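(* Let $k\ge 1$ be a fixed integer and let $\sigma\ge k+1$. Suppose that $\varepsilon\le C_0N^{-1}$ for a fixed constant $C_0$. Let $u$ be the solution of the boundary value problem $-\varepsilon u''+bu'+cu=f$ on $(0,1)$, $u(0)=u(1)=0$. Let $u_N\in V_N^k$ be the NIPG solution on the Bakhvalov-type mesh with parameter $\sigma$, with penalty parameters $\mu(x_j)=1$ for $0\le j\le N/2$ and $\mu(x_j)=N^2$ for $N/2+1\le j\le N$. Then $$\Vert u-u_{N}\Vert_{NIPG}\le CN^{-k},$$ where $C>0$ is independent of $\varepsilon$ and $N$.
   Context: **Continuous problem.** $\Omega=(0,1)$, $0<\varepsilon\ll1$ is a perturbation parameter, and $u$ solves $-\varepsilon u''(x)+b(x)u'(x)+c(x)u(x)=f(x)$ on $\Omega$, $u(0)=u(1)=0$. Here $b,c,f$ are independent of $\varepsilon$ and sufficiently smooth (of class $C^m(\bar\Omega)$ with $m$ large enough depending only on $k$), $b(x)\ge\alpha>0$ and $c(x)-\frac12 b'(x)\ge\gamma>0$ on $\bar\Omega$, with fixed constants $\alpha,\gamma$. It is known (and may be used) that $u=S+E$ with $LS=f$, $LE=0$ (where $Lv=-\varepsilon v''+bv'+cv$) and $|S^{(l)}(x)|\le C$, $|E^{(l)}(x)|\le C\varepsilon^{-l}e^{-\alpha(1-x)/\varepsilon}$ for $0\le l\le q$, where $q$ can be any given positive integer provided $b,c,f$ are smooth enough. **Mesh.** $N\ge4$ is an even integer. $\tau=1+\frac{\sigma\varepsilon}{\alpha}\ln\varepsilon$ is assumed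 to satisfy $\tau\ge1/2$. The mesh points are $x_j=\psi(j/N)$, $j=0,\dots,N$, where $\psi(t)=2\tau t$ for $t\in[0,\frac12)$ and $\psi(t)=1+\frac{\sigma\varepsilon}{\alpha}\ln[1+2(1-\varepsilon)(t-1)]$ for $t\in[\frac12,1]$ (so $x_{N/2}=\tau$). $I_j=[x_{j-1},x_j]$. **Spaces, jumps, averages.** $V_N^k=\{v\in L^2(\Omega): v|_{I_j}\in\mathbb P_k(I_j),\ j=1,\dots,N\}$, with $\mathbb P_k$ the polynomials of degree at most $k$. For a piecewise smooth function $w$, with one-sided limits $w(x_j^\pm)$: $[w(x_j)]=w(x_j^-)-w(x_j^+)$, $\{w(x_j)\}=\frac12(w(x_j^+)+w(x_j^-))$ for $1\le j\le N-1$; $[w(x_0)]=-w(x_0^+)$, $\{w(x_0)\}=w(x_0^+)$, $[w(x_N)]=w(x_N^-)$, $\{w(x_N)\}=w(x_N^-)$. **NIPG method.** $u_N\in V_N^k$ is the unique solution of $B(u_N,v)=\sum_{j=1}^N\int_{I_j}fv\,dx$ for all $v\in V_N^k$, where $$B(w,v)=\sum_{j=1}^N\int_{I_j}\varepsilon w'v'\,dx-\varepsilon\sum_{j=0}^N\{w'(x_j)\}[v(x_j)]+\varepsilon\sum_{j=0}^N[w(x_j)]\{v'(x_j)\}+\sum_{j=0}^N\mu(x_j)[w(x_j)][v(x_j)]$$ $$\qquad+\sum_{j=1}^N\int_{I_j}b\,w'v\,dx-\sum_{j=0}^{N-1}b(x_j)[w(x_j)]v(x_j^+)+\sum_{j=1}^N\int_{I_j}c\,wv\,dx.$$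 **Norm.** For piecewise $H^1$ functions $v$, $$\Vert v\Vert_{NIPG}^2=\varepsilon\sum_{j=1}^N\Vert v'\Vert_{L^2(I_j)}^2+\gamma\sum_{j=1}^N\Vert v\Vert_{L^2(I_j)}^2+\sum_{j=0}^N\left(\mu(x_j)+\tfrac12b(x_j)\right)[v(x_j)]^2.$$ **Constants.** $C$ denotes a positive constant independent of $\varepsilon$ and $N$ (it may depend on $k,\sigma,\alpha,\gamma,b,c,f,C_0$). *)

(* Defs.v *)
From Stdlib Require Import Reals Arith.
From Coquelicot Require Import Coquelicot.

Open Scope R_scope.

Definition unit_interval (x : R) : Prop := 0 <= x <= 1.

(* Derivative relative to [0,1], hence one-sided at the two endpoints. *)
Definition is_derivative_on_unit (g g' : R -> R) : Prop :=
  forall x, unit_interval x -> D_in g g' unit_interval x.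

(* g belongs to C^m([0,1]); D i is the i-th derivative of g.  Values of g
   outside [0,1] play no role. *)
Definition Cm_unit (m : nat) (g : R -> R) : Prop :=
  exists D : nat -> R -> R,
    (forall x, unit_interval x -> D 0%nat x = g x) /\
    (forall i, (i < m)%nat -> is_derivative_on_unit (D i) (D (S i))) /\
    continuous_on unit_interval (D m).

(* Classical solution, in C([0,1]) and twice differentiable in (0,1); u'' is
   then continuous by the equation when b, c, f are. *)
Definition solves_bvp (eps : R) (b c f u : R -> R) : Prop :=
  continuous_on unit_interval u /\
  (forall x, 0 < x < 1 ->
     ex_derive u x /\ ex_derive (Derive u) x /\
     - eps * Derive_n u 2 x + b x * Derive u x + c x * u x = f x) /\
  u 0 = 0 /\ u 1 = 0.

Definition tau (sigma alpha eps : R) : R := 1 + sigma * eps / alpha * ln eps.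

Definition psi (sigma alpha eps t : R) : R :=
  if Rlt_dec t (1 / 2) then 2 * tau sigma alpha eps * t
  else 1 + sigma * eps / alpha * ln (1 + 2 * (1 - eps) * (t - 1)).

Definition mesh (sigma alpha eps : R) (N j : nat) : R :=
  psi sigma alpha eps (INR j / INR N).

(* One-sided limits w(y^-) and w(y^+), total through the unique-choice operator
   iota (meaningful whenever the limit exists). *)
Definition trace_left (w : R -> R) (y : R) : R :=
  iota (fun l : R => filterlim w (at_left y) (locally l)).

Definition trace_right (w : R -> R) (y : R) : R :=
  iota (fun l : R => filterlim w (at_right y) (locally l)).

(* In the following, x : nat -> R lists the mesh points x 0 < ... < x N. *)

Definition jump (x : nat -> R) (N : nat) (w : R -> R) (j : nat) : R :=
  if j =? 0 then - trace_right w (x j)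
  else if j =? N then trace_left w (x j)
  else trace_left w (x j) - trace_right w (x j).

Definition avg (x : nat -> R) (N : nat) (w : R -> R) (j : nat) : R :=
  if j =? 0 then trace_right w (x j)
  else if j =? N then trace_left w (x j)
  else (trace_right w (x j) + trace_left w (x j)) / 2.

(* Elements are functions on R standing for L^2 classes, so nothing is required
   of their values at the mesh points. *)
Definition in_V (x : nat -> R) (N k : nat) (v : R -> R) : Prop :=
  forall j, (1 <= j <= N)%nat ->
    exists a : nat -> R,
      forall y, x (j - 1)%nat < y < x j -> v y = sum_n (fun i => a i * y ^ i) k.

(* sum over 1 <= j <= N of the integral of g over I_j *)
Definition broken_int (x : nat -> R) (N : nat) (g : R -> R) : R :=
  sum_n_m (fun j => RInt g (x (j - 1)%nat) (x j)) 1 N.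

Definition nipg_form (eps : R) (b c : R -> R) (mu x : nat -> R) (N : nat)
    (w v : R -> R) : R :=
  broken_int x N (fun y => eps * Derive w y * Derive v y)
  - eps * sum_n_m (fun j => avg x N (Derive w) j * jump x N v j) 0 N
  + eps * sum_n_m (fun j => jump x N w j * avg x N (Derive v) j) 0 N
  + sum_n_m (fun j => mu j * jump x N w j * jump x N v j) 0 N
  + broken_int x N (fun y => b y * Derive w y * v y)
  - sum_n_m (fun j => b (x j) * jump x N w j * trace_right v (x j)) 0 (N - 1)
  + broken_int x N (fun y => c y * w y * v y).

Definition nipg_solution (eps : R) (b c f : R -> R) (mu x : nat -> R)
    (N k : nat) (uN : R -> R) : Prop :=
  in_V x N k uN /\
  forall v, in_V x N k v ->
    nipg_form eps b c mu x N uN v = broken_int x N (fun y => f y * v y).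

Definition nipg_norm (eps gamma : R) (b : R -> R) (mu x : nat -> R) (N : nat)
    (v : R -> R) : R :=
  sqrt (eps * broken_int x N (fun y => Derive v y ^ 2)
        + gamma * broken_int x N (fun y => v y ^ 2)
        + sum_n_m (fun j => (mu j + b (x j) / 2) * jump x N v j ^ 2) 0 N).

Definition penalty (N j : nat) : R :=
  if j <=? N / 2 then 1 else INR N ^ 2.

(* Main.v *)
(* Write u = S + E + R: S is the regular part of the asymptotic expansion in powers of eps, E the
   WKB expansion of the outflow layer, |E^(l)| <= C eps^-l exp (- alpha (1 - x) / eps), and R, R' are
   O(eps^k) by an energy estimate.  The approximation P of u interpolates S on every cell; E is
   replaced by 0 up to the first layer cell, by an affine function starting from 0 on the second
   one, and interpolated on the others, so that P is continuous and vanishes at 0 and 1.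
   Coercivity and Galerkin orthogonality reduce the theorem to bounding B(u - P, uN - P), where
   u - P has no jumps.  The only delicate term is the convective one in the layer, where (E - P_E)'
   is of size N^-k / eps: it is integrated by parts against E - P_E - E(tau), whose L^2 norm is
   O(sqrt eps N^-k).  Subtracting the constant E(tau) removes the boundary term at the transition
   point tau; the remaining ones meet only jumps of uN - P, controlled by the penalty N^2.
   For eps > 1/2 the number of cells is bounded and P = 0 suffices. *)

Require Import Defs.
From Stdlib Require Import Reals Arith Lra Lia.
From Coquelicot Require Import Coquelicot.

Open Scope R_scope.

(** Interpolating [E] on the first layer cell would not do: the width of that cell is of order eps
    ln (D / eps) with D of order 1 / N, so logarithms unbounded in [eps] would enter. The value 0
    costs only the size of [E], which is O(N^-(k+1)) up to the second node after tau. The slope of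
    the affine piece is O(N^-(k+1) / eps), because eps <= C0 / N bounds the width of its cell below
    by a multiple of [eps]. The same assumption turns O(eps^k) into O(N^-k). The error is split into
    a part that is O(K) in C^1, with K of order N^-k, and a layer part Z measured by eps^-1 Z^2 and
    eps Z'^2, the weights that Young's inequality asks for. There are about N cells and nodes, so
    each is granted a share K^2 / N. On the fine side the penalty N^2 leaves a factor N to spare; on
    the coarse side, with penalty 1, the missing 1 / N must come from [eps] itself. The expansions
    are carried to order k + 2 since the energy estimate loses eps^-2; they live on a neighbourhood
    of [0,1], so that all derivatives are two-sided. *)

Lemma INR_ge_1 (n : nat) : (1 <= n)%nat -> 1 <= INR n.
Proof. intros H. change 1 with (INR 1). now apply le_INR. Qed.

Lemma Rinv_le_1 (a : R) : 1 <= a -> / a <= 1.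
Proof. intros H. rewrite <- Rinv_1. apply Rinv_le_contravar; lra. Qed.

Lemma ball_Rabs (x y e : R) : ball x e y -> Rabs (y - x) < e.
Proof. exact (fun H => H). Qed.

(** * Continuity and derivatives of real functions *)

Lemma continuous_Rplus (f g : R -> R) (x : R) :
  continuous f x -> continuous g x -> continuous (fun y => f y + g y) x.
Proof. exact (continuous_plus f g x). Qed.

Lemma continuous_Ropp (f : R -> R) (x : R) :
  continuous f x -> continuous (fun y => - f y) x.
Proof. exact (continuous_opp f x). Qed.

Lemma continuous_Rminus (f g : R -> R) (x : R) :
  continuous f x -> continuous g x -> continuous (fun y => f y - g y) x.
Proof. exact (continuous_minus f g x). Qed.

Lemma continuous_Rmult (f g : R -> R) (x : R) :
  continuous f x -> continuous g x -> continuous (fun y => f y * g y) x.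
Proof. exact (continuous_mult f g x). Qed.

Lemma continuous_Rsqr (f : R -> R) (x : R) :
  continuous f x -> continuous (fun y => f y ^ 2) x.
Proof.
  intros H. apply continuous_ext with (fun y => f y * f y).
  - intros y; simpl; ring.
  - now apply continuous_Rmult.
Qed.

Lemma is_derive_continuous (f : R -> R) (x l : R) :
  is_derive f x l -> continuous f x.
Proof. intros H. apply @ex_derive_continuous. now exists l. Qed.

Lemma continuous_exp_comp (f : R -> R) (x : R) :
  continuous f x -> continuous (fun y => exp (f y)) x.
Proof.
  intros H. apply (continuous_comp f exp); trivial.
  apply is_derive_continuous with (exp (f x)). apply is_derive_exp.
Qed.

Ltac solve_continuous :=
  lazymatch goal with
  | |- continuous (fun _ => ?c) _ => apply continuous_const
  | |- continuous (fun y => y) _ => apply continuous_id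
  | |- continuous (fun y => @?f y + @?g y) ?x =>
      apply (continuous_Rplus f g x); solve_continuous
  | |- continuous (fun y => @?f y - @?g y) ?x =>
      apply (continuous_Rminus f g x); solve_continuous
  | |- continuous (fun y => - @?f y) ?x => apply (continuous_Ropp f x); solve_continuous
  | |- continuous (fun y => @?f y * @?g y) ?x =>
      apply (continuous_Rmult f g x); solve_continuous
  | |- continuous (fun y => @?f y / ?c) ?x =>
      apply (continuous_Rmult f (fun _ => / c) x); solve_continuous
  | |- continuous (fun y => @?f y ^ 2) ?x => apply (continuous_Rsqr f x); solve_continuous
  | |- continuous (fun y => exp (@?f y)) ?x => apply (continuous_exp_comp f x); solve_continuous
  | |- _ => try (eauto; fail)
  end.

Lemma is_derive_Rplus (f g : R -> R) (x a b : R) :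
  is_derive f x a -> is_derive g x b -> is_derive (fun y => f y + g y) x (a + b).
Proof. exact (is_derive_plus f g x a b). Qed.

Lemma is_derive_Rminus (f g : R -> R) (x a b : R) :
  is_derive f x a -> is_derive g x b -> is_derive (fun y => f y - g y) x (a - b).
Proof. exact (is_derive_minus f g x a b). Qed.

Lemma is_derive_Ropp (f : R -> R) (x a : R) :
  is_derive f x a -> is_derive (fun y => - f y) x (- a).
Proof. exact (is_derive_opp f x a). Qed.

Lemma is_derive_Rmult (f g : R -> R) (x a b : R) :
  is_derive f x a -> is_derive g x b ->
  is_derive (fun y => f y * g y) x (a * g x + f x * b).
Proof. intros Hf Hg. apply (is_derive_mult f g x a b Hf Hg). intros; apply Rmult_comm. Qed.

Lemma is_derive_Rsqr (f : R -> R) (x a : R) :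
  is_derive f x a -> is_derive (fun y => f y ^ 2) x (2 * f x * a).
Proof.
  intros H. apply is_derive_ext with (fun y => f y * f y).
  - intros y; simpl; ring.
  - replace (2 * f x * a) with (a * f x + f x * a) by ring. now apply is_derive_Rmult.
Qed.

Lemma is_derive_exp_comp (f : R -> R) (x a : R) :
  is_derive f x a -> is_derive (fun y => exp (f y)) x (a * exp (f x)).
Proof.
  intros H. apply (is_derive_comp exp f x (exp (f x)) a); trivial.
  apply is_derive_exp.
Qed.

Lemma is_derive_eq (f : R -> R) (x a b : R) : is_derive f x a -> a = b -> is_derive f x b.
Proof. now intros H <-. Qed.

Lemma is_derive_const0 (c x : R) : is_derive (fun _ : R => c) x 0.
Proof. exact (is_derive_const c x). Qed.

Lemma is_derive_id1 (x : R) : is_derive (fun y : R => y) x 1.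
Proof. exact (is_derive_id x). Qed.

(** The derivative is synthesised as a unification variable along the term, its leaves coming from
    hypotheses on abstract functions; [solve_derive] leaves only the algebraic identity with the
    prescribed value. *)
Ltac derive_step :=
  lazymatch goal with
  | |- is_derive (fun y => y) _ _ => apply is_derive_id1
  | |- is_derive (fun _ => ?c) _ _ => apply is_derive_const0
  | |- is_derive (fun y => @?f y + @?g y) ?x _ => eapply (is_derive_Rplus f g x); derive_step
  | |- is_derive (fun y => @?f y - @?g y) ?x _ => eapply (is_derive_Rminus f g x); derive_step
  | |- is_derive (fun y => - @?f y) ?x _ => eapply (is_derive_Ropp f x); derive_step
  | |- is_derive (fun y => @?f y * @?g y) ?x _ => eapply (is_derive_Rmult f g x); derive_step
  | |- is_derive (fun y => @?f y / ?c) ?x _ =>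
      eapply (is_derive_Rmult f (fun _ => / c) x); derive_step
  | |- is_derive (fun y => @?f y ^ 2) ?x _ => eapply (is_derive_Rsqr f x); derive_step
  | |- is_derive (fun y => exp (@?f y)) ?x _ => eapply (is_derive_exp_comp f x); derive_step
  | |- _ => try (eauto; fail)
  end.

Ltac solve_derive := eapply is_derive_eq; [derive_step | cbv beta].

Ltac solve_side := try lra; try (intros y Hy; solve_continuous; fail).

(** * Integrals of continuous functions *)

(** Continuity is two-sided even at the endpoints. Functions attached to a cell are therefore
    regular across its ends, and derivatives and integrals can be used there without one-sided
    notions. *)
Definition cont_on (a b : R) (f : R -> R) : Prop :=
  forall x, a <= x <= b -> continuous f x.

Lemma cont_on_ex_RInt (f : R -> R) (a b : R) :
  a <= b -> cont_on a b f -> ex_RInt f a b.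
Proof.
  intros Hab H. apply @ex_RInt_continuous. intros z.
  rewrite Rmin_left, Rmax_right by lra. apply H.
Qed.

Lemma RInt_Rplus (f g : R -> R) (a b : R) :
  a <= b -> cont_on a b f -> cont_on a b g ->
  RInt (fun y => f y + g y) a b = RInt f a b + RInt g a b.
Proof. intros; apply (RInt_plus f g a b); now apply cont_on_ex_RInt. Qed.

Lemma RInt_Rminus (f g : R -> R) (a b : R) :
  a <= b -> cont_on a b f -> cont_on a b g ->
  RInt (fun y => f y - g y) a b = RInt f a b - RInt g a b.
Proof. intros; apply (RInt_minus f g a b); now apply cont_on_ex_RInt. Qed.

Lemma RInt_Rscal (f : R -> R) (a b l : R) :
  a <= b -> cont_on a b f -> RInt (fun y => l * f y) a b = l * RInt f a b.
Proof. intros; apply (RInt_scal f a b l); now apply cont_on_ex_RInt. Qed.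

Lemma RInt_mono (f g : R -> R) (a b : R) :
  a <= b -> cont_on a b f -> cont_on a b g ->
  (forall x, a < x < b -> f x <= g x) -> RInt f a b <= RInt g a b.
Proof. intros; apply RInt_le; trivial; now apply cont_on_ex_RInt. Qed.

Lemma RInt_eq_open (f g : R -> R) (a b : R) :
  a <= b -> (forall x, a < x < b -> f x = g x) -> RInt f a b = RInt g a b.
Proof.
  intros Hab H. apply RInt_ext. intros x. rewrite Rmin_left, Rmax_right by lra. apply H.
Qed.

Lemma RInt_constR (a b c : R) : RInt (fun _ => c) a b = c * (b - a).
Proof. rewrite RInt_const. apply Rmult_comm. Qed.

Lemma RInt_FTC (f df : R -> R) (a b : R) :
  a <= b -> (forall x, a <= x <= b -> is_derive f x (df x)) -> cont_on a b df ->
  RInt df a b = f b - f a.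
Proof.
  intros Hab Hd Hc. apply is_RInt_unique. apply (is_RInt_derive f df a b);
  rewrite Rmin_left, Rmax_right by lra; trivial.
Qed.

Lemma RInt_ge0 (f : R -> R) (a b : R) :
  a <= b -> cont_on a b f -> (forall x, a < x < b -> 0 <= f x) -> 0 <= RInt f a b.
Proof.
  intros Hab Hf Hp. rewrite <- (Rmult_0_l (b - a)), <- RInt_constR.
  apply RInt_mono; trivial. intros x _; apply continuous_const.
Qed.

Lemma RInt_le_const (f : R -> R) (a b M : R) :
  a <= b -> cont_on a b f -> (forall x, a < x < b -> f x <= M) ->
  RInt f a b <= M * (b - a).
Proof.
  intros Hab Hf Hp. rewrite <- RInt_constR.
  apply RInt_mono; trivial. intros x _; apply continuous_const.
Qed.

Lemma Rabs_diff_le_of_derive (f df : R -> R) (a b M : R) :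
  a <= b -> (forall x, a <= x <= b -> is_derive f x (df x)) ->
  (forall x, a <= x <= b -> Rabs (df x) <= M) ->
  Rabs (f b - f a) <= M * (b - a).
Proof.
  intros Hab Hd HM.
  destruct (MVT_gen f a b df) as [c [Hc He]]; rewrite ?Rmin_left, ?Rmax_right in * by lra.
  - intros x Hx; apply Hd; lra.
  - intros x Hx. apply continuity_pt_filterlim. apply is_derive_continuous with (df x).
    apply Hd; lra.
  - rewrite He, Rabs_mult, (Rabs_right (b - a)) by lra.
    apply Rmult_le_compat_r; [lra | now apply HM].
Qed.

(** * Finite sums of reals *)

Definition Rsum (f : nat -> R) (m n : nat) : R := sum_n_m f m n.

Lemma Rsum_S (f : nat -> R) (m n : nat) :
  (m <= S n)%nat -> Rsum f m (S n) = Rsum f m n + f (S n).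
Proof. intros H; unfold Rsum; now rewrite sum_n_Sm. Qed.

Lemma Rsum_1_0 (f : nat -> R) : Rsum f 1 0 = 0.
Proof. unfold Rsum; rewrite sum_n_m_zero by lia; reflexivity. Qed.

Lemma Rsum_0_0 (f : nat -> R) : Rsum f 0 0 = f 0%nat.
Proof. unfold Rsum; now rewrite sum_n_n. Qed.

Lemma Rsum_last (f : nat -> R) (n : nat) :
  (1 <= n)%nat -> Rsum f 0 n = Rsum f 0 (n - 1) + f n.
Proof.
  intros H. destruct n as [|n]; [lia|]. rewrite Rsum_S by lia.
  now replace (S n - 1)%nat with n by lia.
Qed.

Lemma Rsum_plus (f g : nat -> R) (m n : nat) :
  Rsum (fun j => f j + g j) m n = Rsum f m n + Rsum g m n.
Proof. exact (sum_n_m_plus f g m n). Qed.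

Lemma Rsum_scal (a : R) (f : nat -> R) (m n : nat) :
  Rsum (fun j => a * f j) m n = a * Rsum f m n.
Proof. exact (sum_n_m_mult_l a f m n). Qed.

Lemma Rsum_ext (f g : nat -> R) (m n : nat) :
  (forall j, (m <= j <= n)%nat -> f j = g j) -> Rsum f m n = Rsum g m n.
Proof. intros; now apply sum_n_m_ext_loc. Qed.

Lemma Rsum_minus (f g : nat -> R) (m n : nat) :
  Rsum (fun j => f j - g j) m n = Rsum f m n - Rsum g m n.
Proof.
  unfold Rminus. rewrite Rsum_plus. f_equal.
  transitivity (Rsum (fun j => (-1) * g j) m n).
  - apply Rsum_ext; intros; ring.
  - rewrite Rsum_scal; ring.
Qed.

Lemma Rsum_le (f g : nat -> R) (m n : nat) :
  (forall j, (m <= j <= n)%nat -> f j <= g j) -> Rsum f m n <= Rsum g m n.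
Proof.
  intros H. induction n as [|n IH].
  - destruct m as [|m].
    + rewrite !Rsum_0_0; apply H; lia.
    + unfold Rsum; rewrite !sum_n_m_zero by lia; apply Rle_refl.
  - destruct (Nat.le_gt_cases m (S n)) as [Hm|Hm].
    + rewrite !Rsum_S by trivial. apply Rplus_le_compat.
      * apply IH; intros; apply H; lia.
      * apply H; lia.
    + unfold Rsum; rewrite !sum_n_m_zero by lia; apply Rle_refl.
Qed.

Lemma Rsum_ge0 (f : nat -> R) (m n : nat) :
  (forall j, (m <= j <= n)%nat -> 0 <= f j) -> 0 <= Rsum f m n.
Proof.
  intros H. replace 0 with (Rsum (fun _ => 0 * 0) m n).
  - apply Rsum_le; intros j Hj; rewrite Rmult_0_l; auto.
  - rewrite (Rsum_scal 0 (fun _ => 0)); ring.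
Qed.

Lemma Rsum_const_1 (c : R) (n : nat) : Rsum (fun _ => c) 1 n = INR n * c.
Proof.
  induction n as [|n IH]; [rewrite Rsum_1_0; simpl; ring|].
  rewrite Rsum_S, IH, S_INR by lia; ring.
Qed.

Lemma Rsum_const_0 (c : R) (n : nat) : Rsum (fun _ => c) 0 n = (INR n + 1) * c.
Proof.
  induction n as [|n IH]; [rewrite Rsum_0_0; simpl; ring|].
  rewrite Rsum_S, IH, S_INR by lia; ring.
Qed.

(** Regrouping from cells to nodes: [A] plays the left trace and [B] the right trace. Node 0 has no
    cell on its left, hence the condition on [A]; the surplus [B N] disappears in the applications
    because the right trace at [N] is 0. *)
Lemma Rsum_telescope (A B : nat -> R) (N : nat) :
  A 0%nat = 0 -> (1 <= N)%nat ->
  Rsum (fun j => A j - B (j - 1)%nat) 1 N = Rsum (fun j => A j - B j) 0 N + B N.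
Proof.
  intros HA HN. induction N as [|N IH]; [lia|].
  destruct N as [|N].
  - rewrite !Rsum_S, Rsum_1_0, Rsum_0_0, HA by lia; simpl; ring.
  - rewrite (Rsum_S _ 1), (Rsum_S _ 0), IH by lia.
    replace (S (S N) - 1)%nat with (S N) by lia; ring.
Qed.

(** * Piecewise functions, traces and the bilinear form *)

Record is_mesh (x : nat -> R) (N : nat) : Prop := {
  mesh_pos : (1 <= N)%nat;
  mesh_0 : x 0%nat = 0;
  mesh_N : x N = 1;
  mesh_lt : forall j, (1 <= j <= N)%nat -> x (j - 1)%nat < x j
}.

Lemma mesh_mono (x : nat -> R) (N i j : nat) :
  is_mesh x N -> (i <= j <= N)%nat -> x i <= x j.
Proof.
  intros Hx. induction j as [|j IH]; intros H.
  - replace i with 0%nat by lia; lra.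
  - destruct (Nat.eq_dec i (S j)) as [->|Hn]; [lra|].
    assert (H1 := mesh_lt x N Hx (S j)). replace (S j - 1)%nat with j in H1 by lia.
    assert (x i <= x j) by (apply IH; lia). assert (x j < x (S j)) by (apply H1; lia). lra.
Qed.

Lemma mesh_range (x : nat -> R) (N j : nat) :
  is_mesh x N -> (j <= N)%nat -> 0 <= x j <= 1.
Proof.
  intros Hx Hj. split.
  - rewrite <- (mesh_0 x N Hx). apply mesh_mono with N; trivial; lia.
  - rewrite <- (mesh_N x N Hx). apply mesh_mono with N; trivial; lia.
Qed.

Lemma cell_unit (x : nat -> R) (N j : nat) (y : R) :
  is_mesh x N -> (1 <= j <= N)%nat -> x (j - 1)%nat <= y <= x j -> 0 <= y <= 1.
Proof.
  intros Hx Hj Hy. assert (H1 := mesh_range x N (j - 1) Hx). assert (H2 := mesh_range x N j Hx).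
  assert (0 <= x (j - 1)%nat <= 1) by (apply H1; lia).
  assert (0 <= x j <= 1) by (apply H2; lia). lra.
Qed.

(* A function that is C^1 on every closed cell is encoded by families [W] and [W'] indexed by the
   cell number; the value of the function at the mesh points is then irrelevant. *)
Definition cellwise_C1 (x : nat -> R) (N : nat) (W W' : nat -> R -> R) : Prop :=
  forall j, (1 <= j <= N)%nat -> forall y, x (j - 1)%nat <= y <= x j ->
    is_derive (W j) y (W' j y) /\ continuous (W' j) y.

Definition represents (x : nat -> R) (N : nat) (w : R -> R) (W : nat -> R -> R) : Prop :=
  forall j, (1 <= j <= N)%nat -> forall y, x (j - 1)%nat < y < x j -> w y = W j y.

Lemma cellwise_C1_minus (x : nat -> R) (N : nat) (V V' W W' : nat -> R -> R) :
  cellwise_C1 x N V V' -> cellwise_C1 x N W W' ->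
  cellwise_C1 x N (fun j y => V j y - W j y) (fun j y => V' j y - W' j y).
Proof.
  intros HV HW j Hj y Hy. destruct (HV j Hj y Hy), (HW j Hj y Hy). split.
  - now apply is_derive_Rminus.
  - now apply continuous_Rminus.
Qed.

Lemma cellwise_C1_cont (x : nat -> R) (N : nat) (V V' : nat -> R -> R) (j : nat) :
  cellwise_C1 x N V V' -> (1 <= j <= N)%nat ->
  cont_on (x (j - 1)%nat) (x j) (V j) /\ cont_on (x (j - 1)%nat) (x j) (V' j).
Proof.
  intros HV Hj; split; intros y Hy; destruct (HV j Hj y Hy) as [H1 H2]; trivial.
  now apply is_derive_continuous with (V' j y).
Qed.

Lemma iota_unique (P : R -> Prop) (l : R) :
  P l -> (forall l', P l' -> l' = l) -> iota P = l.
Proof.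
  intros Hl Hu. apply Hu. apply (iota_correct P). exists l. split; trivial.
  intros l' Hl'. symmetry; now apply Hu.
Qed.

(** The filter [at_left y] only sees the cell, where [w] agrees with a function continuous across
    [y]; uniqueness of limits then determines the value of [iota], whatever [w] is at the node. *)
Lemma trace_left_eq (w W : R -> R) (p y : R) :
  p < y -> continuous W y -> (forall z, p < z < y -> w z = W z) ->
  trace_left w y = W y.
Proof.
  intros Hp Hc He.
  assert (Hl : filterlim w (at_left y) (locally (W y))).
  { apply (filterlim_ext_loc (F := at_left y) (G := locally (W y)) W w).
    - exists (mkposreal (y - p) ltac:(lra)). intros z Hz Hzy.
      symmetry; apply He. apply ball_Rabs in Hz; simpl in Hz.
      apply Rabs_def2 in Hz; lra.
    - apply (filterlim_filter_le_1 (F := locally y) W); [apply filter_le_within | exact Hc]. }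
  apply iota_unique; trivial.
  intros l' Hl'. now apply (filterlim_locally_unique (F := at_left y) w).
Qed.

Lemma trace_right_eq (w W : R -> R) (q y : R) :
  y < q -> continuous W y -> (forall z, y < z < q -> w z = W z) ->
  trace_right w y = W y.
Proof.
  intros Hp Hc He.
  assert (Hl : filterlim w (at_right y) (locally (W y))).
  { apply (filterlim_ext_loc (F := at_right y) (G := locally (W y)) W w).
    - exists (mkposreal (q - y) ltac:(lra)). intros z Hz Hzy.
      symmetry; apply He. apply ball_Rabs in Hz; simpl in Hz.
      apply Rabs_def2 in Hz; lra.
    - apply (filterlim_filter_le_1 (F := locally y) W); [apply filter_le_within | exact Hc]. }
  apply iota_unique; trivial.
  intros l' Hl'. now apply (filterlim_locally_unique (F := at_right y) w).
Qed.

(* Extending by [0] outside [0,1] makes the jump at every node, endpoints included,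
   equal to [lval - rval]. *)
Definition lval (x : nat -> R) (V : nat -> R -> R) (j : nat) : R :=
  if j =? 0 then 0 else V j (x j).

Definition rval (x : nat -> R) (N : nat) (V : nat -> R -> R) (j : nat) : R :=
  if j =? N then 0 else V (S j) (x j).

Definition cjump (x : nat -> R) (N : nat) (V : nat -> R -> R) (j : nat) : R :=
  lval x V j - rval x N V j.

Definition cavg (x : nat -> R) (N : nat) (V : nat -> R -> R) (j : nat) : R :=
  if j =? 0 then rval x N V j
  else if j =? N then lval x V j
  else (rval x N V j + lval x V j) / 2.

Lemma trace_right_rval (x : nat -> R) (N : nat) (w : R -> R) (W : nat -> R -> R) (j : nat) :
  is_mesh x N -> represents x N w W ->
  (forall i, (1 <= i <= N)%nat -> cont_on (x (i - 1)%nat) (x i) (W i)) ->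
  (j < N)%nat -> trace_right w (x j) = rval x N W j.
Proof.
  intros Hx Hw Hc Hj. unfold rval.
  replace (j =? N) with false by (symmetry; apply Nat.eqb_neq; lia).
  assert (H := mesh_lt x N Hx (S j)). assert (H1 := Hw (S j)). assert (H2 := Hc (S j)).
  replace (S j - 1)%nat with j in * by lia.
  apply trace_right_eq with (x (S j)).
  - apply H; lia.
  - apply H2; [lia|]. assert (x j < x (S j)) by (apply H; lia). lra.
  - apply H1; lia.
Qed.

Lemma trace_left_lval (x : nat -> R) (N : nat) (w : R -> R) (W : nat -> R -> R) (j : nat) :
  is_mesh x N -> represents x N w W ->
  (forall i, (1 <= i <= N)%nat -> cont_on (x (i - 1)%nat) (x i) (W i)) ->
  (1 <= j <= N)%nat -> trace_left w (x j) = lval x W j.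
Proof.
  intros Hx Hw Hc Hj. unfold lval.
  replace (j =? 0) with false by (symmetry; apply Nat.eqb_neq; lia).
  assert (H := mesh_lt x N Hx j Hj).
  apply trace_left_eq with (x (j - 1)%nat); trivial.
  - apply Hc; trivial. lra.
  - now apply Hw.
Qed.

Lemma jump_cjump (x : nat -> R) (N : nat) (w : R -> R) (W : nat -> R -> R) (j : nat) :
  is_mesh x N -> represents x N w W ->
  (forall i, (1 <= i <= N)%nat -> cont_on (x (i - 1)%nat) (x i) (W i)) ->
  (j <= N)%nat -> jump x N w j = cjump x N W j.
Proof.
  intros Hx Hw Hc Hj. unfold jump, cjump. assert (HN := mesh_pos x N Hx).
  destruct (Nat.eqb_spec j 0) as [->|H0].
  - rewrite (trace_right_rval x N w W 0) by (trivial; lia).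
    unfold lval; simpl. ring.
  - destruct (Nat.eqb_spec j N) as [->|H1].
    + rewrite (trace_left_lval x N w W N) by (trivial; lia).
      unfold rval; rewrite Nat.eqb_refl; ring.
    + rewrite (trace_left_lval x N w W j), (trace_right_rval x N w W j) by (trivial; lia).
      reflexivity.
Qed.

Lemma avg_cavg (x : nat -> R) (N : nat) (w : R -> R) (W : nat -> R -> R) (j : nat) :
  is_mesh x N -> represents x N w W ->
  (forall i, (1 <= i <= N)%nat -> cont_on (x (i - 1)%nat) (x i) (W i)) ->
  (j <= N)%nat -> avg x N w j = cavg x N W j.
Proof.
  intros Hx Hw Hc Hj. unfold avg, cavg. assert (HN := mesh_pos x N Hx).
  destruct (Nat.eqb_spec j 0) as [->|H0].
  - apply trace_right_rval; trivial; lia.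
  - destruct (Nat.eqb_spec j N) as [->|H1].
    + apply trace_left_lval with N; trivial; lia.
    + rewrite (trace_left_lval x N w W j), (trace_right_rval x N w W j) by (trivial; lia).
      reflexivity.
Qed.

Lemma represents_Derive (x : nat -> R) (N : nat) (w : R -> R) (W W' : nat -> R -> R) :
  represents x N w W -> cellwise_C1 x N W W' -> represents x N (Derive w) W'.
Proof.
  intros Hw HW j Hj y Hy. apply is_derive_unique.
  destruct (HW j Hj y) as [Hd _]; [lra|].
  apply is_derive_ext_loc with (W j); trivial.
  assert (Hpos : 0 < Rmin (y - x (j - 1)%nat) (x j - y)) by (apply Rmin_pos; lra).
  exists (mkposreal _ Hpos). intros z Hz.
  apply ball_Rabs in Hz; simpl in Hz.
  assert (H1 := Rmin_l (y - x (j - 1)%nat) (x j - y)).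
  assert (H2 := Rmin_r (y - x (j - 1)%nat) (x j - y)).
  apply Rabs_def2 in Hz. symmetry; apply Hw; trivial. lra.
Qed.

(** The NIPG form with cell integrals and nodal terms collected. The upwind sum may run up to [N]
    instead of [N - 1], since [rval] vanishes at the last node. *)
Definition cell_form (eps : R) (b c : R -> R) (mu x : nat -> R) (N : nat)
    (W W' V V' : nat -> R -> R) : R :=
  Rsum (fun j => RInt (fun y => eps * W' j y * V' j y + b y * W' j y * V j y
                                + c y * W j y * V j y) (x (j - 1)%nat) (x j)) 1 N
  + Rsum (fun j => - eps * cavg x N W' j * cjump x N V j
                   + eps * cjump x N W j * cavg x N V' j
                   + mu j * cjump x N W j * cjump x N V j
                   - b (x j) * cjump x N W j * rval x N V j) 0 N.

Lemma broken_int_Rsum (x : nat -> R) (N : nat) (g : R -> R) :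
  broken_int x N g = Rsum (fun j => RInt g (x (j - 1)%nat) (x j)) 1 N.
Proof. reflexivity. Qed.

(** [b1], [c1] are the given coefficients, meaningful on [0,1] only; [b], [c] are extensions of
    them, continuous at the endpoints too. The estimates that follow concern the extensions. *)
Lemma nipg_form_cell_form (eps : R) (b c b1 c1 : R -> R) (mu x : nat -> R) (N : nat)
    (w v : R -> R) (W W' V V' : nat -> R -> R) :
  is_mesh x N -> cont_on 0 1 b -> cont_on 0 1 c ->
  (forall y, unit_interval y -> b1 y = b y) -> (forall y, unit_interval y -> c1 y = c y) ->
  represents x N w W -> cellwise_C1 x N W W' ->
  represents x N v V -> cellwise_C1 x N V V' ->
  nipg_form eps b1 c1 mu x N w v = cell_form eps b c mu x N W W' V V'.
Proof.
  intros Hx Hb Hc Hb1 Hc1 Hw HW Hv HV.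
  assert (Hw' := represents_Derive x N w W W' Hw HW).
  assert (Hv' := represents_Derive x N v V V' Hv HV).
  assert (HN := mesh_pos x N Hx).
  assert (cW : forall i, (1 <= i <= N)%nat -> cont_on (x (i - 1)%nat) (x i) (W i))
    by (intros; now apply (cellwise_C1_cont x N W W')).
  assert (cW' : forall i, (1 <= i <= N)%nat -> cont_on (x (i - 1)%nat) (x i) (W' i))
    by (intros; now apply (cellwise_C1_cont x N W W')).
  assert (cV : forall i, (1 <= i <= N)%nat -> cont_on (x (i - 1)%nat) (x i) (V i))
    by (intros; now apply (cellwise_C1_cont x N V V')).
  assert (cV' : forall i, (1 <= i <= N)%nat -> cont_on (x (i - 1)%nat) (x i) (V' i))
    by (intros; now apply (cellwise_C1_cont x N V V')).
  assert (cb : forall i, (1 <= i <= N)%nat -> cont_on (x (i - 1)%nat) (x i) b)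
    by (intros i Hi y Hy; apply Hb; now apply cell_unit with x N i).
  assert (cc : forall i, (1 <= i <= N)%nat -> cont_on (x (i - 1)%nat) (x i) c)
    by (intros i Hi y Hy; apply Hc; now apply cell_unit with x N i).
  unfold nipg_form, cell_form. rewrite !broken_int_Rsum.
  fold (Rsum (fun j => avg x N (Derive w) j * jump x N v j) 0 N).
  fold (Rsum (fun j => jump x N w j * avg x N (Derive v) j) 0 N).
  fold (Rsum (fun j => mu j * jump x N w j * jump x N v j) 0 N).
  fold (Rsum (fun j => b1 (x j) * jump x N w j * trace_right v (x j)) 0 (N - 1)).
  rewrite (Rsum_ext (fun j => RInt (fun y => eps * W' j y * V' j y + b y * W' j y * V j y
                                + c y * W j y * V j y) (x (j - 1)%nat) (x j))
    (fun j => RInt (fun y => eps * Derive w y * Derive v y) (x (j - 1)%nat) (x j)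
     + RInt (fun y => b1 y * Derive w y * v y) (x (j - 1)%nat) (x j)
     + RInt (fun y => c1 y * w y * v y) (x (j - 1)%nat) (x j)) 1 N).
  2:{ intros j Hj. assert (Hlt := mesh_lt x N Hx j Hj).
    assert (cu := fun y => cell_unit x N j y Hx Hj).
    rewrite (RInt_eq_open (fun y => eps * Derive w y * Derive v y)
      (fun y => eps * W' j y * V' j y))
      by (try lra; intros y Hy; rewrite (Hw' j), (Hv' j) by trivial; reflexivity).
    rewrite (RInt_eq_open (fun y => b1 y * Derive w y * v y) (fun y => b y * W' j y * V j y))
      by (try lra; intros y Hy; rewrite (Hw' j), (Hv j), Hb1 by (trivial; apply cu; lra); reflexivity).
    rewrite (RInt_eq_open (fun y => c1 y * w y * v y) (fun y => c y * W j y * V j y))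
      by (try lra; intros y Hy; rewrite (Hw j), (Hv j), Hc1 by (trivial; apply cu; lra); reflexivity).
    assert (cw := cW j Hj). assert (cw' := cW' j Hj). assert (cv := cV j Hj).
    assert (cv' := cV' j Hj). assert (cb_ := cb j Hj). assert (cc_ := cc j Hj).
    rewrite !RInt_Rplus; trivial; try lra; intros y Hy; solve_continuous. }
  rewrite !Rsum_plus.
  assert (Hlast : Rsum (fun j => b1 (x j) * jump x N w j * trace_right v (x j)) 0 (N - 1)
     = Rsum (fun j => b (x j) * cjump x N W j * rval x N V j) 0 N).
  { rewrite (Rsum_last (fun j => b (x j) * cjump x N W j * rval x N V j)) by trivial.
    unfold rval at 2. rewrite Nat.eqb_refl.
    rewrite (Rsum_ext _ (fun j => b (x j) * cjump x N W j * rval x N V j) 0 (N - 1)); [ring|].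
    intros j Hj. rewrite (jump_cjump x N w W), (trace_right_rval x N v V), Hb1; trivial; try lia.
    apply (mesh_range x N); trivial; lia. }
  rewrite Hlast.
  rewrite Rsum_minus, !Rsum_plus.
  rewrite <- !Rsum_scal.
  rewrite (Rsum_ext (fun j => - eps * cavg x N W' j * cjump x N V j)
    (fun j => (-1) * (eps * (avg x N (Derive w) j * jump x N v j)))).
  2:{ intros j Hj. rewrite (avg_cavg x N (Derive w) W'), (jump_cjump x N v V); trivial; try lia. ring. }
  rewrite (Rsum_ext (fun j => eps * cjump x N W j * cavg x N V' j)
    (fun j => eps * (jump x N w j * avg x N (Derive v) j))).
  2:{ intros j Hj. rewrite (avg_cavg x N (Derive v) V'), (jump_cjump x N w W); trivial; try lia. ring. }
  rewrite (Rsum_ext (fun j => mu j * cjump x N W j * cjump x N V j)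
    (fun j => mu j * jump x N w j * jump x N v j)).
  2:{ intros j Hj. rewrite (jump_cjump x N w W), (jump_cjump x N v V); trivial; try lia. }
  rewrite (Rsum_scal (-1)). ring.
Qed.

(** * Galerkin identity, coercivity and the energy estimate *)

(** [b1] is the derivative of [b]. Coercivity is required in the open interval only, where the
    one-sided derivative of the problem is an ordinary one; under the integral this is enough. *)
Record coefficients (b b1 c : R -> R) (gamma B : R) : Prop := {
  coef_derive : forall y, 0 <= y <= 1 -> is_derive b y (b1 y);
  coef_cont_b1 : cont_on 0 1 b1;
  coef_cont_c : cont_on 0 1 c;
  coef_b_pos : forall y, 0 <= y <= 1 -> 0 <= b y;
  coef_b : forall y, 0 <= y <= 1 -> Rabs (b y) <= B;
  coef_b1 : forall y, 0 <= y <= 1 -> Rabs (b1 y) <= B;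
  coef_c : forall y, 0 <= y <= 1 -> Rabs (c y) <= B;
  coef_gamma : 0 < gamma;
  coef_coercive : forall y, 0 < y < 1 -> gamma <= c y - b1 y / 2
}.

Arguments coef_derive {_ _ _ _ _}.
Arguments coef_cont_b1 {_ _ _ _ _}.
Arguments coef_cont_c {_ _ _ _ _}.
Arguments coef_b_pos {_ _ _ _ _}.
Arguments coef_b {_ _ _ _ _}.
Arguments coef_b1 {_ _ _ _ _}.
Arguments coef_c {_ _ _ _ _}.
Arguments coef_gamma {_ _ _ _ _}.
Arguments coef_coercive {_ _ _ _ _}.

Lemma coef_cont_b (b b1 c : R -> R) (gamma B : R) :
  coefficients b b1 c gamma B -> cont_on 0 1 b.
Proof.
  intros H y Hy. apply is_derive_continuous with (b1 y). now apply (coef_derive H).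
Qed.

Arguments coef_cont_b {_ _ _ _ _}.

Lemma cell_ends (x : nat -> R) (N j : nat) (V : nat -> R -> R) :
  (1 <= j <= N)%nat ->
  lval x V j = V j (x j) /\ rval x N V (j - 1) = V j (x (j - 1)%nat).
Proof.
  intros Hj. unfold lval, rval.
  destruct (Nat.eqb_spec j 0); [lia|]. destruct (Nat.eqb_spec (j - 1) N); [lia|].
  now replace (S (j - 1)) with j by lia.
Qed.

(** A factor [a] that is single-valued at the nodes turns the boundary terms of a cellwise
    integration by parts into jumps. Both the flux of the exact solution and the layer error meet
    the test function in this way. *)
Lemma sum_cell_boundary (x a : nat -> R) (N : nat) (V : nat -> R -> R) :
  (1 <= N)%nat ->
  Rsum (fun j => a j * V j (x j) - a (j - 1)%nat * V j (x (j - 1)%nat)) 1 N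
  = Rsum (fun j => a j * cjump x N V j) 0 N.
Proof.
  intros HN.
  rewrite (Rsum_ext _ (fun j => a j * lval x V j
     - (fun i => a i * rval x N V i) (j - 1)%nat)).
  2:{ intros j Hj. destruct (cell_ends x N j V Hj) as [-> ->]. reflexivity. }
  etransitivity;
    [apply (Rsum_telescope (fun j => a j * lval x V j) (fun j => a j * rval x N V j)); trivial;
     unfold lval; simpl; ring|].
  assert (E0 : rval x N V N = 0) by (unfold rval; now rewrite Nat.eqb_refl).
  rewrite E0, Rmult_0_r, Rplus_0_r.
  apply Rsum_ext; intros; unfold cjump; ring.
Qed.

Lemma cont_on_cell (x : nat -> R) (N j : nat) (f : R -> R) :
  is_mesh x N -> (1 <= j <= N)%nat -> cont_on 0 1 f -> cont_on (x (j - 1)%nat) (x j) f.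
Proof. intros Hx Hj Hf y Hy. apply Hf. now apply cell_unit with x N j. Qed.

Lemma cjump_minus (x : nat -> R) (N j : nat) (V W : nat -> R -> R) :
  cjump x N (fun i y => V i y - W i y) j = cjump x N V j - cjump x N W j.
Proof. unfold cjump, lval, rval. destruct (j =? 0), (j =? N); ring. Qed.

Lemma cavg_minus (x : nat -> R) (N j : nat) (V W : nat -> R -> R) :
  cavg x N (fun i y => V i y - W i y) j = cavg x N V j - cavg x N W j.
Proof.
  unfold cavg, lval, rval. destruct (j =? 0), (j =? N); lra.
Qed.

Lemma cell_form_minus_l (eps : R) (b c : R -> R) (mu x : nat -> R) (N : nat)
    (W1 W1' W2 W2' V V' : nat -> R -> R) :
  is_mesh x N -> cont_on 0 1 b -> cont_on 0 1 c ->
  cellwise_C1 x N W1 W1' -> cellwise_C1 x N W2 W2' -> cellwise_C1 x N V V' ->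
  cell_form eps b c mu x N (fun j y => W1 j y - W2 j y) (fun j y => W1' j y - W2' j y) V V'
  = cell_form eps b c mu x N W1 W1' V V' - cell_form eps b c mu x N W2 W2' V V'.
Proof.
  intros Hx Hb Hc H1 H2 HV. unfold cell_form.
  rewrite (Rsum_ext (fun j => RInt (fun y => eps * (W1' j y - W2' j y) * V' j y
      + b y * (W1' j y - W2' j y) * V j y + c y * (W1 j y - W2 j y) * V j y)
      (x (j - 1)%nat) (x j))
    (fun j => RInt (fun y => eps * W1' j y * V' j y + b y * W1' j y * V j y
                                + c y * W1 j y * V j y) (x (j - 1)%nat) (x j)
     - RInt (fun y => eps * W2' j y * V' j y + b y * W2' j y * V j y
                                + c y * W2 j y * V j y) (x (j - 1)%nat) (x j))).
  2:{ intros j Hj. assert (Hlt := mesh_lt x N Hx j Hj).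
    destruct (cellwise_C1_cont x N _ _ j H1 Hj), (cellwise_C1_cont x N _ _ j H2 Hj),
      (cellwise_C1_cont x N _ _ j HV Hj).
    assert (cb := cont_on_cell x N j b Hx Hj Hb). assert (cc := cont_on_cell x N j c Hx Hj Hc).
    rewrite <- RInt_Rminus; try lra.
    - apply RInt_eq_open; [lra|]. intros; ring.
    - intros y Hy; solve_continuous.
    - intros y Hy; solve_continuous. }
  rewrite Rsum_minus.
  rewrite (Rsum_ext (fun j => - eps * cavg x N (fun i y => W1' i y - W2' i y) j * cjump x N V j
     + eps * cjump x N (fun i y => W1 i y - W2 i y) j * cavg x N V' j
     + mu j * cjump x N (fun i y => W1 i y - W2 i y) j * cjump x N V j
     - b (x j) * cjump x N (fun i y => W1 i y - W2 i y) j * rval x N V j)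
    (fun j => (- eps * cavg x N W1' j * cjump x N V j + eps * cjump x N W1 j * cavg x N V' j
       + mu j * cjump x N W1 j * cjump x N V j - b (x j) * cjump x N W1 j * rval x N V j)
     - (- eps * cavg x N W2' j * cjump x N V j + eps * cjump x N W2 j * cavg x N V' j
       + mu j * cjump x N W2 j * cjump x N V j - b (x j) * cjump x N W2 j * rval x N V j))).
  2:{ intros j Hj. rewrite cavg_minus, cjump_minus. ring. }
  rewrite (Rsum_minus (fun j => (- eps * cavg x N W1' j * cjump x N V j
       + eps * cjump x N W1 j * cavg x N V' j
       + mu j * cjump x N W1 j * cjump x N V j - b (x j) * cjump x N W1 j * rval x N V j))).
  ring.
Qed.

(** Consistency of the method. Integrating [eps * v * V'] by parts on each cell produces the flux
    [eps * v] against the jumps of [V], which the average term cancels; all other nodal terms carry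
    a jump of [U], which is 0 at the endpoints as well. *)
Lemma cell_form_solution (eps : R) (b c f U v : R -> R) (mu x : nat -> R) (N : nat)
    (V V' : nat -> R -> R) :
  is_mesh x N -> 0 < eps -> cont_on 0 1 b -> cont_on 0 1 c -> cont_on 0 1 f ->
  (forall y, 0 <= y <= 1 -> is_derive U y (v y)) ->
  (forall y, 0 <= y <= 1 -> is_derive v y ((b y * v y + c y * U y - f y) / eps)) ->
  U 0 = 0 -> U 1 = 0 -> cellwise_C1 x N V V' ->
  cell_form eps b c mu x N (fun _ => U) (fun _ => v) V V'
  = Rsum (fun j => RInt (fun y => f y * V j y) (x (j - 1)%nat) (x j)) 1 N.
Proof.
  intros Hx He Hb Hc Hf HU Hv U0 U1 HV. unfold cell_form.
  assert (HN := mesh_pos x N Hx).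
  assert (cU : cont_on 0 1 U) by (intros y Hy; now apply is_derive_continuous with (v y); auto).
  assert (cv : cont_on 0 1 v) by (intros y Hy; eapply is_derive_continuous; apply Hv; trivial).
  assert (jU : forall j, (j <= N)%nat -> cjump x N (fun _ => U) j = 0).
  { intros j Hj. unfold cjump, lval, rval.
    destruct (Nat.eqb_spec j 0) as [Ej|Ej], (Nat.eqb_spec j N) as [Ej'|Ej'];
      rewrite ?Ej, ?Ej', ?(mesh_0 x N Hx), ?(mesh_N x N Hx), ?U0, ?U1; ring. }
  assert (aU : forall j, (j <= N)%nat -> cavg x N (fun _ => v) j = v (x j)).
  { intros j Hj. unfold cavg, lval, rval.
    destruct (Nat.eqb_spec j 0), (Nat.eqb_spec j N); try lia; lra. }
  rewrite (Rsum_ext (fun j => RInt (fun y => eps * v y * V' j y + b y * v y * V j y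
                                + c y * U y * V j y) (x (j - 1)%nat) (x j))
    (fun j => (eps * v (x j) * V j (x j)
         - eps * v (x (j - 1)%nat) * V j (x (j - 1)%nat))
      + RInt (fun y => f y * V j y) (x (j - 1)%nat) (x j))).
  2:{ intros j Hj. assert (Hlt := mesh_lt x N Hx j Hj).
    destruct (cellwise_C1_cont x N _ _ j HV Hj) as [cV cV'].
    assert (cb_ := cont_on_cell x N j b Hx Hj Hb). assert (cc := cont_on_cell x N j c Hx Hj Hc).
    assert (cf_ := cont_on_cell x N j f Hx Hj Hf). assert (cu_ := cont_on_cell x N j U Hx Hj cU).
    assert (cv_ := cont_on_cell x N j v Hx Hj cv).
    rewrite <- (RInt_FTC (fun y => eps * v y * V j y)
      (fun y => (b y * v y + c y * U y - f y) * V j y + eps * v y * V' j y)); try lra.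
    - rewrite <- RInt_Rplus; try lra.
      + apply RInt_eq_open; [lra|]; intros; ring.
      + intros y Hy; solve_continuous.
      + intros y Hy; solve_continuous.
    - intros y Hy. assert (0 <= y <= 1) by (now apply cell_unit with x N j).
      destruct (HV j Hj y Hy) as [HVd _].
      solve_derive. field. lra.
    - intros y Hy; solve_continuous. }
  rewrite Rsum_plus, (sum_cell_boundary x (fun j => eps * v (x j))) by trivial.
  rewrite (Rsum_ext (fun j => - eps * cavg x N (fun _ => v) j * cjump x N V j
     + eps * cjump x N (fun _ => U) j * cavg x N V' j
     + mu j * cjump x N (fun _ => U) j * cjump x N V j
     - b (x j) * cjump x N (fun _ => U) j * rval x N V j)
    (fun j => (-1) * (eps * v (x j) * cjump x N V j)) 0 N).
  2:{ intros j Hj. rewrite jU, aU by lia. ring. }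
  rewrite Rsum_scal. ring.
Qed.

Definition cell_norm2 (eps gamma : R) (b : R -> R) (mu x : nat -> R) (N : nat)
    (V V' : nat -> R -> R) : R :=
  eps * Rsum (fun j => RInt (fun y => V' j y ^ 2) (x (j - 1)%nat) (x j)) 1 N
  + gamma * Rsum (fun j => RInt (fun y => V j y ^ 2) (x (j - 1)%nat) (x j)) 1 N
  + Rsum (fun j => (mu j + b (x j) / 2) * cjump x N V j ^ 2) 0 N.

Lemma nipg_norm_cell_norm2 (eps gamma : R) (b b0 : R -> R) (mu x : nat -> R) (N : nat)
    (w : R -> R) (W W' : nat -> R -> R) :
  is_mesh x N -> (forall y, unit_interval y -> b0 y = b y) ->
  represents x N w W -> cellwise_C1 x N W W' ->
  nipg_norm eps gamma b0 mu x N w = sqrt (cell_norm2 eps gamma b mu x N W W').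
Proof.
  intros Hx Hb Hw HW. assert (Hw' := represents_Derive x N w W W' Hw HW).
  unfold nipg_norm, cell_norm2. f_equal. rewrite !broken_int_Rsum.
  f_equal; [f_equal; f_equal|].
  - apply Rsum_ext. intros j Hj. assert (Hlt := mesh_lt x N Hx j Hj).
    apply RInt_eq_open; [lra|]. intros y Hy. now rewrite (Hw' j).
  - apply Rsum_ext. intros j Hj. assert (Hlt := mesh_lt x N Hx j Hj).
    apply RInt_eq_open; [lra|]. intros y Hy. now rewrite (Hw j).
  - apply Rsum_ext. intros j Hj. rewrite (jump_cjump x N w W), Hb; trivial; try lia.
    + apply (mesh_range x N); trivial; lia.
    + intros i Hi. now apply (cellwise_C1_cont x N W W').
Qed.

(** The two [eps] terms at a node cancel by the nonsymmetric sign. With l, r the traces, integration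
    of b V' V leaves b/2 (l^2 - r^2) at each node, and the upwind term completes it to a square: b/2
    (l^2 - r^2) - b (l - r) r = b/2 (l - r)^2. The volume term left has the factor c - b'/2. *)
Lemma cell_form_coercive (eps gamma B : R) (b b1 c : R -> R) (mu x : nat -> R) (N : nat)
    (V V' : nat -> R -> R) :
  is_mesh x N -> coefficients b b1 c gamma B -> cellwise_C1 x N V V' ->
  cell_norm2 eps gamma b mu x N V V' <= cell_form eps b c mu x N V V' V V'.
Proof.
  intros Hx Hco HV. unfold cell_norm2, cell_form.
  assert (HN := mesh_pos x N Hx).
  assert (Hb := coef_cont_b Hco). assert (Hc := coef_cont_c Hco).
  assert (Hb1 := coef_cont_b1 Hco).
  rewrite <- !Rsum_scal, <- Rsum_plus.
  apply Rle_trans with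
    (Rsum (fun j => (eps * RInt (fun y => V' j y ^ 2) (x (j - 1)%nat) (x j)
       + gamma * RInt (fun y => V j y ^ 2) (x (j - 1)%nat) (x j))
       + (b (x j) / 2 * V j (x j) * V j (x j)
         - b (x (j - 1)%nat) / 2 * V j (x (j - 1)%nat) * V j (x (j - 1)%nat))) 1 N
    + Rsum (fun j => - eps * cavg x N V' j * cjump x N V j + eps * cjump x N V j * cavg x N V' j
       + mu j * cjump x N V j * cjump x N V j - b (x j) * cjump x N V j * rval x N V j) 0 N).
  - rewrite (Rsum_plus (fun j => eps * RInt (fun y => V' j y ^ 2) (x (j - 1)%nat) (x j)
       + gamma * RInt (fun y => V j y ^ 2) (x (j - 1)%nat) (x j))), (Rplus_assoc (Rsum _ 1 N)).
    apply Rplus_le_compat_l.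
    rewrite (Rsum_ext (fun j => b (x j) / 2 * V j (x j) * V j (x j)
         - b (x (j - 1)%nat) / 2 * V j (x (j - 1)%nat) * V j (x (j - 1)%nat))
      (fun j => b (x j) / 2 * lval x V j * lval x V j
         - (fun i => b (x i) / 2 * rval x N V i * rval x N V i) (j - 1)%nat)).
    2:{ intros j Hj. destruct (cell_ends x N j V Hj) as [-> ->]. reflexivity. }
    rewrite (Rsum_telescope (fun j => b (x j) / 2 * lval x V j * lval x V j)
      (fun i => b (x i) / 2 * rval x N V i * rval x N V i)); trivial;
      [|unfold lval; simpl; ring].
    assert (E0 : rval x N V N = 0) by (unfold rval; now rewrite Nat.eqb_refl).
    rewrite E0, Rmult_0_r, Rplus_0_r, <- Rsum_plus.
    apply Rsum_le. intros j Hj. apply Req_le. unfold cjump. field.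
  - apply Rplus_le_compat_r, Rsum_le. intros j Hj.
    assert (Hlt := mesh_lt x N Hx j Hj).
    destruct (cellwise_C1_cont x N _ _ j HV Hj) as [cV cV'].
    assert (cb_ := cont_on_cell x N j b Hx Hj Hb). assert (cc := cont_on_cell x N j c Hx Hj Hc).
    assert (cb1 := cont_on_cell x N j b1 Hx Hj Hb1).
    rewrite <- (RInt_FTC (fun y => b y / 2 * V j y * V j y)
      (fun y => b1 y / 2 * V j y * V j y + b y * V' j y * V j y)); try lra.
    + rewrite <- !RInt_Rscal, <- !RInt_Rplus; solve_side.
      apply RInt_mono; solve_side.
      intros y Hy. assert (Hg := coef_coercive Hco y).
      assert (H0 := mesh_range x N j Hx). assert (H1 := mesh_range x N (j - 1) Hx).
      assert (0 <= x j <= 1) by (apply H0; lia).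
      assert (0 <= x (j - 1)%nat <= 1) by (apply H1; lia).
      assert (gamma <= c y - b1 y / 2) by (apply Hg; lra).
      assert (0 <= (c y - b1 y / 2 - gamma) * V j y ^ 2)
        by (apply Rmult_le_pos; [lra | apply pow2_ge_0]).
      lra.
    + intros y Hy. assert (0 <= y <= 1) by (now apply cell_unit with x N j).
      destruct (HV j Hj y Hy) as [HVd _]. assert (Hd := coef_derive Hco y).
      solve_derive. field.
    + intros y Hy; solve_continuous.
Qed.

Lemma young (s p q : R) : 0 < s -> p * q <= s * p ^ 2 + q ^ 2 / (4 * s).
Proof.
  intros Hs. assert (H : 0 <= (2 * s * p - q) ^ 2 / (4 * s)).
  { apply Rmult_le_pos; [apply pow2_ge_0 | left; apply Rinv_0_lt_compat; lra]. }
  replace ((2 * s * p - q) ^ 2 / (4 * s)) with (s * p ^ 2 + q ^ 2 / (4 * s) - p * q) in H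
    by (field; lra). lra.
Qed.

Lemma Rabs_le_sqr (a B : R) : Rabs a <= B -> a ^ 2 <= B ^ 2.
Proof.
  intros H. rewrite <- (pow2_abs a). apply pow_incr. split; [apply Rabs_pos | trivial].
Qed.

Lemma sqr_mult_le (p q B K : R) : p ^ 2 <= B -> q ^ 2 <= K -> (p * q) ^ 2 <= B * K.
Proof.
  intros Hp Hq. rewrite Rpow_mult_distr.
  apply Rmult_le_compat; trivial; apply pow2_ge_0.
Qed.

Lemma sqr_sum3_le (p q r : R) : (p + q + r) ^ 2 <= 3 * (p ^ 2 + q ^ 2 + r ^ 2).
Proof.
  assert (H1 := pow2_ge_0 (p - q)). assert (H2 := pow2_ge_0 (q - r)).
  assert (H3 := pow2_ge_0 (p - r)). lra.
Qed.

Lemma sqr_sum2_le (p q : R) : (p + q) ^ 2 <= 2 * p ^ 2 + 2 * q ^ 2.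
Proof. assert (H1 := pow2_ge_0 (p - q)). lra. Qed.

(** The integrand of the form once the derivative of b z X has been subtracted, which trades b z' X
    for - b1 z X - b z X'. Here t + z is the error and z its layer part. Young's inequality takes
    e/8 of X'^2 for each of the two products with X' and g/4 of X^2 for the rest; the product b z X'
    is what forces the weight 1/e on z^2. *)
Lemma cell_integrand_bound (e g B K b b1 c t t' z z' X X' : R) :
  0 < e <= 1 -> 0 < g -> Rabs b <= B -> Rabs b1 <= B -> Rabs c <= B ->
  Rabs t <= K -> Rabs t' <= K ->
  e * (t' + z') * X' + b * t' * X + c * (t + z) * X - b1 * z * X - b * z * X'
  <= / 4 * (e * X' ^ 2 + g * X ^ 2)
     + (12 * B ^ 2 / g + 2 * B ^ 2 + 4) * (K ^ 2 + / e * z ^ 2 + e * z' ^ 2).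
Proof.
  intros He Hg Hb Hb1 Hc Ht Ht'.
  apply Rabs_le_sqr in Hb, Hb1, Hc, Ht, Ht'.
  assert (Y1 := young (e / 8) X' (t' + z')).
  assert (Y1' := young (/ 8) X' (t' + z')).
  assert (Y2 := young (e / 8) X' (- b * z)).
  assert (Y3 := young (g / 4) X (b * t' + c * t + (c - b1) * z)).
  assert (He1 : 1 <= / e) by (rewrite <- Rinv_1; apply Rinv_le_contravar; lra).
  assert (P0 := pow2_ge_0 z).
  assert (Hz : z ^ 2 <= / e * z ^ 2) by (rewrite <- (Rmult_1_l (z ^ 2)) at 1; apply Rmult_le_compat_r; lra).
  assert (Q : (b * t' + c * t + (c - b1) * z) ^ 2 <= 12 * B ^ 2 * (K ^ 2 + / e * z ^ 2)).
  { eapply Rle_trans; [apply sqr_sum3_le|].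
    assert (H1 := sqr_mult_le b t' _ _ Hb Ht'). assert (H2 := sqr_mult_le c t _ _ Hc Ht).
    assert (Hcb : (c - b1) ^ 2 <= 4 * B ^ 2).
    { assert (H := sqr_sum2_le c (- b1)). replace (c + - b1) with (c - b1) in H by ring.
      replace ((- b1) ^ 2) with (b1 ^ 2) in H by ring. lra. }
    assert (H3 := sqr_mult_le (c - b1) z _ _ Hcb Hz).
    assert (0 <= B ^ 2 * K ^ 2) by (apply Rmult_le_pos; apply pow2_ge_0). lra. }
  assert (Q' : (b * t' + c * t + (c - b1) * z) ^ 2 / (4 * (g / 4))
      <= 12 * B ^ 2 / g * (K ^ 2 + / e * z ^ 2)).
  { replace (4 * (g / 4)) with g by field. unfold Rdiv.
    replace (12 * B ^ 2 * / g * (K ^ 2 + / e * z ^ 2))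
      with (12 * B ^ 2 * (K ^ 2 + / e * z ^ 2) * / g) by ring.
    apply Rmult_le_compat_r; [left; now apply Rinv_0_lt_compat | exact Q]. }
  assert (S : (t' + z') ^ 2 <= 2 * K ^ 2 + 2 * z' ^ 2)
    by (eapply Rle_trans; [apply sqr_sum2_le | lra]).
  assert (S' : (t' + z') ^ 2 / (4 * / 8) <= 4 * K ^ 2 + 4 * z' ^ 2)
    by (unfold Rdiv; replace (/ (4 * / 8)) with 2 by field; lra).
  assert (S'' : e * ((t' + z') ^ 2 / (4 * / 8)) <= 4 * K ^ 2 + 4 * (e * z' ^ 2)).
  { apply Rle_trans with (e * (4 * K ^ 2 + 4 * z' ^ 2)).
    - apply Rmult_le_compat_l; lra.
    - assert (0 <= (1 - e) * K ^ 2) by (apply Rmult_le_pos; [lra | apply pow2_ge_0]). lra. }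
  assert (T1 : e * (t' + z') * X' <= e * X' ^ 2 / 8 + (4 * K ^ 2 + 4 * (e * z' ^ 2))).
  { assert (H : X' * (t' + z') <= / 8 * X' ^ 2 + (t' + z') ^ 2 / (4 * / 8)) by (apply Y1'; lra).
    apply Rmult_le_compat_l with (r := e) in H; lra. }
  assert (U : (- b * z) ^ 2 / (4 * (e / 8)) <= 2 * B ^ 2 * (/ e * z ^ 2)).
  { replace ((- b * z) ^ 2 / (4 * (e / 8))) with (2 * b ^ 2 * (/ e * z ^ 2)) by (field; lra).
    apply Rmult_le_compat_r; [|lra].
    apply Rmult_le_pos; [left; apply Rinv_0_lt_compat; lra | trivial]. }
  assert (T2 : - b * z * X' <= e / 8 * X' ^ 2 + 2 * B ^ 2 * (/ e * z ^ 2)).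
  { assert (X' * (- b * z) <= e / 8 * X' ^ 2 + (- b * z) ^ 2 / (4 * (e / 8))) by (apply Y2; lra).
    lra. }
  assert (T3 : (b * t' + c * t + (c - b1) * z) * X
     <= g / 4 * X ^ 2 + 12 * B ^ 2 / g * (K ^ 2 + / e * z ^ 2)).
  { assert (X * (b * t' + c * t + (c - b1) * z) <= g / 4 * X ^ 2
      + (b * t' + c * t + (c - b1) * z) ^ 2 / (4 * (g / 4))) by (apply Y3; lra). lra. }
  assert (G : 0 <= 12 * B ^ 2 / g).
  { apply Rmult_le_pos; [assert (H := pow2_ge_0 B); lra | left; now apply Rinv_0_lt_compat]. }
  assert (Z1 : 0 <= e * z' ^ 2) by (apply Rmult_le_pos; [lra | apply pow2_ge_0]).
  assert (Z2 : 0 <= / e * z ^ 2) by lra.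
  assert (0 <= 12 * B ^ 2 / g * (e * z' ^ 2)) by now apply Rmult_le_pos.
  assert (0 <= 2 * B ^ 2 * (e * z' ^ 2))
    by (apply Rmult_le_pos; trivial; assert (H' := pow2_ge_0 B); lra).
  assert (0 <= 2 * B ^ 2 * K ^ 2)
    by (assert (0 <= B ^ 2 * K ^ 2) by (apply Rmult_le_pos; apply pow2_ge_0); lra).
  lra.
Qed.

Lemma mesh_sum (x : nat -> R) (n : nat) :
  Rsum (fun j => x j - x (j - 1)%nat) 1 n = x n - x 0%nat.
Proof.
  induction n as [|n IH]; [rewrite Rsum_1_0; ring|].
  rewrite Rsum_S, IH by lia. replace (S n - 1)%nat with n by lia. ring.
Qed.

(* [H] is the interpolation error and [Z] its part in the layer, small only in
   the weighted norms below. *)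
Record split_error (eps K : R) (mu x : nat -> R) (N : nat)
    (H H' Z Z' : nat -> R -> R) (zn : nat -> R) : Prop := {
  split_C1_H : cellwise_C1 x N H H';
  split_C1_Z : cellwise_C1 x N Z Z';
  split_jump : forall j, (j <= N)%nat -> cjump x N H j = 0;
  split_diff : forall j, (1 <= j <= N)%nat -> forall y, x (j - 1)%nat <= y <= x j ->
    Rabs (H j y - Z j y) <= K /\ Rabs (H' j y - Z' j y) <= K;
  split_Z : forall j, (1 <= j <= N)%nat ->
    RInt (fun y => Z j y ^ 2) (x (j - 1)%nat) (x j) <= eps * (K ^ 2 / INR N);
  split_Z' : forall j, (1 <= j <= N)%nat ->
    eps * RInt (fun y => Z' j y ^ 2) (x (j - 1)%nat) (x j) <= K ^ 2 / INR N;
  split_zn_r : forall j, (1 <= j <= N)%nat -> Z j (x j) = zn j;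
  split_zn_l : forall j, (1 <= j <= N)%nat -> Z j (x (j - 1)%nat) = zn (j - 1)%nat;
  split_zn : forall j, (j <= N)%nat -> zn j ^ 2 <= mu j * (K ^ 2 / INR N);
  split_H'_r : forall j, (1 <= j <= N)%nat -> (eps * H' j (x j)) ^ 2 <= mu j * (K ^ 2 / INR N);
  split_H'_l : forall j, (1 <= j <= N)%nat ->
    (eps * H' j (x (j - 1)%nat)) ^ 2 <= mu (j - 1)%nat * (K ^ 2 / INR N)
}.

Arguments split_C1_H {_ _ _ _ _ _ _ _ _ _}.
Arguments split_C1_Z {_ _ _ _ _ _ _ _ _ _}.
Arguments split_jump {_ _ _ _ _ _ _ _ _ _}.
Arguments split_diff {_ _ _ _ _ _ _ _ _ _}.
Arguments split_Z {_ _ _ _ _ _ _ _ _ _}.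
Arguments split_Z' {_ _ _ _ _ _ _ _ _ _}.
Arguments split_zn_r {_ _ _ _ _ _ _ _ _ _}.
Arguments split_zn_l {_ _ _ _ _ _ _ _ _ _}.
Arguments split_zn {_ _ _ _ _ _ _ _ _ _}.
Arguments split_H'_r {_ _ _ _ _ _ _ _ _ _}.
Arguments split_H'_l {_ _ _ _ _ _ _ _ _ _}.

(** Convexity: the square of the mean of two one-sided fluxes is at most the larger of their
    squares. At the two end nodes there is only one flux. *)
Lemma split_cavg (eps K : R) (mu x : nat -> R) (N : nat)
    (H H' Z Z' : nat -> R -> R) (zn : nat -> R) (j : nat) :
  (1 <= N)%nat -> split_error eps K mu x N H H' Z Z' zn -> (j <= N)%nat ->
  (eps * cavg x N H' j) ^ 2 <= mu j * (K ^ 2 / INR N).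
Proof.
  intros HN Hs Hj.
  assert (Hr := split_H'_r Hs j).
  assert (Hl := split_H'_l Hs (S j)).
  replace (S j - 1)%nat with j in Hl by lia.
  unfold cavg, lval, rval.
  destruct (Nat.eqb_spec j 0) as [E|E], (Nat.eqb_spec j N) as [E'|E'].
  - lia.
  - apply Hl; lia.
  - apply Hr; lia.
  - assert (H1 := Hl ltac:(lia)). assert (H2 := Hr ltac:(lia)).
    assert (H3 := pow2_ge_0 (eps * H' (S j) (x j) - eps * H' j (x j))).
    replace ((eps * ((H' (S j) (x j) + H' j (x j)) / 2)) ^ 2)
      with ((2 * (eps * H' (S j) (x j)) ^ 2 + 2 * (eps * H' j (x j)) ^ 2
        - (eps * H' (S j) (x j) - eps * H' j (x j)) ^ 2) / 4) by field.
    lra.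
Qed.

(** Only the convective term of [Z] is integrated by parts. Since [zn] is shared by the two cells of
    a node, its boundary terms collect into jumps of [X], absorbed by a quarter of the penalty; the
    flux averages take another quarter. *)
Lemma cell_form_split_bound (eps gamma B K : R) (b b1 c : R -> R) (mu x : nat -> R) (N : nat)
    (H H' Z Z' X X' : nat -> R -> R) (zn : nat -> R) :
  is_mesh x N -> coefficients b b1 c gamma B -> 0 < eps <= 1 ->
  (forall j, (j <= N)%nat -> 0 < mu j) ->
  split_error eps K mu x N H H' Z Z' zn -> cellwise_C1 x N X X' ->
  cell_form eps b c mu x N H H' X X'
  <= / 4 * (eps * Rsum (fun j => RInt (fun y => X' j y ^ 2) (x (j - 1)%nat) (x j)) 1 N
            + gamma * Rsum (fun j => RInt (fun y => X j y ^ 2) (x (j - 1)%nat) (x j)) 1 N)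
     + / 2 * Rsum (fun j => mu j * cjump x N X j ^ 2) 0 N
     + (3 * (12 * B ^ 2 / gamma + 2 * B ^ 2 + 4) + 2 * (B ^ 2 + 1)) * K ^ 2.
Proof.
  intros Hx Hco He Hmu Hs HX.
  assert (HN := mesh_pos x N Hx).
  assert (HNR := INR_ge_1 N ltac:(lia)).
  assert (Hb := coef_cont_b Hco). assert (Hc := coef_cont_c Hco).
  assert (Hb1 := coef_cont_b1 Hco). assert (Hg := coef_gamma Hco).
  set (C1 := 12 * B ^ 2 / gamma + 2 * B ^ 2 + 4).
  assert (HC1 : 0 <= C1).
  { unfold C1. assert (P := pow2_ge_0 B).
    assert (0 <= 12 * B ^ 2 / gamma)
      by (apply Rmult_le_pos; [lra | left; now apply Rinv_0_lt_compat]). lra. }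
  assert (HH := split_C1_H Hs).
  assert (HZ := split_C1_Z Hs).
  unfold cell_form.
  apply Rle_trans with
    (Rsum (fun j => (/ 4 * (eps * RInt (fun y => X' j y ^ 2) (x (j - 1)%nat) (x j)
         + gamma * RInt (fun y => X j y ^ 2) (x (j - 1)%nat) (x j))
         + (C1 * (K ^ 2 * (x j - x (j - 1)%nat)) + 2 * C1 * (K ^ 2 / INR N)))
        + (b (x j) * zn j * X j (x j)
           - b (x (j - 1)%nat) * zn (j - 1)%nat * X j (x (j - 1)%nat))) 1 N
     + Rsum (fun j => - eps * cavg x N H' j * cjump x N X j) 0 N).
  - apply Rplus_le_compat.
    + apply Rsum_le. intros j Hj. assert (Hlt := mesh_lt x N Hx j Hj).
      destruct (cellwise_C1_cont x N _ _ j HH Hj), (cellwise_C1_cont x N _ _ j HZ Hj),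
        (cellwise_C1_cont x N _ _ j HX Hj).
      assert (cb_ := cont_on_cell x N j b Hx Hj Hb). assert (cc := cont_on_cell x N j c Hx Hj Hc).
      assert (cb1 := cont_on_cell x N j b1 Hx Hj Hb1).
      assert (SZ := split_Z Hs j Hj).
      assert (SZ' := split_Z' Hs j Hj).
      rewrite <- (split_zn_r Hs j Hj),
        <- (split_zn_l Hs j Hj).
      (* The last bracket is the derivative of [b * Z * X]; it will be integrated exactly, to
         boundary values. *)
      apply Rle_trans with (RInt (fun y => (/ 4 * (eps * X' j y ^ 2 + gamma * X j y ^ 2)
         + C1 * (K ^ 2 + / eps * Z j y ^ 2 + eps * Z' j y ^ 2))
         + (b1 y * Z j y * X j y + b y * Z' j y * X j y + b y * Z j y * X' j y))
         (x (j - 1)%nat) (x j)).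
      * apply RInt_mono; solve_side.
        intros y Hy. assert (Hu : 0 <= y <= 1) by (apply cell_unit with x N j; trivial; lra).
        destruct (split_diff Hs j Hj y) as [D D']; [lra|].
        assert (P := cell_integrand_bound eps gamma B K (b y) (b1 y) (c y) (H j y - Z j y)
          (H' j y - Z' j y) (Z j y) (Z' j y) (X j y) (X' j y) He Hg
          (coef_b Hco y Hu) (coef_b1 Hco y Hu) (coef_c Hco y Hu)
          D D').
        fold C1 in P. lra.
      * rewrite (RInt_Rplus _ (fun y => b1 y * Z j y * X j y + b y * Z' j y * X j y
            + b y * Z j y * X' j y)); solve_side.
        apply Rplus_le_compat.
        -- rewrite RInt_Rplus, !RInt_Rscal, !RInt_Rplus, !RInt_Rscal, RInt_constR;
             solve_side.
           apply Rplus_le_compat_l.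
           assert (G1 : / eps * RInt (fun y => Z j y ^ 2) (x (j - 1)%nat) (x j) <= K ^ 2 / INR N).
           { apply Rmult_le_reg_l with eps; [lra|].
             rewrite <- Rmult_assoc, Rinv_r, Rmult_1_l by lra. exact SZ. }
           apply Rle_trans with (C1 * (K ^ 2 * (x j - x (j - 1)%nat) + K ^ 2 / INR N + K ^ 2 / INR N));
             [apply Rmult_le_compat_l; lra | lra].
        -- apply Req_le.
           rewrite (RInt_FTC (fun y => b y * Z j y * X j y)); solve_side.
           intros y Hy. assert (Hu : 0 <= y <= 1) by (now apply cell_unit with x N j).
           destruct (HZ j Hj y Hy) as [DZ _]. destruct (HX j Hj y Hy) as [DX _].
           assert (Db := coef_derive Hco y Hu). solve_derive. ring.
    + apply Rsum_le. intros j Hj.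
      rewrite (split_jump Hs j) by lia. apply Req_le; ring.
  - rewrite Rsum_plus, (sum_cell_boundary x (fun j => b (x j) * zn j)) by trivial.
    rewrite !Rsum_plus, !Rsum_scal, Rsum_plus, !Rsum_scal, mesh_sum, Rsum_const_1.
    rewrite (mesh_0 x N Hx), (mesh_N x N Hx).
    replace (INR N * (K ^ 2 / INR N)) with (K ^ 2) by (field; lra).
    rewrite Rplus_assoc, <- Rsum_plus.
    assert (P : Rsum (fun j => b (x j) * zn j * cjump x N X j
        + - eps * cavg x N H' j * cjump x N X j) 0 N
      <= Rsum (fun j => / 2 * (mu j * cjump x N X j ^ 2) + (B ^ 2 + 1) * (K ^ 2 / INR N)) 0 N).
    { apply Rsum_le. intros j Hj. assert (Hm : 0 < mu j) by (apply Hmu; lia).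
      assert (Ha := split_cavg _ _ _ _ _ _ _ _ _ _ j HN Hs (proj2 Hj)).
      assert (Hz := split_zn Hs j (proj2 Hj)).
      assert (Hu := mesh_range x N j Hx (proj2 Hj)).
      assert (Bb := Rabs_le_sqr _ _ (coef_b Hco _ Hu)).
      assert (Y1 := young (mu j / 4) (cjump x N X j) (b (x j) * zn j)).
      assert (Y2 := young (mu j / 4) (cjump x N X j) (- (eps * cavg x N H' j))).
      replace (4 * (mu j / 4)) with (mu j) in Y1, Y2 by field.
      assert (E1 : (b (x j) * zn j) ^ 2 / mu j <= B ^ 2 * (K ^ 2 / INR N)).
      { apply Rmult_le_reg_r with (mu j); trivial. unfold Rdiv at 1.
        rewrite Rmult_assoc, Rinv_l, Rmult_1_r by lra.
        eapply Rle_trans; [apply (sqr_mult_le _ _ _ _ Bb Hz)|]. apply Req_le; ring. }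
      assert (E2 : (- (eps * cavg x N H' j)) ^ 2 / mu j <= K ^ 2 / INR N).
      { apply Rmult_le_reg_r with (mu j); trivial. unfold Rdiv at 1.
        rewrite Rmult_assoc, Rinv_l, Rmult_1_r by lra. lra. }
      assert (Hm4 : 0 < mu j / 4) by lra. specialize (Y1 Hm4). specialize (Y2 Hm4). lra. }
    rewrite (Rsum_plus (fun j => / 2 * (mu j * cjump x N X j ^ 2))), Rsum_scal, Rsum_const_0 in P.
    (* [N + 1] nodes with a share of K^2 / N each: the factor 2 bounds (N + 1) / N. *)
    assert (Q : (INR N + 1) * ((B ^ 2 + 1) * (K ^ 2 / INR N)) <= 2 * (B ^ 2 + 1) * K ^ 2).
    { replace ((INR N + 1) * ((B ^ 2 + 1) * (K ^ 2 / INR N)))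
        with ((1 + / INR N) * ((B ^ 2 + 1) * K ^ 2)) by (field; lra).
      assert (/ INR N <= 1) by (rewrite <- Rinv_1; apply Rinv_le_contravar; lra).
      assert (0 <= (B ^ 2 + 1) * K ^ 2).
      { apply Rmult_le_pos; [assert (P1 := pow2_ge_0 B); lra | apply pow2_ge_0]. }
      apply Rle_trans with (2 * ((B ^ 2 + 1) * K ^ 2)); [apply Rmult_le_compat_r; lra | lra]. }
    lra.
Qed.

(** After absorption at least half of the energy of [X] remains on the left. The triangle inequality
    then adds the energy of [H], which contributes nothing to the jumps. *)
Lemma split_error_estimate (gamma B : R) (b b1 c : R -> R) :
  coefficients b b1 c gamma B ->
  exists C, 0 < C /\
  forall (eps K : R) (mu x : nat -> R) (N : nat) (H H' Z Z' X X' : nat -> R -> R) (zn : nat -> R),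
    is_mesh x N -> 0 < eps <= 1 -> (forall j, (j <= N)%nat -> 0 < mu j) ->
    split_error eps K mu x N H H' Z Z' zn -> cellwise_C1 x N X X' ->
    cell_form eps b c mu x N X X' X X' = cell_form eps b c mu x N H H' X X' ->
    cell_norm2 eps gamma b mu x N (fun j y => H j y - X j y) (fun j y => H' j y - X' j y)
    <= C * K ^ 2.
Proof.
  intros Hco.
  assert (Hg := coef_gamma Hco).
  set (C2 := 3 * (12 * B ^ 2 / gamma + 2 * B ^ 2 + 4) + 2 * (B ^ 2 + 1)).
  assert (HC2 : 0 < C2).
  { unfold C2. assert (P := pow2_ge_0 B).
    assert (0 <= 12 * B ^ 2 / gamma)
      by (apply Rmult_le_pos; [lra | left; now apply Rinv_0_lt_compat]). lra. }
  (* The energy of [X] is at most 2 C2 K^2, doubled by the triangle inequality; the terms in [H']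
     and [H] are at most 4 K^2 and 4 gamma K^2, doubled as well. *)
  exists (4 * C2 + 8 + 8 * gamma). split; [lra|].
  intros eps K mu x N H H' Z Z' X X' zn Hx He Hmu Hs HX Hgal.
  assert (HN := mesh_pos x N Hx).
  assert (HNR := INR_ge_1 N ltac:(lia)).
  assert (HH := split_C1_H Hs).
  assert (HZ := split_C1_Z Hs).
  assert (U := cell_form_split_bound eps gamma B K b b1 c mu x N H H' Z Z' X X' zn
    Hx Hco He Hmu Hs HX). fold C2 in U.
  assert (L := cell_form_coercive eps gamma B b b1 c mu x N X X' Hx Hco HX).
  rewrite Hgal in L.
  set (hi := fun (W : nat -> R -> R) =>
    Rsum (fun j => RInt (fun y => W j y ^ 2) (x (j - 1)%nat) (x j)) 1 N).
  assert (Hpos : forall W, (forall j, (1 <= j <= N)%nat -> cont_on (x (j - 1)%nat) (x j) (W j)) ->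
     0 <= hi W).
  { intros W HW. apply Rsum_ge0. intros j Hj. assert (Hlt := mesh_lt x N Hx j Hj).
    assert (cW := HW j Hj). apply RInt_ge0; [lra | intros y Hy; solve_continuous |].
    intros; apply pow2_ge_0. }
  assert (Hsum2 : forall W V, (forall j, (1 <= j <= N)%nat -> cont_on (x (j - 1)%nat) (x j) (W j)) ->
     (forall j, (1 <= j <= N)%nat -> cont_on (x (j - 1)%nat) (x j) (V j)) ->
     hi (fun j y => W j y - V j y) <= 2 * hi W + 2 * hi V).
  { intros W V HW HV. unfold hi. rewrite <- !Rsum_scal, <- Rsum_plus.
    apply Rsum_le. intros j Hj. assert (Hlt := mesh_lt x N Hx j Hj).
    assert (cW := HW j Hj). assert (cV := HV j Hj).
    rewrite <- !RInt_Rscal, <- RInt_Rplus; solve_side.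
    apply RInt_mono; solve_side.
    intros y _. assert (Q := pow2_ge_0 (W j y + V j y)). lra. }
  assert (cX : forall j, (1 <= j <= N)%nat -> cont_on (x (j - 1)%nat) (x j) (X j))
    by (intros; now apply (cellwise_C1_cont x N X X')).
  assert (cX' : forall j, (1 <= j <= N)%nat -> cont_on (x (j - 1)%nat) (x j) (X' j))
    by (intros; now apply (cellwise_C1_cont x N X X')).
  assert (cH : forall j, (1 <= j <= N)%nat -> cont_on (x (j - 1)%nat) (x j) (H j))
    by (intros; now apply (cellwise_C1_cont x N H H')).
  assert (cH' : forall j, (1 <= j <= N)%nat -> cont_on (x (j - 1)%nat) (x j) (H' j))
    by (intros; now apply (cellwise_C1_cont x N H H')).
  assert (cZ : forall j, (1 <= j <= N)%nat -> cont_on (x (j - 1)%nat) (x j) (Z j))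
    by (intros; now apply (cellwise_C1_cont x N Z Z')).
  assert (cZ' : forall j, (1 <= j <= N)%nat -> cont_on (x (j - 1)%nat) (x j) (Z' j))
    by (intros; now apply (cellwise_C1_cont x N Z Z')).
  assert (S1 := Hsum2 H' X' cH' cX'). assert (S2 := Hsum2 H X cH cX).
  assert (PX := Hpos X cX). assert (PX' := Hpos X' cX').
  assert (K2 := pow2_ge_0 K).
  (* [H^2 <= 2 K^2 + 2 Z^2] on each cell *)
  assert (Hhi : forall W V a, 0 <= a ->
     (forall j, (1 <= j <= N)%nat -> cont_on (x (j - 1)%nat) (x j) (W j)) ->
     (forall j, (1 <= j <= N)%nat -> cont_on (x (j - 1)%nat) (x j) (V j)) ->
     (forall j, (1 <= j <= N)%nat -> forall y, x (j - 1)%nat <= y <= x j ->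
        Rabs (W j y - V j y) <= K) ->
     (forall j, (1 <= j <= N)%nat ->
        a * RInt (fun y => V j y ^ 2) (x (j - 1)%nat) (x j) <= K ^ 2 / INR N) ->
     a * hi W <= 2 * a * K ^ 2 + 2 * K ^ 2).
  { intros W V a Ha HW HV HD HI.
    apply Rle_trans with (Rsum (fun j => 2 * a * K ^ 2 * (x j - x (j - 1)%nat)
       + 2 * (K ^ 2 / INR N)) 1 N).
    - unfold hi. rewrite <- Rsum_scal. apply Rsum_le. intros j Hj.
      assert (Hlt := mesh_lt x N Hx j Hj). assert (HI' := HI j Hj).
      assert (cW := HW j Hj). assert (cV := HV j Hj).
      assert (E : RInt (fun y => W j y ^ 2) (x (j - 1)%nat) (x j)
         <= 2 * K ^ 2 * (x j - x (j - 1)%nat)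
            + 2 * RInt (fun y => V j y ^ 2) (x (j - 1)%nat) (x j)).
      { rewrite <- RInt_constR, <- RInt_Rscal, <- RInt_Rplus; solve_side.
        apply RInt_mono; solve_side.
        intros y Hy. assert (D := HD j Hj y). apply Rabs_le_sqr in D; [|lra].
        assert (Q := pow2_ge_0 (W j y - 2 * V j y)). lra. }
      apply Rmult_le_compat_l with (r := a) in E; trivial. lra.
    - rewrite Rsum_plus, Rsum_scal, mesh_sum, Rsum_const_1, (mesh_0 x N Hx), (mesh_N x N Hx).
      apply Req_le. field. lra. }
  assert (B1 : eps * hi H' <= 2 * eps * K ^ 2 + 2 * K ^ 2).
  { apply Hhi with Z'; trivial; try lra.
    - intros j Hj y Hy. now apply (split_diff Hs j Hj y).
    - intros j Hj. now apply (split_Z' Hs). }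
  assert (B2 : 1 * hi H <= 2 * 1 * K ^ 2 + 2 * K ^ 2).
  { apply Hhi with Z; trivial; try lra.
    - intros j Hj y Hy. now apply (split_diff Hs j Hj y).
    - intros j Hj. assert (SZ := split_Z Hs j Hj).
      assert (0 <= K ^ 2 / INR N)
        by (apply Rmult_le_pos; [trivial | left; apply Rinv_0_lt_compat; lra]).
      assert (0 <= (1 - eps) * (K ^ 2 / INR N)) by (apply Rmult_le_pos; lra). lra. }
  unfold cell_norm2 in L |- *. fold (hi X) (hi X') in L, U.
  fold (hi (fun j y => H j y - X j y)) (hi (fun j y => H' j y - X' j y)).
  rewrite (Rsum_ext (fun j => (mu j + b (x j) / 2)
      * cjump x N (fun i y => H i y - X i y) j ^ 2)
    (fun j => (mu j + b (x j) / 2) * cjump x N X j ^ 2)).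
  2:{ intros j Hj. rewrite cjump_minus, (split_jump Hs j) by lia. ring. }
  assert (J : Rsum (fun j => mu j * cjump x N X j ^ 2) 0 N
     <= Rsum (fun j => (mu j + b (x j) / 2) * cjump x N X j ^ 2) 0 N).
  { apply Rsum_le. intros j Hj. apply Rmult_le_compat_r; [apply pow2_ge_0|].
    assert (P := coef_b_pos Hco (x j)).
    assert (0 <= b (x j)) by (apply P, (mesh_range x N); trivial; lia). lra. }
  set (j2 := Rsum (fun j => (mu j + b (x j) / 2) * cjump x N X j ^ 2) 0 N) in *.
  set (j1 := Rsum (fun j => mu j * cjump x N X j ^ 2) 0 N) in *.
  assert (0 <= j1).
  { apply Rsum_ge0. intros j Hj. apply Rmult_le_pos; [|apply pow2_ge_0].
    left; apply Hmu; lia. }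
  set (h1 := hi (fun j y => H' j y - X' j y)) in *.
  set (h2 := hi (fun j y => H j y - X j y)) in *.
  assert (eps * h1 <= eps * (2 * hi H' + 2 * hi X')) by (apply Rmult_le_compat_l; lra).
  assert (gamma * h2 <= gamma * (2 * hi H + 2 * hi X)) by (apply Rmult_le_compat_l; lra).
  assert (gamma * hi H <= gamma * (4 * K ^ 2)) by (apply Rmult_le_compat_l; lra).
  assert (0 <= (1 - eps) * K ^ 2) by (apply Rmult_le_pos; lra).
  assert (0 <= eps * hi X') by (apply Rmult_le_pos; lra).
  assert (0 <= gamma * hi X) by (apply Rmult_le_pos; lra).
  lra.
Qed.

(** * The continuous problem *)

Lemma RInt_subinterval_le (q : R -> R) (z y : R) :
  0 <= z <= y -> y <= 1 -> cont_on 0 1 q -> (forall t, 0 <= t <= 1 -> 0 <= q t) ->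
  RInt q z y <= RInt q 0 1.
Proof.
  intros Hz Hy Hc Hp.
  assert (c1 : cont_on 0 z q) by (intros t Ht; apply Hc; lra).
  assert (c2 : cont_on z y q) by (intros t Ht; apply Hc; lra).
  assert (c3 : cont_on y 1 q) by (intros t Ht; apply Hc; lra).
  assert (e1 : ex_RInt q 0 z) by (apply cont_on_ex_RInt; trivial; lra).
  assert (e2 : ex_RInt q z y) by (apply cont_on_ex_RInt; trivial; lra).
  assert (e3 : ex_RInt q y 1) by (apply cont_on_ex_RInt; trivial; lra).
  rewrite <- (RInt_Chasles q 0 z 1), <- (RInt_Chasles q z y 1); trivial.
  2: now apply ex_RInt_Chasles with y.
  assert (0 <= RInt q 0 z) by (apply RInt_ge0; try lra; trivial; intros; apply Hp; lra).
  assert (0 <= RInt q y 1) by (apply RInt_ge0; try lra; trivial; intros; apply Hp; lra).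
  unfold plus; simpl. lra.
Qed.

(** [q] is integrated over all of [0,1], so any point can serve as reference: an endpoint for the
    values of a solution, a zero of unknown position for its derivative. *)
Lemma Rabs_diff_le_RInt (w v q : R -> R) (y z : R) :
  (forall t, 0 <= t <= 1 -> is_derive w t (v t)) -> cont_on 0 1 v -> cont_on 0 1 q ->
  (forall t, 0 <= t <= 1 -> Rabs (v t) <= q t) ->
  0 <= y <= 1 -> 0 <= z <= 1 -> Rabs (w y - w z) <= RInt q 0 1.
Proof.
  intros Hw Hv Hq Hb.
  assert (Hle : forall z y, 0 <= z <= y -> y <= 1 -> Rabs (w y - w z) <= RInt q 0 1).
  { clear y z. intros z y Hz Hy.
    assert (c1 : cont_on z y v) by (intros t Ht; apply Hv; lra).
    assert (c2 : cont_on z y q) by (intros t Ht; apply Hq; lra).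
    apply Rle_trans with (RInt q z y).
    - rewrite <- (RInt_FTC w v z y); try lra; trivial; [|intros; apply Hw; lra].
      apply Rabs_le; split.
      + rewrite <- (Rmult_1_l (RInt q z y)), Ropp_mult_distr_l, <- RInt_Rscal; try lra; trivial.
        apply RInt_mono; try lra; trivial; [intros t Ht; solve_continuous|].
        intros t Ht. assert (H := Hb t). apply Rabs_le_between in H; lra.
      + apply RInt_mono; try lra; trivial.
        intros t Ht. assert (H := Hb t). apply Rabs_le_between in H; lra.
    - apply RInt_subinterval_le; trivial.
      intros t Ht. apply Rle_trans with (Rabs (v t)); [apply Rabs_pos | now apply Hb]. }
  intros Hy Hz. destruct (Rle_lt_dec z y).
  - apply Hle; lra.
  - rewrite Rabs_minus_sym. apply Hle; lra.
Qed.

(** The energy estimate bounds eps times the integral of v^2, hence w by O(G / eps) starting from w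
    0 = 0; then v is bounded by integrating the equation from a zero of v, which costs a second
    factor 1 / eps. The powers are crude, but the expansion can pay for them with two more
    orders. *)
Lemma a_priori_bound (gamma B : R) (b b1 c : R -> R) :
  coefficients b b1 c gamma B ->
  exists C, 0 < C /\
  forall (eps G : R) (w v g : R -> R),
    0 < eps <= 1 -> 0 < G -> cont_on 0 1 g ->
    (forall y, 0 <= y <= 1 -> is_derive w y (v y)) ->
    (forall y, 0 <= y <= 1 -> is_derive v y ((b y * v y + c y * w y - g y) / eps)) ->
    (forall y, 0 <= y <= 1 -> Rabs (g y) <= G) ->
    w 0 = 0 -> w 1 = 0 ->
    forall y, 0 <= y <= 1 -> Rabs (w y) <= C * G / eps ^ 2 /\ Rabs (v y) <= C * G / eps ^ 2.
Proof.
  intros Hco.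
  assert (Hg := coef_gamma Hco).
  assert (Hb := coef_cont_b Hco). assert (Hc := coef_cont_c Hco).
  assert (Hb1 := coef_cont_b1 Hco).
  assert (HB : 0 <= B).
  { apply Rle_trans with (Rabs (b 0)); [apply Rabs_pos | apply (coef_b Hco); lra]. }
  set (Ca := / (8 * gamma) + / 2).
  assert (HCa : 0 < Ca) by (unfold Ca; assert (0 < / (8 * gamma)) by (apply Rinv_0_lt_compat; lra); lra).
  assert (HBC : 0 <= B * Ca) by (apply Rmult_le_pos; lra).
  exists (2 * (B * Ca) + 1 + Ca). split; [lra|].
  intros eps G w v g He HG cg Hw Hv Hgb w0 w1.
  assert (cw : cont_on 0 1 w) by (intros y Hy; eapply is_derive_continuous; now apply Hw).
  assert (cv : cont_on 0 1 v) by (intros y Hy; eapply is_derive_continuous; now apply Hv).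
  (* testing the equation with w *)
  assert (E : eps * RInt (fun y => v y ^ 2) 0 1 <= G ^ 2 / (4 * gamma)).
  { assert (F : @eq R (RInt (fun y => (b y * v y + c y * w y - g y) * w y + eps * v y ^ 2
        - (b1 y / 2 * w y * w y + b y * v y * w y)) 0 1) 0).
    { rewrite (RInt_FTC (fun y => eps * v y * w y - b y / 2 * w y * w y)).
      - rewrite w0, w1; ring.
      - lra.
      - intros y Hy. assert (Db := coef_derive Hco y Hy).
        assert (D1 := Hw y Hy). assert (D2 := Hv y Hy).
        solve_derive. field. lra.
      - intros y Hy; solve_continuous. }
    apply Rle_trans with (RInt (fun y => (b y * v y + c y * w y - g y) * w y + eps * v y ^ 2
        - (b1 y / 2 * w y * w y + b y * v y * w y) + G ^ 2 / (4 * gamma)) 0 1).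
    - rewrite <- RInt_Rscal; solve_side.
      apply RInt_mono; solve_side.
      intros y Hy. assert (P := coef_coercive Hco y Hy).
      assert (Y := young gamma (w y) (g y) Hg).
      assert (Gy : g y ^ 2 <= G ^ 2) by (apply Rabs_le_sqr, Hgb; lra).
      assert (Gy' : g y ^ 2 / (4 * gamma) <= G ^ 2 / (4 * gamma))
        by (apply Rmult_le_compat_r; trivial; left; apply Rinv_0_lt_compat; lra).
      assert (0 <= (c y - b1 y / 2 - gamma) * w y ^ 2)
        by (apply Rmult_le_pos; [lra | apply pow2_ge_0]).
      lra.
    - rewrite RInt_Rplus, F, RInt_constR; solve_side. }
  (* A quadratic majorant of |v| in place of the Cauchy-Schwarz inequality; with these weights the
     energy bound makes its integral O(G / eps). *)
  set (q := fun y => eps / (2 * G) * v y ^ 2 + G / (2 * eps)).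
  assert (cq : cont_on 0 1 q) by (intros y Hy; unfold q; solve_continuous).
  assert (Hq : forall y, Rabs (v y) <= q y).
  { intros y. unfold q.
    assert (Hs : 0 < eps / (2 * G)) by (apply Rdiv_lt_0_compat; lra).
    assert (Y1 := young (eps / (2 * G)) (v y) 1 Hs).
    assert (Y2 := young (eps / (2 * G)) (v y) (-1) Hs).
    replace (1 ^ 2 / (4 * (eps / (2 * G)))) with (G / (2 * eps)) in Y1 by (field; lra).
    replace ((-1) ^ 2 / (4 * (eps / (2 * G)))) with (G / (2 * eps)) in Y2 by (field; lra).
    apply Rabs_le; lra. }
  assert (Iq : RInt q 0 1 <= Ca * (G / eps)).
  { unfold q. rewrite RInt_Rplus, RInt_Rscal, RInt_constR; solve_side.
    replace (eps / (2 * G) * RInt (fun y => v y ^ 2) 0 1)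
      with (/ (2 * G) * (eps * RInt (fun y => v y ^ 2) 0 1)) by (field; lra).
    assert (Hi : 0 <= / (2 * G)) by (left; apply Rinv_0_lt_compat; lra).
    apply Rmult_le_compat_l with (r := / (2 * G)) in E; trivial.
    replace (/ (2 * G) * (G ^ 2 / (4 * gamma))) with (/ (8 * gamma) * G) in E by (field; lra).
    assert (Ge : G <= G / eps).
    { unfold Rdiv. rewrite <- (Rmult_1_r G) at 1. apply Rmult_le_compat_l; [lra|].
      rewrite <- Rinv_1. apply Rinv_le_contravar; lra. }
    assert (/ (8 * gamma) * G <= / (8 * gamma) * (G / eps))
      by (apply Rmult_le_compat_l; trivial; left; apply Rinv_0_lt_compat; lra).
    replace (G / (2 * eps) * (1 - 0)) with (/ 2 * (G / eps)) by (field; lra).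
    unfold Ca. lra. }
  assert (Ww : forall y, 0 <= y <= 1 -> Rabs (w y) <= Ca * (G / eps)).
  { intros y Hy. replace (w y) with (w y - w 0) by (rewrite w0; ring).
    apply Rle_trans with (RInt q 0 1); trivial.
    apply Rabs_diff_le_RInt with v; trivial; lra. }
  assert (Ge2 : G / eps <= G / eps ^ 2).
  { replace (G / eps ^ 2) with (G / eps * / eps) by (field; lra).
    rewrite <- (Rmult_1_r (G / eps)) at 1. apply Rmult_le_compat_l.
    - left; apply Rdiv_lt_0_compat; lra.
    - rewrite <- Rinv_1. apply Rinv_le_contravar; lra. }
  assert (Ge20 : 0 < G / eps ^ 2) by (apply Rdiv_lt_0_compat; [lra | apply pow_lt; lra]).
  set (X := G / eps ^ 2) in *.
  assert (CX : Ca * (G / eps) <= Ca * X) by (apply Rmult_le_compat_l; lra).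
  assert (PBX : 0 <= B * Ca * X) by (apply Rmult_le_pos; lra).
  assert (PCX : 0 <= Ca * X) by (apply Rmult_le_pos; lra).
  replace ((2 * (B * Ca) + 1 + Ca) * G / eps ^ 2)
    with ((2 * (B * Ca) + 1 + Ca) * X) by (unfold X; field; lra).
  intros y Hy. split.
  - assert (W := Ww y Hy). lra.
  (* Rolle's theorem: [w] vanishes at both ends, so [v] has a zero [z]. *)
  - destruct (MVT_gen w 0 1 v) as [z [Hz Ez]]; rewrite ?Rmin_left, ?Rmax_right in * by lra.
    + intros t Ht; apply Hw; lra.
    + intros t Ht. apply continuity_pt_filterlim. now apply cw.
    + assert (Vz : v z = 0) by (rewrite w0, w1 in Ez; lra).
      replace (v y) with (v y - v z) by (rewrite Vz; ring).
      set (q2 := fun t => / eps * (B * q t + (B * (Ca * (G / eps)) + G))).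
      apply Rle_trans with (RInt q2 0 1).
      * apply Rabs_diff_le_RInt with (fun t => (b t * v t + c t * w t - g t) / eps); trivial.
        -- intros t Ht; solve_continuous.
        -- intros t Ht; unfold q2; solve_continuous.
        -- intros t Ht. unfold q2. unfold Rdiv. rewrite Rmult_comm, Rabs_mult.
           rewrite (Rabs_right (/ eps)) by (apply Rle_ge; left; apply Rinv_0_lt_compat; lra).
           apply Rmult_le_compat_l; [left; apply Rinv_0_lt_compat; lra|].
           unfold Rminus. eapply Rle_trans; [apply Rabs_triang|].
           rewrite Rabs_Ropp. rewrite <- Rplus_assoc. apply Rplus_le_compat; [|now apply Hgb].
           eapply Rle_trans; [apply Rabs_triang|]. rewrite !Rabs_mult.
           apply Rplus_le_compat; apply Rmult_le_compat; try apply Rabs_pos; trivial.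
           ++ now apply (coef_b Hco).
           ++ now apply (coef_c Hco).
           ++ now apply Ww.
      * unfold q2. rewrite RInt_Rscal, RInt_Rplus, RInt_Rscal, RInt_constR; try lra; trivial;
          try (intros t Ht; solve_continuous; fail).
        assert (Bq : B * RInt q 0 1 <= B * (Ca * (G / eps))) by (apply Rmult_le_compat_l; trivial).
        assert (Ge : G <= G / eps).
        { unfold Rdiv. rewrite <- (Rmult_1_r G) at 1. apply Rmult_le_compat_l; [lra|].
          rewrite <- Rinv_1. apply Rinv_le_contravar; lra. }
        apply Rle_trans with (/ eps * ((2 * (B * Ca) + 1) * (G / eps))).
        -- apply Rmult_le_compat_l; [left; apply Rinv_0_lt_compat; lra | lra].
        -- replace (/ eps * ((2 * (B * Ca) + 1) * (G / eps)))
             with ((2 * (B * Ca) + 1) * X) by (unfold X; field; lra). lra.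
Qed.

(** Retraction onto [0,1]: composing with it turns relative continuity on [0,1] into continuity on
    the whole line. *)
Definition clamp (x : R) : R := Rmax 0 (Rmin 1 x).

Lemma clamp_unit (x : R) : unit_interval (clamp x).
Proof. unfold clamp, unit_interval, Rmax, Rmin. repeat destruct Rle_dec; lra. Qed.

Lemma clamp_id (x : R) : unit_interval x -> clamp x = x.
Proof. unfold clamp, unit_interval, Rmax, Rmin. intros; repeat destruct Rle_dec; lra. Qed.

Lemma clamp_contract (x y : R) : Rabs (clamp y - clamp x) <= Rabs (y - x).
Proof.
  unfold clamp, Rmax, Rmin, Rabs. repeat destruct Rle_dec; repeat destruct Rcase_abs; lra.
Qed.

Lemma continuous_clamp (g : R -> R) (x : R) :
  continuous_on unit_interval g -> continuous (fun y => g (clamp y)) x.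
Proof.
  intros Hg. unfold continuous. eapply filterlim_comp; [|apply (Hg (clamp x)), clamp_unit].
  intros P [d Hd]. exists d. intros y Hy. apply Hd; [|apply clamp_unit].
  unfold ball in *; simpl in *; unfold AbsRing_ball, abs, minus, plus, opp in *; simpl in *.
  eapply Rle_lt_trans; [apply clamp_contract | exact Hy].
Qed.

Lemma constant_of_derive_0 (h : R -> R) (x y : R) :
  (forall z, Rmin x y < z < Rmax x y -> is_derive h z 0) ->
  (forall z, Rmin x y <= z <= Rmax x y -> continuous h z) -> h x = h y.
Proof.
  intros Hd Hc. destruct (MVT_gen h x y (fun _ => 0)) as [z [_ Hz]]; trivial.
  - intros z Hz. apply continuity_pt_filterlim. now apply Hc.
  - lra.
Qed.

Lemma primitive_exists (h : R -> R) (x0 y0 : R) :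
  (forall x, continuous h x) ->
  exists P : R -> R, P x0 = y0 /\ forall x, is_derive P x (h x).
Proof.
  intros Hh. exists (fun x => y0 + RInt h x0 x). split.
  - rewrite RInt_point. apply Rplus_0_r.
  - intros x. eapply is_derive_eq; [apply is_derive_Rplus; [apply is_derive_const0|]|].
    + apply (is_derive_RInt h (fun x => RInt h x0 x) x0 x); [|apply Hh].
      exists (mkposreal 1 Rlt_0_1). intros z _. apply (RInt_correct h).
      apply @ex_RInt_continuous. intros; apply Hh.
    + ring.
Qed.

(* The integrating factor [exp (- P / eps)], [P' = b], shows that [u'] extends continuously to the
   endpoints, so that [u] extends to a solution that is twice differentiable at 0 and 1. *)
Lemma bvp_solution_extends (eps : R) (b0 c0 f0 b c f u : R -> R) :
  0 < eps -> (forall x, continuous b x) -> (forall x, continuous c x) ->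
  (forall x, continuous f x) ->
  (forall x, unit_interval x -> b x = b0 x) -> (forall x, unit_interval x -> c x = c0 x) ->
  (forall x, unit_interval x -> f x = f0 x) ->
  solves_bvp eps b0 c0 f0 u ->
  exists U v : R -> R, (forall y, unit_interval y -> U y = u y) /\
    (forall y, 0 <= y <= 1 -> is_derive U y (v y)) /\
    (forall y, 0 <= y <= 1 -> is_derive v y ((b y * v y + c y * U y - f y) / eps)).
Proof.
  intros He Hb Hc Hf Eb Ec Ef [Hu [Hode _]].
  assert (cu := fun x => continuous_clamp u x Hu).
  destruct (primitive_exists b 0 0 Hb) as [P [_ HP]].
  assert (cP : forall x, continuous P x) by (intros x; eapply is_derive_continuous; apply HP).
  (* The derivative of [exp (- P / eps) * u'] according to the equation; it contains [u] but not
     [u'], hence is continuous up to the endpoints. *)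
  set (q := fun x => exp (- P x / eps) * ((c x * u (clamp x) - f x) / eps)).
  assert (cq : forall x, continuous q x) by (intros x; unfold q; solve_continuous).
  destruct (primitive_exists q 0 0 cq) as [Q [_ HQ]].
  assert (cQ : forall x, continuous Q x) by (intros x; eapply is_derive_continuous; apply HQ).
  (* The constant of integration is fixed at an interior point, because [u'] is only known
     inside. *)
  set (k := exp (- P (1 / 2) / eps) * Derive u (1 / 2) - Q (1 / 2)).
  set (v := fun x => exp (P x / eps) * (Q x + k)).
  assert (Hv : forall x, is_derive v x ((b x * v x + c x * u (clamp x) - f x) / eps)).
  { intros x. unfold v. assert (D1 := HP x). assert (D2 := HQ x). solve_derive. unfold q.
    replace (- P x / eps) with (- (P x / eps)) by (field; lra). rewrite exp_Ropp.
    field. split; [lra | apply Rgt_not_eq, exp_pos]. }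
  assert (cv : forall x, continuous v x) by (intros x; eapply is_derive_continuous; apply Hv).
  assert (Du : forall x, 0 < x < 1 -> Derive u x = v x).
  { intros x Hx.
    assert (K : exp (- P x / eps) * Derive u x - Q x = k).
    { apply (constant_of_derive_0 (fun x => exp (- P x / eps) * Derive u x - Q x)).
      - intros z Hz.
        assert (Hz' : 0 < z < 1) by (revert Hz; unfold Rmin, Rmax; destruct Rle_dec; lra).
        destruct (Hode z Hz') as [_ [D2 Eq]].
        assert (D2' : is_derive (Derive u) z (Derive_n u 2 z)) by (apply Derive_correct; trivial).
        assert (D1 := HP z). assert (D3 := HQ z).
        solve_derive. unfold q. rewrite (clamp_id z) by (unfold unit_interval; lra).
        rewrite Eb, Ec, Ef by (unfold unit_interval; lra). rewrite <- Eq. field. lra.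
      - intros z Hz.
        assert (Hz' : 0 < z < 1) by (revert Hz; unfold Rmin, Rmax; destruct Rle_dec; lra).
        destruct (Hode z Hz') as [_ [D2 _]].
        assert (cD : continuous (Derive u) z) by (now apply @ex_derive_continuous).
        solve_continuous. }
    unfold v. rewrite <- K.
    replace (- P x / eps) with (- (P x / eps)) by (field; lra). rewrite exp_Ropp.
    field. apply Rgt_not_eq, exp_pos. }
  destruct (primitive_exists v (1 / 2) (u (1 / 2)) cv) as [U [U0 HU]].
  assert (cU : forall x, continuous U x) by (intros x; eapply is_derive_continuous; apply HU).
  assert (EU : forall y, unit_interval y -> U y = u y).
  { intros y Hy. assert (E : U y - u (clamp y) = U (1 / 2) - u (clamp (1 / 2))).
    { apply (constant_of_derive_0 (fun y => U y - u (clamp y))).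
      - intros z Hz. unfold unit_interval in Hy.
        assert (Hz' : 0 < z < 1) by (revert Hz; unfold Rmin, Rmax; destruct Rle_dec; lra).
        assert (Dz : is_derive (fun y => u (clamp y)) z (v z)).
        { apply is_derive_ext_loc with u.
          - assert (Hm : 0 < Rmin z (1 - z)) by (apply Rmin_pos; lra).
            exists (mkposreal _ Hm). intros t Ht. rewrite clamp_id; trivial.
            apply ball_Rabs in Ht; simpl in Ht.
            assert (H1 := Rmin_l z (1 - z)). assert (H2 := Rmin_r z (1 - z)).
            apply Rabs_def2 in Ht. unfold unit_interval; lra.
          - rewrite <- Du by trivial. apply Derive_correct. now apply Hode. }
        assert (D := HU z). solve_derive. ring.
      - intros z _. solve_continuous. }
    rewrite !clamp_id, U0 in E by (unfold unit_interval in *; lra). lra. }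
  exists U, v. split; [exact EU | split].
  - intros y _; apply HU.
  - intros y Hy. eapply is_derive_eq; [apply Hv|]. now rewrite (clamp_id y Hy), (EU y Hy).
Qed.

(** * Asymptotic expansion of the solution *)

(** An open neighbourhood of [0,1] on which the functions of the expansion are differentiable in the
    ordinary sense; [d] will be so small that [b] has no zero there. *)
Definition dom (d x : R) : Prop := - d < x < 1 + d.

Fixpoint Cn (d : R) (n : nat) (f : R -> R) : Prop :=
  match n with
  | O => forall x, dom d x -> continuous f x
  | S n => exists f', (forall x, dom d x -> is_derive f x (f' x)) /\ Cn d n f'
  end.

Lemma Cn_cont (d : R) (n : nat) (f : R -> R) :
  Cn d n f -> forall x, dom d x -> continuous f x.
Proof.
  destruct n; simpl; trivial. intros [f' [H _]] x Hx.
  eapply is_derive_continuous; now apply H.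
Qed.

Lemma Cn_pred (d : R) (n : nat) (f : R -> R) : Cn d (S n) f -> Cn d n f.
Proof.
  revert f; induction n as [|n IH]; intros f H.
  - simpl; now apply Cn_cont with (n := 1%nat).
  - destruct H as [f' [H1 H2]]. exists f'. split; trivial. now apply IH.
Qed.

Lemma Cn_le (d : R) (m n : nat) (f : R -> R) : (m <= n)%nat -> Cn d n f -> Cn d m f.
Proof. induction 1; trivial. intros H1; apply IHle; now apply Cn_pred. Qed.

Lemma Cn_const (d : R) (n : nat) (c : R) : Cn d n (fun _ => c).
Proof.
  revert c; induction n as [|n IH]; intros c; simpl.
  - intros; apply continuous_const.
  - exists (fun _ => 0). split; [intros; apply is_derive_const0 | apply IH].
Qed.

Lemma Cn_plus (d : R) (n : nat) (f g : R -> R) :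
  Cn d n f -> Cn d n g -> Cn d n (fun x => f x + g x).
Proof.
  revert f g; induction n as [|n IH]; simpl; intros f g.
  - intros Hf Hg x Hx; specialize (Hf x Hx); specialize (Hg x Hx); solve_continuous.
  - intros [f' [Hf1 Hf2]] [g' [Hg1 Hg2]]. exists (fun x => f' x + g' x). split.
    + intros x Hx; apply is_derive_Rplus; auto.
    + now apply IH.
Qed.

Lemma Cn_mult (d : R) (n : nat) (f g : R -> R) :
  Cn d n f -> Cn d n g -> Cn d n (fun x => f x * g x).
Proof.
  revert f g; induction n as [|n IH]; intros f g Hf Hg.
  - simpl in *. intros x Hx; specialize (Hf x Hx); specialize (Hg x Hx); solve_continuous.
  - assert (Hf0 := Cn_pred d n f Hf). assert (Hg0 := Cn_pred d n g Hg).
    destruct Hf as [f' [Hf1 Hf2]], Hg as [g' [Hg1 Hg2]].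
    exists (fun x => f' x * g x + f x * g' x). split.
    + intros x Hx; apply is_derive_Rmult; auto.
    + apply Cn_plus; now apply IH.
Qed.

Lemma Cn_opp (d : R) (n : nat) (f : R -> R) : Cn d n f -> Cn d n (fun x => - f x).
Proof.
  revert f; induction n as [|n IH]; simpl; intros f.
  - intros Hf x Hx; specialize (Hf x Hx); solve_continuous.
  - intros [f' [H1 H2]]. exists (fun x => - f' x). split.
    + intros x Hx; apply is_derive_Ropp; auto.
    + now apply IH.
Qed.

Lemma Cn_minus (d : R) (n : nat) (f g : R -> R) :
  Cn d n f -> Cn d n g -> Cn d n (fun x => f x - g x).
Proof. intros Hf Hg. apply (Cn_plus d n f (fun x => - g x)); trivial. now apply Cn_opp. Qed.

Lemma Cn_inv (d : R) (n : nat) (f : R -> R) :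
  (forall x, dom d x -> f x <> 0) -> Cn d n f -> Cn d n (fun x => / f x).
Proof.
  intros H0; induction n as [|n IH]; intros Hf.
  - simpl in *. intros x Hx. specialize (Hf x Hx).
    apply (continuous_comp f Rinv); trivial.
    apply is_derive_continuous with (- / (f x) ^ 2). auto_derive; [now apply H0|].
    field; now apply H0.
  - assert (Hf0 := Cn_pred d n f Hf). destruct Hf as [f' [H1 H2]].
    exists (fun x => - (f' x * (/ f x * / f x))). split.
    + intros x Hx. eapply is_derive_eq; [apply is_derive_inv; auto|]. field. now apply H0.
    + apply Cn_opp. apply Cn_mult; trivial. apply Cn_mult; now apply IH.
Qed.

Lemma Cn_exp (d : R) (n : nat) (f : R -> R) : Cn d n f -> Cn d n (fun x => exp (f x)).
Proof.
  induction n as [|n IH]; intros Hf.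
  - simpl in *. intros x Hx; specialize (Hf x Hx); solve_continuous.
  - assert (Hf0 := Cn_pred d n f Hf). destruct Hf as [f' [H1 H2]].
    exists (fun x => f' x * exp (f x)). split.
    + intros x Hx; apply is_derive_exp_comp; auto.
    + apply Cn_mult; trivial. now apply IH.
Qed.

Lemma primitive_exists_dom (d : R) (h : R -> R) (x0 y0 : R) :
  dom d x0 -> (forall x, dom d x -> continuous h x) ->
  exists P : R -> R, P x0 = y0 /\ forall x, dom d x -> is_derive P x (h x).
Proof.
  intros H0 Hh. exists (fun x => y0 + RInt h x0 x). split.
  - rewrite RInt_point. apply Rplus_0_r.
  - intros x Hx. eapply is_derive_eq; [apply is_derive_Rplus; [apply is_derive_const0|]|].
    + apply (is_derive_RInt h (fun x => RInt h x0 x) x0 x); [|now apply Hh].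
      unfold dom in *.
      assert (Hm : 0 < Rmin (x + d) (1 + d - x)) by (apply Rmin_pos; lra).
      exists (mkposreal _ Hm). intros z Hz. apply (RInt_correct h).
      apply ball_Rabs in Hz; simpl in Hz.
      assert (H1 := Rmin_l (x + d) (1 + d - x)). assert (H2 := Rmin_r (x + d) (1 + d - x)).
      apply Rabs_def2 in Hz.
      apply @ex_RInt_continuous. intros t Ht; apply Hh.
      revert Ht; unfold Rmin, Rmax; destruct Rle_dec; lra.
    + ring.
Qed.

Lemma D_in_is_derive (g g' : R -> R) (x : R) :
  D_in g g' unit_interval x -> 0 < x < 1 -> is_derive g x (g' x).
Proof.
  intros H Hx. apply is_derive_Reals. intros e He.
  destruct (H e He) as [a [Ha H1]].
  assert (Hm : 0 < Rmin a (Rmin x (1 - x))) by (repeat apply Rmin_pos; lra).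
  exists (mkposreal _ Hm). intros h Hh0 Hh. simpl in Hh.
  assert (M1 := Rmin_l a (Rmin x (1 - x))). assert (M2 := Rmin_r a (Rmin x (1 - x))).
  assert (M3 := Rmin_l x (1 - x)). assert (M4 := Rmin_r x (1 - x)).
  assert (Hh' := Rabs_def2 _ _ Hh).
  specialize (H1 (x + h)). simpl in H1. unfold Rdist, D_x, unit_interval in H1.
  replace (x + h - x) with h in H1 by ring. apply H1. repeat split; lra.
Qed.

Lemma D_in_continuous_on (g g' : R -> R) :
  is_derivative_on_unit g g' -> continuous_on unit_interval g.
Proof.
  intros H x Hx. assert (Hc := cont_deriv g g' unit_interval x (H x Hx)).
  intros P [e He]. destruct (Hc e (cond_pos e)) as [a [Ha H1]].
  exists (mkposreal a Ha). intros y Hy Hyu. apply He.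
  destruct (Req_dec x y) as [->|Hn]; [apply ball_center|].
  unfold ball in *; simpl in *; unfold AbsRing_ball, abs, minus, plus, opp in *; simpl in *.
  apply (H1 y). repeat split; trivial; apply Hyu.
Qed.

(** Only the highest derivative is extended, by constants outside [0,1]; integrating back [m] times
    gives the class on the whole line. On [0,1] the primitive and [g] have the same derivative
    inside and agree at 0, so they coincide. *)
Lemma Cm_unit_extends (m : nat) (g : R -> R) :
  Cm_unit m g ->
  exists ge : R -> R, (forall x, unit_interval x -> ge x = g x) /\ forall d, Cn d m ge.
Proof.
  revert g; induction m as [|m IH]; intros g [D [D0 [D1 D2]]].
  - exists (fun x => D 0%nat (clamp x)). split.
    + intros x Hx. now rewrite clamp_id, D0.
    + intros d x _. now apply continuous_clamp.
  - destruct (IH (D 1%nat)) as [h [Hh Ch]].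
    { exists (fun i => D (S i)). split; [trivial | split; trivial]. intros i Hi; apply D1; lia. }
    assert (ch : forall x, continuous h x).
    { intros x. apply (Cn_cont (Rabs x + 1) m h (Ch _)). unfold dom.
      assert (H1 := Rle_abs x). assert (H2 := Rle_abs (- x)). rewrite Rabs_Ropp in H2. lra. }
    destruct (primitive_exists h 0 (D 0%nat 0) ch) as [P [P0 HP]].
    assert (cP : forall x, continuous P x) by (intros x; eapply is_derive_continuous; apply HP).
    assert (cD := fun x => continuous_clamp _ x (D_in_continuous_on _ _ (D1 0%nat (Nat.lt_0_succ m)))).
    exists P. split.
    + intros x Hx. rewrite <- D0 by trivial.
      assert (E : P x - D 0%nat (clamp x) = P 0 - D 0%nat (clamp 0)).
      { apply (constant_of_derive_0 (fun x => P x - D 0%nat (clamp x))).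
        - intros z Hz. unfold unit_interval in Hx.
          assert (Hz' : 0 < z < 1) by (revert Hz; unfold Rmin, Rmax; destruct Rle_dec; lra).
          assert (Dz : is_derive (fun y => D 0%nat (clamp y)) z (D 1%nat z)).
          { apply is_derive_ext_loc with (D 0%nat).
            - assert (Hm : 0 < Rmin z (1 - z)) by (apply Rmin_pos; lra).
              exists (mkposreal _ Hm). intros t Ht. rewrite clamp_id; trivial.
              apply ball_Rabs in Ht; simpl in Ht.
              assert (H1 := Rmin_l z (1 - z)). assert (H2 := Rmin_r z (1 - z)).
              apply Rabs_def2 in Ht. unfold unit_interval; lra.
            - apply D_in_is_derive; trivial. apply D1; [lia | unfold unit_interval; lra]. }
          assert (Dp := HP z). solve_derive.
          rewrite Hh by (unfold unit_interval; lra). ring.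
        - intros z _. solve_continuous. }
      rewrite P0, !clamp_id in E by (unfold unit_interval in *; lra). lra.
    + intros d. exists h. split; [intros; apply HP | apply Ch].
Qed.

(** Variation of constants with the integrating factor [exp P], [P' = p]. Primitives are taken from
    [x0], so the data can be imposed at either endpoint. *)
Lemma linear_ode (d : R) (n : nat) (p g : R -> R) (x0 y0 : R) :
  dom d x0 -> Cn d n p -> Cn d n g ->
  exists S, Cn d n S /\ S x0 = y0 /\ forall x, dom d x -> is_derive S x (g x - p x * S x).
Proof.
  intros H0 Hp Hg.
  destruct (primitive_exists_dom d p x0 0 H0 (Cn_cont d n p Hp)) as [P [P0 HP]].
  assert (CP : Cn d n P) by (apply Cn_pred; exists p; now split).
  assert (Cq : Cn d n (fun x => exp (P x) * g x)) by (apply Cn_mult; trivial; now apply Cn_exp).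
  destruct (primitive_exists_dom d _ x0 y0 H0 (Cn_cont d n _ Cq)) as [Q [Q0 HQ]].
  assert (CQ : Cn d n Q) by (apply Cn_pred; eexists; split; [exact HQ | trivial]).
  exists (fun x => exp (- P x) * Q x). split; [|split].
  - apply Cn_mult; trivial. apply (Cn_exp d n (fun x => - P x)). now apply Cn_opp.
  - rewrite P0, Q0, Ropp_0, exp_0; ring.
  - intros x Hx. assert (D1 := HP x Hx). assert (D2 := HQ x Hx). solve_derive.
    rewrite exp_Ropp. field. apply Rgt_not_eq, exp_pos.
Qed.

Lemma Cn_chain (d : R) (n : nat) (f : R -> R) :
  Cn d n f ->
  exists F : nat -> R -> R, F 0%nat = f /\
    (forall l, (l < n)%nat -> forall x, dom d x -> is_derive (F l) x (F (S l) x)) /\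
    (forall l, (l <= n)%nat -> forall x, dom d x -> continuous (F l) x).
Proof.
  revert f; induction n as [|n IH]; intros f Hf.
  - exists (fun _ => f). split; [trivial | split]; [intros; lia | intros l _; exact Hf].
  - assert (cf := Cn_cont d _ f Hf). destruct Hf as [f' [H1 H2]].
    destruct (IH f' H2) as [F [F0 [F1 F2]]].
    exists (fun l => match l with O => f | S l => F l end). split; [reflexivity | split].
    + intros [|l] Hl x Hx; [rewrite F0; now apply H1 | apply F1; trivial; lia].
    + intros [|l] Hl x Hx; [now apply cf | apply F2; trivial; lia].
Qed.

Lemma bounded_unit (f : R -> R) :
  cont_on 0 1 f -> exists C, 0 < C /\ forall x, 0 <= x <= 1 -> Rabs (f x) <= C.
Proof.
  intros Hf. destruct (bounded_continuity f 0 1) as [C HC].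
  - intros x Hx. now apply Hf.
  - exists (Rabs C + 1). assert (H := Rabs_pos C). split; [lra|].
    intros x Hx. assert (H1 := HC x Hx). assert (H2 := Rle_abs C).
    unfold norm in H1; simpl in H1; unfold abs in H1; simpl in H1. lra.
Qed.

Lemma uniform_constant (P : nat -> R -> Prop) (n : nat) :
  (forall l C C', P l C -> C <= C' -> P l C') ->
  (forall l, (l <= n)%nat -> exists C, P l C) ->
  exists C, 0 < C /\ forall l, (l <= n)%nat -> P l C.
Proof.
  intros Hm; induction n as [|n IH]; intros H.
  - destruct (H 0%nat) as [C HC]; trivial. exists (Rmax C 1). split.
    + assert (M := Rmax_r C 1). lra.
    + intros l Hl. replace l with 0%nat by lia. apply Hm with C; trivial. apply Rmax_l.
  - destruct IH as [C1 [P1 H1]]; [intros; apply H; lia|].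
    destruct (H (S n)) as [C2 H2]; trivial. exists (Rmax C1 C2). split.
    + assert (M := Rmax_l C1 C2). lra.
    + intros l Hl. destruct (Nat.eq_dec l (S n)) as [->|Hn].
      * apply Hm with C2; trivial. apply Rmax_r.
      * apply Hm with C1; [apply H1; lia | apply Rmax_l].
Qed.

(* [F l eps] is the [l]-th derivative of a function of [x] that depends on the parameter [eps]. *)
Record smooth_family (d : R) (n : nat) (F : nat -> R -> R -> R) : Prop := {
  fam_derive : forall l eps x, (l < n)%nat -> 0 < eps <= 1 -> dom d x ->
    is_derive (F l eps) x (F (S l) eps x);
  fam_bound : exists C, 0 < C /\ forall l eps x, (l <= n)%nat -> 0 < eps <= 1 ->
    0 <= x <= 1 -> Rabs (F l eps x) <= C
}.

(* The asymptotic expansion in powers of [eps]: the leading term solves the reduced first-order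
   problem, and its second derivative is the right-hand side for the next one. *)
Lemma asymptotic_expansion (d : R) (M n : nat) (p q f : R -> R) (x0 y0 : R) :
  0 < d -> dom d x0 -> (forall x, dom d x -> p x <> 0) ->
  Cn d (n + M) p -> Cn d (n + M) q -> Cn d (n + M) f ->
  exists (F : nat -> R -> R -> R) (g : R -> R),
    smooth_family d n F /\ (forall x, dom d x -> continuous g x) /\
    (forall eps, F 0%nat eps x0 = y0) /\
    (forall eps x, 0 < eps <= 1 -> dom d x ->
       - eps * F 2%nat eps x + p x * F 1%nat eps x + q x * F 0%nat eps x
       = f x - eps ^ M * g x).
Proof.
  intros Hd H0 Hp. revert f y0. induction M as [|M IH]; intros f y0 Cp Cq Cf.
  (* At order 0 the residual need not be small, so the constant [y0] will do. *)
  - exists (fun l _ _ => match l with O => y0 | _ => 0 end), (fun x => f x - q x * y0).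
    split; [split | split; [|split; [trivial|]]].
    + intros [|l] eps x _ _ _; apply is_derive_const0.
    + exists (Rabs y0 + 1). assert (P := Rabs_pos y0). split; [lra|].
      intros [|l] eps x _ _ _; [lra | rewrite Rabs_R0; lra].
    + apply (Cn_cont d (n + 0)). apply Cn_minus; trivial. apply Cn_mult; trivial. apply Cn_const.
    + intros eps x _ _. simpl. ring.
  - assert (Cpi : Cn d (n + S M) (fun x => / p x)) by now apply Cn_inv.
    destruct (linear_ode d (n + S M) (fun x => q x * / p x) (fun x => f x * / p x) x0 y0)
      as [S0 [CS [S00 DS]]]; trivial; [now apply Cn_mult | now apply Cn_mult |].
    (* The derivative of [S0], written through its equation: it is as regular as [S0], so the second
       derivative loses only one degree, and each order of the expansion costs one derivative of the
       data. *)
    set (s1 := fun x => f x * / p x - q x * / p x * S0 x) in *.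
    assert (Cs1 : Cn d (n + S M) s1)
      by (apply Cn_minus; [now apply Cn_mult | apply Cn_mult; trivial; now apply Cn_mult]).
    assert (cs1 := Cn_cont _ _ _ Cs1).
    replace (n + S M)%nat with (S (n + M)) in Cs1 by lia.
    destruct Cs1 as [s2 [Ds1 Cs2]].
    destruct (Cn_chain d (n + M) s2 Cs2) as [Hc [Hc0 [Hc1 Hc2]]].
    destruct (IH s2 0) as [T [g [[TD [CT [CT0 TB]]] [cg [T0 TE]]]]];
      [apply Cn_le with (n + S M)%nat; trivial; lia
      |apply Cn_le with (n + S M)%nat; trivial; lia | exact Cs2 |].
    set (G := fun l => match l with O => S0 | S O => s1 | S (S l) => Hc l end).
    assert (GD : forall l x, (l < n)%nat -> dom d x -> is_derive (G l) x (G (S l) x)).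
    { intros [|[|l]] x Hl Hx; simpl.
      - now apply DS.
      - rewrite Hc0. now apply Ds1.
      - apply Hc1; trivial; lia. }
    assert (GB : exists C, 0 < C /\ forall l, (l <= n)%nat -> forall x, 0 <= x <= 1 ->
       Rabs (G l x) <= C).
    { apply (uniform_constant (fun l C => forall x, 0 <= x <= 1 -> Rabs (G l x) <= C)).
      - intros l C C' HC Hle x Hx. apply Rle_trans with C; auto.
      - intros l Hl. destruct (bounded_unit (G l)) as [C [_ HC]]; [|now exists C].
        intros x Hx. assert (Dx : dom d x) by (unfold dom; lra).
        destruct l as [|[|l]]; simpl.
        + now apply (Cn_cont d (n + S M)).
        + now apply cs1.
        + apply Hc2; trivial; lia. }
    destruct GB as [CG [CG0 GB]].
    exists (fun l eps x => G l x + eps * T l eps x), g. split; [split | split; [trivial|split]].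
    + intros l eps x Hl He Hx. assert (D1 := GD l x Hl Hx). assert (D2 := TD l eps x Hl He Hx).
      solve_derive. ring.
    + exists (CG + CT). split; [lra|]. intros l eps x Hl He Hx.
      eapply Rle_trans; [apply Rabs_triang|]. apply Rplus_le_compat; [now apply GB|].
      rewrite Rabs_mult, (Rabs_right eps) by lra.
      assert (B := TB l eps x Hl He Hx). assert (P := Rabs_pos (T l eps x)).
      assert (0 <= (1 - eps) * Rabs (T l eps x)) by (apply Rmult_le_pos; lra). lra.
    + intros eps. simpl. rewrite S00, T0. ring.
    + intros eps x He Hx. assert (E := TE eps x He Hx). simpl. rewrite Hc0.
      assert (Px := Hp x Hx).
      replace (p x * (s1 x + eps * T 1%nat eps x))
        with (f x - q x * S0 x + eps * (p x * T 1%nat eps x))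
        by (unfold s1; field; trivial).
      apply Rmult_eq_compat_l with (r := eps) in E. lra.
Qed.

Definition bounded_family (P : R -> R -> R) : Prop :=
  exists C, 0 < C /\ forall eps x, 0 < eps <= 1 -> 0 <= x <= 1 -> Rabs (P eps x) <= C.

(** Regularity with bounds uniform in [eps]. The recursive form is stable under products without the
    Leibniz sums that the indexed [smooth_family] would call for. *)
Fixpoint uniform_Cn (d : R) (n : nat) (P : R -> R -> R) : Prop :=
  bounded_family P /\
  match n with
  | O => True
  | S n => exists P', (forall eps x, 0 < eps <= 1 -> dom d x -> is_derive (P eps) x (P' eps x))
                      /\ uniform_Cn d n P'
  end.

Lemma uniform_Cn_pred (d : R) (n : nat) (P : R -> R -> R) :
  uniform_Cn d (S n) P -> uniform_Cn d n P.
Proof.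
  revert P; induction n as [|n IH]; intros P [H [P' [H1 H2]]].
  - now split.
  - split; trivial. exists P'. split; trivial. now apply IH.
Qed.

Lemma bounded_family_plus (P Q : R -> R -> R) :
  bounded_family P -> bounded_family Q -> bounded_family (fun eps x => P eps x + Q eps x).
Proof.
  intros [C [HC H]] [C' [HC' H']]. exists (C + C'). split; [lra|]. intros eps x He Hx.
  eapply Rle_trans; [apply Rabs_triang|]. apply Rplus_le_compat; auto.
Qed.

Lemma bounded_family_mult (P Q : R -> R -> R) :
  bounded_family P -> bounded_family Q -> bounded_family (fun eps x => P eps x * Q eps x).
Proof.
  intros [C [HC H]] [C' [HC' H']]. exists (C * C'). split; [now apply Rmult_lt_0_compat|].
  intros eps x He Hx. rewrite Rabs_mult. apply Rmult_le_compat; auto using Rabs_pos.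
Qed.

Lemma uniform_Cn_plus (d : R) (n : nat) (P Q : R -> R -> R) :
  uniform_Cn d n P -> uniform_Cn d n Q -> uniform_Cn d n (fun eps x => P eps x + Q eps x).
Proof.
  revert P Q; induction n as [|n IH]; intros P Q [HP HP'] [HQ HQ'];
    (split; [now apply bounded_family_plus|]); trivial.
  destruct HP' as [P' [H1 H2]], HQ' as [Q' [H3 H4]].
  exists (fun eps x => P' eps x + Q' eps x). split.
  - intros eps x He Hx. apply is_derive_Rplus; auto.
  - now apply IH.
Qed.

Lemma uniform_Cn_mult (d : R) (n : nat) (P Q : R -> R -> R) :
  uniform_Cn d n P -> uniform_Cn d n Q -> uniform_Cn d n (fun eps x => P eps x * Q eps x).
Proof.
  revert P Q; induction n as [|n IH]; intros P Q HP HQ.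
  - split; trivial. apply bounded_family_mult; [apply HP | apply HQ].
  - assert (HP0 := uniform_Cn_pred d n P HP). assert (HQ0 := uniform_Cn_pred d n Q HQ).
    destruct HP as [BP [P' [H1 H2]]], HQ as [BQ [Q' [H3 H4]]].
    split; [now apply bounded_family_mult|].
    exists (fun eps x => P' eps x * Q eps x + P eps x * Q' eps x). split.
    + intros eps x He Hx. apply is_derive_Rmult; auto.
    + apply uniform_Cn_plus; now apply IH.
Qed.

Lemma uniform_Cn_const (d : R) (n : nat) (a : R -> R) :
  bounded_family (fun eps _ => a eps) -> uniform_Cn d n (fun eps _ => a eps).
Proof.
  revert a; induction n as [|n IH]; intros a Ha; split; trivial.
  exists (fun _ _ => 0). split.
  - intros; apply is_derive_const0.
  - apply (IH (fun _ => 0)). exists 1. split; [lra|]. intros; rewrite Rabs_R0; lra.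
Qed.

Lemma uniform_Cn_of_Cn (d : R) (n : nat) (f : R -> R) :
  0 < d -> Cn d n f -> uniform_Cn d n (fun _ => f).
Proof.
  intros Hd. revert f; induction n as [|n IH]; intros f Hf.
  - split; trivial. destruct (bounded_unit f) as [C [HC H]].
    + intros x Hx; apply Hf; unfold dom; lra.
    + exists C. split; auto.
  - split.
    + destruct (bounded_unit f) as [C [HC H]].
      * intros x Hx; apply (Cn_cont d (S n)); trivial; unfold dom; lra.
      * exists C. split; auto.
    + destruct Hf as [f' [H1 H2]]. exists (fun _ => f'). split; auto.
Qed.

Lemma uniform_Cn_of_family (d : R) (n : nat) (F : nat -> R -> R -> R) :
  smooth_family d n F -> uniform_Cn d n (F 0%nat).
Proof.
  revert F; induction n as [|n IH]; intros F [HD [C [HC HB]]].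
  - split; trivial. exists C. split; trivial. intros; apply HB; trivial.
  - split.
    + exists C. split; trivial. intros; apply HB; trivial; lia.
    + exists (F 1%nat). split.
      * intros; apply HD; trivial; lia.
      * apply (IH (fun l => F (S l))). split.
        -- intros; apply HD; trivial; lia.
        -- exists C. split; trivial. intros; apply HB; trivial; lia.
Qed.

(** One differentiation gives exp (- beta / eps) (b P + eps P') / eps: the same form with a new
    amplitude that is again uniformly smooth, at the cost of one factor 1 / eps. Iteration yields
    the whole family. *)
Lemma layer_family (d : R) (n : nat) (b beta : R -> R) (P : R -> R -> R) :
  (forall x, dom d x -> is_derive beta x (- b x)) ->
  uniform_Cn d n (fun _ => b) -> uniform_Cn d n P ->
  exists F : nat -> R -> R -> R,
    F 0%nat = (fun eps x => exp (- beta x / eps) * P eps x) /\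
    (forall l eps x, (l < n)%nat -> 0 < eps <= 1 -> dom d x ->
       is_derive (F l eps) x (F (S l) eps x)) /\
    exists C, 0 < C /\ forall l eps x, (l <= n)%nat -> 0 < eps <= 1 -> 0 <= x <= 1 ->
      Rabs (F l eps x) <= C * (/ eps) ^ l * exp (- beta x / eps).
Proof.
  intros Hbeta Hb. revert P; induction n as [|n IH]; intros P HP.
  - exists (fun _ eps x => exp (- beta x / eps) * P eps x). split; [reflexivity | split].
    + intros; lia.
    + destruct HP as [[C [HC HB]] _]. exists C. split; trivial.
      intros l eps x Hl He Hx. replace l with 0%nat by lia. simpl.
      rewrite Rabs_mult, (Rabs_right (exp _)) by (left; apply exp_pos).
      rewrite Rmult_1_r, Rmult_comm. apply Rmult_le_compat_r; [left; apply exp_pos | now apply HB].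
  - assert (Hb0 := uniform_Cn_pred _ _ _ Hb). assert (HP0 := uniform_Cn_pred _ _ _ HP).
    destruct HP as [[C [HC HB]] [P' [H1 H2]]].
    destruct (IH Hb0 (fun eps x => b x * P eps x + eps * P' eps x)) as [F [F0 [FD [C' [HC' FB]]]]].
    { apply uniform_Cn_plus.
      - now apply (uniform_Cn_mult d n (fun _ => b)).
      - apply uniform_Cn_mult; trivial. apply (uniform_Cn_const d n (fun eps => eps)).
        exists 1. split; [lra|]. intros eps x He _; rewrite Rabs_right; lra. }
    exists (fun l eps x => match l with O => exp (- beta x / eps) * P eps x
                                      | S l => / eps * F l eps x end).
    split; [reflexivity | split].
    + intros [|l] eps x Hl He Hx.
      * rewrite F0. assert (D1 := Hbeta x Hx). assert (D2 := H1 eps x He Hx).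
        solve_derive. field. lra.
      * assert (D1 := FD l eps x ltac:(lia) He Hx). solve_derive. ring.
    + exists (C + C'). split; [lra|]. intros [|l] eps x Hl He Hx.
      * rewrite Rabs_mult, (Rabs_right (exp _)) by (left; apply exp_pos).
        simpl. rewrite Rmult_1_r, Rmult_comm. apply Rmult_le_compat_r; [left; apply exp_pos|].
        assert (H := HB eps x He Hx). lra.
      * assert (Hi : 0 < / eps) by (apply Rinv_0_lt_compat; lra).
        rewrite Rabs_mult, (Rabs_right (/ eps)) by lra. simpl.
        assert (H := FB l eps x ltac:(lia) He Hx).
        apply Rle_trans with (/ eps * (C' * (/ eps) ^ l * exp (- beta x / eps))).
        -- apply Rmult_le_compat_l; lra.
        -- assert (0 <= / eps * (C * (/ eps) ^ l * exp (- beta x / eps))).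
           { apply Rmult_le_pos; [lra|]. apply Rmult_le_pos; [|left; apply exp_pos].
             apply Rmult_le_pos; [lra | left; now apply pow_lt]. }
           lra.
Qed.

Lemma exp_pow (t : R) (n : nat) : exp (INR n * t) = exp t ^ n.
Proof.
  induction n as [|n IH].
  - simpl. now rewrite Rmult_0_l, exp_0.
  - rewrite S_INR, Rmult_plus_distr_r, Rmult_1_l, exp_plus, IH. simpl. ring.
Qed.

(** From exp (- s) <= 1 / s with s = alpha / (M eps), raised to the power [M]. *)
Lemma exp_neg_le_pow (M : nat) (alpha eps : R) :
  0 < alpha -> 0 < eps -> (1 <= M)%nat -> exp (- alpha / eps) <= (INR M / alpha) ^ M * eps ^ M.
Proof.
  intros Ha He HM. assert (HMR : 0 < INR M) by (apply lt_0_INR; lia).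
  assert (Ht : 0 < alpha / (INR M * eps))
    by (apply Rdiv_lt_0_compat; trivial; now apply Rmult_lt_0_compat).
  rewrite <- Rpow_mult_distr.
  replace (- alpha / eps) with (INR M * (- (alpha / (INR M * eps)))) by (field; lra).
  rewrite exp_pow. apply pow_incr. split; [left; apply exp_pos|].
  rewrite exp_Ropp.
  replace (INR M / alpha * eps) with (/ (alpha / (INR M * eps))) by (field; lra).
  apply Rinv_le_contravar; trivial.
  assert (H := exp_ineq1_le (alpha / (INR M * eps))). lra.
Qed.

(** Order k + 1 is what interpolation in P_k consumes. The two end conditions make the approximation
    vanish at 0 and 1: at 0 only [S] is interpolated, at 1 both parts are. The value of [E] at 0 is
    left to the remainder. *)
Record layer_decomposition (k : nat) (alpha C eps : R) (U v : R -> R) (S E : nat -> R -> R)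
    : Prop := {
  dec_S_derive : forall l x, (l <= k)%nat -> 0 <= x <= 1 -> is_derive (S l) x (S (l + 1)%nat x);
  dec_E_derive : forall l x, (l <= k)%nat -> 0 <= x <= 1 -> is_derive (E l) x (E (l + 1)%nat x);
  dec_S_bound : forall l x, (l <= k + 1)%nat -> 0 <= x <= 1 -> Rabs (S l x) <= C;
  dec_E_bound : forall l x, (l <= k + 1)%nat -> 0 <= x <= 1 ->
    Rabs (E l x) <= C * (/ eps) ^ l * exp (- alpha * (1 - x) / eps);
  dec_remainder : forall x, 0 <= x <= 1 ->
    Rabs (U x - S 0%nat x - E 0%nat x) <= C * eps ^ k
    /\ Rabs (v x - S 1%nat x - E 1%nat x) <= C * eps ^ k;
  dec_S_0 : S 0%nat 0 = 0;
  dec_1 : S 0%nat 1 + E 0%nat 1 = 0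
}.

Arguments dec_S_derive {_ _ _ _ _ _ _ _}.
Arguments dec_E_derive {_ _ _ _ _ _ _ _}.
Arguments dec_S_bound {_ _ _ _ _ _ _ _}.
Arguments dec_E_bound {_ _ _ _ _ _ _ _}.
Arguments dec_remainder {_ _ _ _ _ _ _ _}.
Arguments dec_S_0 {_ _ _ _ _ _ _ _}.
Arguments dec_1 {_ _ _ _ _ _ _ _}.

(* The layer part is the WKB expansion [exp (- beta / eps) * A], [beta' = - b], whose amplitude
   satisfies [- eps A'' - b A' + (c - b') A = O(eps ^ M)]. *)
Lemma layer_decomposition_exists (k : nat) (d alpha gamma B : R) (b b1 c f : R -> R) :
  (1 <= k)%nat -> 0 < d -> 0 < alpha -> coefficients b b1 c gamma B ->
  (forall x, 0 <= x <= 1 -> alpha <= b x) ->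
  (forall x, dom d x -> b x <> 0) ->
  (forall x, dom d x -> is_derive b x (b1 x)) ->
  Cn d (k + 2 + (k + 2)) b -> Cn d (k + 2 + (k + 2)) b1 -> Cn d (k + 2 + (k + 2)) c ->
  Cn d (k + 2 + (k + 2)) f ->
  exists C, 0 < C /\ forall (eps : R) (U v : R -> R),
    0 < eps <= 1 ->
    (forall y, 0 <= y <= 1 -> is_derive U y (v y)) ->
    (forall y, 0 <= y <= 1 -> is_derive v y ((b y * v y + c y * U y - f y) / eps)) ->
    U 0 = 0 -> U 1 = 0 ->
    exists S E, layer_decomposition k alpha C eps U v S E.
Proof.
  intros Hk Hd Ha Hco Hab Hb0 Hb1 Cb Cb1 Cc Cf.
  assert (D0 : dom d 0) by (unfold dom; lra). assert (D1 : dom d 1) by (unfold dom; lra).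
  assert (Du : forall x, 0 <= x <= 1 -> dom d x) by (unfold dom; intros; lra).
  destruct (asymptotic_expansion d (k + 2) (k + 2) b c f 0 0)
    as [F [gS [FS [cgS [F0 FE]]]]]; trivial.
  (* The amplitude is transported from the outflow end, where it is normalised to 1; the factor
     [a eps] below gives it its size. *)
  destruct (asymptotic_expansion d (k + 2) (k + 2) (fun x => - b x) (fun x => c x - b1 x)
    (fun _ => 0) 1 1) as [A [gA [AS [cgA [A0 AE]]]]]; trivial.
  { intros x Hx. assert (H := Hb0 x Hx). lra. }
  { now apply Cn_opp. }
  { now apply Cn_minus. }
  { apply Cn_const. }
  destruct (primitive_exists_dom d (fun x => - b x) 1 0 D1) as [beta [b0 Hbeta]].
  { intros x Hx. apply continuous_Ropp. now apply (Cn_cont d _ b Cb). }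
  (* Integrating b >= alpha from x to 1 places the WKB exponential below the model weight exp (-
     alpha (1 - x) / eps). *)
  assert (Hbe : forall x, 0 <= x <= 1 -> alpha * (1 - x) <= beta x).
  { intros x Hx. destruct (MVT_gen beta x 1 (fun t => - b t)) as [z [Hz Ez]];
      rewrite ?Rmin_left, ?Rmax_right in * by lra.
    - intros t Ht; apply Hbeta, Du; lra.
    - intros t Ht. apply continuity_pt_filterlim. eapply is_derive_continuous, Hbeta, Du; lra.
    - rewrite b0 in Ez. assert (H : alpha <= b z) by (apply Hab; lra).
      assert (0 <= (b z - alpha) * (1 - x)) by (apply Rmult_le_pos; lra). lra. }
  destruct FS as [FD [CF [HCF FB]]].
  assert (AU := uniform_Cn_of_family _ _ _ AS).
  destruct AS as [AD [CA [HCA AB]]].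
  (* For positive [eps] this is minus the value of the regular part at 1, so that both parts cancel
     there. *)
  set (a := fun eps => - F 0%nat (Rmax eps 0) 1).
  assert (Ea : forall eps, 0 < eps -> a eps = - F 0%nat eps 1)
    by (intros; unfold a; now rewrite Rmax_left by lra).
  assert (Ba : forall eps, 0 < eps <= 1 -> Rabs (a eps) <= CF).
  { intros eps He. rewrite Ea, Rabs_Ropp by lra. apply FB; trivial; [lia | lra]. }
  assert (cb1 := coef_cont_b1 Hco).
  destruct (layer_family d (k + 2) b beta (fun eps x => a eps * A 0%nat eps x) Hbeta)
    as [L [L0 [LD [CL [HCL LB]]]]].
  { apply uniform_Cn_of_Cn; trivial. now apply Cn_le with (k + 2 + (k + 2))%nat; [lia|]. }
  { apply uniform_Cn_mult; trivial. apply uniform_Cn_const. exists CF. split; trivial.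
    intros; now apply Ba. }
  destruct (bounded_unit gS) as [CgS [HCgS BgS]]; [intros x Hx; now apply cgS, Du|].
  destruct (bounded_unit gA) as [CgA [HCgA BgA]]; [intros x Hx; now apply cgA, Du|].
  destruct (a_priori_bound gamma B b b1 c Hco) as [Cp [HCp AP]].
  assert (HB : 0 <= B).
  { apply Rle_trans with (Rabs (b 0)); [apply Rabs_pos | apply (coef_b Hco); lra]. }
  set (M := (k + 2)%nat) in *.
  set (Ce := CL * (INR M / alpha) ^ M).
  assert (HCe : 0 < Ce).
  { unfold Ce. apply Rmult_lt_0_compat; trivial. apply pow_lt, Rdiv_lt_0_compat; trivial.
    apply lt_0_INR; unfold M; lia. }
  (* Residuals of the regular part, of the layer part and of the affine corrector [(1 - x) * e0],
     all in units of eps^M. *)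
  set (G := CgS + CF * CgA + 2 * B * Ce).
  assert (HCFA : 0 < CF * CgA) by now apply Rmult_lt_0_compat.
  assert (HG : 0 < G).
  { unfold G. assert (0 <= B * Ce) by (apply Rmult_le_pos; lra). lra. }
  assert (HCG : 0 < Cp * G) by now apply Rmult_lt_0_compat.
  exists (CF + CL + Cp * G + Ce). split; [lra|].
  intros eps U v He HU Hv U0 U1.
  exists (fun l => F l eps), (fun l => L l eps).
  assert (Hexp : forall x, 0 <= x <= 1 -> exp (- beta x / eps) <= exp (- alpha * (1 - x) / eps)).
  { intros x Hx. assert (H := Hbe x Hx).
    destruct H as [H|H].
    - left. apply exp_increasing. apply Rmult_lt_compat_r; [apply Rinv_0_lt_compat; lra | lra].
    - right. f_equal. f_equal. lra. }
  assert (Hexp1 : forall x, 0 <= x <= 1 -> exp (- beta x / eps) <= 1).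
  { intros x Hx. rewrite <- exp_0. assert (H := Hbe x Hx).
    assert (0 <= alpha * (1 - x)) by (apply Rmult_le_pos; lra).
    assert (Hi : 0 < / eps) by (apply Rinv_0_lt_compat; lra).
    assert (Hm : - beta x / eps <= 0).
    { unfold Rdiv. rewrite <- (Rmult_0_l (/ eps)). apply Rmult_le_compat_r; lra. }
    destruct Hm as [Hm|Hm]; [left; now apply exp_increasing | right; now rewrite Hm]. }
  assert (pM : 0 < eps ^ M) by (apply pow_lt; lra).
  assert (pk : 0 < eps ^ k) by (apply pow_lt; lra).
  assert (EM : eps ^ M = eps ^ k * eps ^ 2) by (unfold M; now rewrite pow_add).
  assert (LM : eps ^ M <= eps ^ k).
  { rewrite EM. rewrite <- (Rmult_1_r (eps ^ k)) at 2. apply Rmult_le_compat_l; [lra|].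
    rewrite <- (pow1 2). apply pow_incr; lra. }
  (* The layer need not vanish at 0. Its value there is exponentially small, hence O(eps^M), and the
     corrector [(1 - x) * e0] removes it, so that [w] vanishes at both ends. *)
  set (e0 := L 0%nat eps 0).
  assert (Be0 : Rabs e0 <= Ce * eps ^ M).
  { eapply Rle_trans; [apply LB; trivial; try lia; lra|]. simpl. rewrite Rmult_1_r.
    unfold Ce. rewrite Rmult_assoc. apply Rmult_le_compat_l; [lra|].
    eapply Rle_trans; [apply Hexp; lra|].
    replace (- alpha * (1 - 0)) with (- alpha) by ring.
    apply exp_neg_le_pow; trivial; [lra | unfold M; lia]. }
  (* An explicit form of the derivative of the layer: [L] supplies bounds for its derivatives, while
     the equation for the remainder needs their formulas. *)
  set (E1 := fun x => exp (- beta x / eps) * (a eps * (b x / eps * A 0%nat eps x + A 1%nat eps x))).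
  assert (DA0 : forall x, 0 <= x <= 1 -> is_derive (A 0%nat eps) x (A 1%nat eps x))
    by (intros x Hx; apply AD; auto; unfold M; lia).
  assert (DA1 : forall x, 0 <= x <= 1 -> is_derive (A 1%nat eps) x (A 2%nat eps x))
    by (intros x Hx; apply AD; auto; unfold M; lia).
  assert (DF0 : forall x, 0 <= x <= 1 -> is_derive (F 0%nat eps) x (F 1%nat eps x))
    by (intros x Hx; apply FD; auto; unfold M; lia).
  assert (DF1 : forall x, 0 <= x <= 1 -> is_derive (F 1%nat eps) x (F 2%nat eps x))
    by (intros x Hx; apply FD; auto; unfold M; lia).
  assert (Dbe : forall x, 0 <= x <= 1 -> is_derive beta x (- b x)) by auto.
  assert (DL0 : forall x, 0 <= x <= 1 -> is_derive (L 0%nat eps) x (E1 x)).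
  { intros x Hx. rewrite L0. assert (d1 := DA0 x Hx). assert (d2 := Dbe x Hx).
    solve_derive. unfold E1. field. lra. }
  assert (EL1 : forall x, 0 <= x <= 1 -> L 1%nat eps x = E1 x).
  { intros x Hx. assert (d1 := DL0 x Hx).
    assert (d2 : is_derive (L 0%nat eps) x (L 1%nat eps x)) by (apply LD; auto; unfold M; lia).
    apply is_derive_unique in d1, d2. congruence. }
  assert (DE1 : forall x, 0 <= x <= 1 -> is_derive E1 x
     (exp (- beta x / eps) * (a eps * (b x / eps * (b x / eps * A 0%nat eps x + A 1%nat eps x)
        + b1 x / eps * A 0%nat eps x + b x / eps * A 1%nat eps x + A 2%nat eps x)))).
  { intros x Hx. unfold E1. assert (d1 := DA0 x Hx). assert (d2 := Dbe x Hx).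
    assert (d3 := DA1 x Hx). assert (d4 := Hb1 x (Du x Hx)).
    solve_derive. field. lra. }
  set (w := fun x => U x - F 0%nat eps x - L 0%nat eps x + (1 - x) * e0).
  set (w' := fun x => v x - F 1%nat eps x - E1 x - e0).
  set (g := fun x => eps ^ M * gS x + exp (- beta x / eps) * (a eps * (eps ^ M * gA x))
                     + (c x * (1 - x) - b x) * e0).
  assert (W : forall y, 0 <= y <= 1 ->
    Rabs (w y) <= Cp * (G * eps ^ M) / eps ^ 2 /\ Rabs (w' y) <= Cp * (G * eps ^ M) / eps ^ 2).
  { apply (AP eps (G * eps ^ M) w w' g); trivial.
    - now apply Rmult_lt_0_compat.
    - intros x Hx. unfold g.
      assert (c1 := cgS x (Du x Hx)). assert (c2 := cgA x (Du x Hx)).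
      assert (c3 := is_derive_continuous _ _ _ (Dbe x Hx)).
      assert (c4 := coef_cont_b Hco x Hx). assert (c5 := coef_cont_c Hco x Hx).
      solve_continuous.
    - intros x Hx. unfold w, w'. assert (d1 := HU x Hx). assert (d2 := DF0 x Hx).
      assert (d3 := DL0 x Hx). solve_derive. ring.
    - intros x Hx. unfold w'. assert (d1 := Hv x Hx). assert (d2 := DF1 x Hx).
      assert (d3 := DE1 x Hx). solve_derive.
      assert (ES := FE eps x He (Du x Hx)). assert (EA := AE eps x He (Du x Hx)).
      apply (Rmult_eq_reg_l eps); [|lra].
      unfold w, g, w', E1. rewrite L0.
      match goal with |- ?l = ?r =>
        replace r with ((b x * (v x - F 1%nat eps x
          - exp (- beta x / eps) * (a eps * (b x / eps * A 0%nat eps x + A 1%nat eps x)) - e0)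
          + c x * (U x - F 0%nat eps x - exp (- beta x / eps) * (a eps * A 0%nat eps x)
             + (1 - x) * e0))
          - (eps ^ M * gS x + exp (- beta x / eps) * (a eps * (eps ^ M * gA x))
                     + (c x * (1 - x) - b x) * e0)) by (field; lra)
      end.
      replace (eps ^ M * gS x) with (f x - (- eps * F 2%nat eps x + b x * F 1%nat eps x
        + c x * F 0%nat eps x)) by lra.
      replace (eps ^ M * gA x) with (- (- eps * A 2%nat eps x + - b x * A 1%nat eps x
        + (c x - b1 x) * A 0%nat eps x)) by lra.
      field. lra.
    - intros x Hx. unfold g.
      assert (T1 : Rabs (eps ^ M * gS x) <= CgS * eps ^ M).
      { rewrite Rabs_mult, (Rabs_right (eps ^ M)), Rmult_comm by lra.
        apply Rmult_le_compat_r; [lra | now apply BgS]. }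
      assert (T2 : Rabs (exp (- beta x / eps) * (a eps * (eps ^ M * gA x)))
         <= CF * CgA * eps ^ M).
      { rewrite !Rabs_mult, (Rabs_right (exp _)), (Rabs_right (eps ^ M))
          by (try lra; left; apply exp_pos).
        rewrite <- (Rmult_1_l (CF * CgA * eps ^ M)).
        apply Rmult_le_compat; [left; apply exp_pos | | now apply Hexp1 |].
        - repeat apply Rmult_le_pos; try apply Rabs_pos; lra.
        - rewrite Rmult_assoc. apply Rmult_le_compat; [apply Rabs_pos | | now apply Ba |].
          + apply Rmult_le_pos; [lra | apply Rabs_pos].
          + rewrite Rmult_comm. apply Rmult_le_compat_r; [lra | now apply BgA]. }
      assert (T3 : Rabs ((c x * (1 - x) - b x) * e0) <= 2 * B * Ce * eps ^ M).
      { rewrite Rabs_mult, (Rmult_assoc (2 * B)). apply Rmult_le_compat; try apply Rabs_pos; trivial.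
        unfold Rminus at 1. eapply Rle_trans; [apply Rabs_triang|].
        rewrite Rabs_Ropp, Rabs_mult, (Rabs_right (1 - x)) by lra.
        assert (h1 := coef_b Hco x Hx). assert (h2 := coef_c Hco x Hx).
        assert (0 <= Rabs (c x) * x) by (apply Rmult_le_pos; [apply Rabs_pos | lra]). lra. }
      eapply Rle_trans; [apply Rabs_triang|].
      eapply Rle_trans; [apply Rplus_le_compat_r, Rabs_triang|]. unfold G. lra.
    - unfold w. rewrite U0, F0. fold e0. ring.
    - unfold w. rewrite U1, L0, A0, b0, Ea by lra. unfold Rdiv. rewrite Ropp_0, Rmult_0_l, exp_0. ring. }
  (* The two surplus orders, M = k + 2, pay for the factor eps^-2 of the a priori bound. *)
  assert (EQ : Cp * (G * eps ^ M) / eps ^ 2 = Cp * G * eps ^ k).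
  { rewrite EM. field. lra. }
  split.
  - intros l x Hl Hx. replace (l + 1)%nat with (S l) by lia. apply FD; auto. unfold M; lia.
  - intros l x Hl Hx. replace (l + 1)%nat with (S l) by lia. apply LD; auto. unfold M; lia.
  - intros l x Hl Hx. apply Rle_trans with CF; [|lra]. apply FB; trivial. unfold M; lia.
  - intros l x Hl Hx. eapply Rle_trans; [apply LB; trivial; unfold M; lia|].
    assert (P1 : 0 <= (/ eps) ^ l) by (left; apply pow_lt, Rinv_0_lt_compat; lra).
    apply Rmult_le_compat; [| left; apply exp_pos | | now apply Hexp].
    + apply Rmult_le_pos; lra.
    + apply Rmult_le_compat_r; lra.
  - intros x Hx. destruct (W x Hx) as [W1 W2]. rewrite EQ in W1, W2.
    assert (Be : Rabs e0 <= Ce * eps ^ k)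
      by (eapply Rle_trans; [exact Be0 | apply Rmult_le_compat_l; lra]).
    assert (0 <= (CF + CL) * eps ^ k) by (apply Rmult_le_pos; lra). split.
    + replace (U x - F 0%nat eps x - L 0%nat eps x) with (w x - (1 - x) * e0) by (unfold w; ring).
      unfold Rminus. eapply Rle_trans; [apply Rabs_triang|].
      rewrite Rabs_Ropp, Rabs_mult, (Rabs_right (1 + - x)) by lra.
      assert (0 <= x * Rabs e0) by (apply Rmult_le_pos; [lra | apply Rabs_pos]). lra.
    + rewrite EL1 by trivial. replace (v x - F 1%nat eps x - E1 x) with (w' x + e0) by (unfold w'; ring).
      eapply Rle_trans; [apply Rabs_triang|]. lra.
  - apply F0.
  - rewrite L0, A0, b0, Ea by lra. unfold Rdiv. rewrite Ropp_0, Rmult_0_l, exp_0. ring.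
Qed.

(** * Approximation on one cell *)

Definition is_poly (k : nat) (f : R -> R) : Prop :=
  exists a : nat -> R, forall y, f y = Rsum (fun i => a i * y ^ i) 0 k.

Lemma is_poly_plus (k : nat) (f g : R -> R) :
  is_poly k f -> is_poly k g -> is_poly k (fun y => f y + g y).
Proof.
  intros [a Ha] [a' Ha']. exists (fun i => a i + a' i). intros y.
  rewrite Ha, Ha', <- Rsum_plus. apply Rsum_ext; intros; ring.
Qed.

Lemma is_poly_scal (k : nat) (c : R) (f : R -> R) :
  is_poly k f -> is_poly k (fun y => c * f y).
Proof.
  intros [a Ha]. exists (fun i => c * a i). intros y.
  rewrite Ha, <- Rsum_scal. apply Rsum_ext; intros; ring.
Qed.

Lemma is_poly_S (k : nat) (f : R -> R) : is_poly k f -> is_poly (S k) f.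
Proof.
  intros [a Ha]. exists (fun i => if (i <=? k)%nat then a i else 0). intros y.
  rewrite Ha, Rsum_S by lia. destruct (Nat.leb_spec (S k) k); [lia|].
  rewrite Rmult_0_l, Rplus_0_r. apply Rsum_ext. intros j Hj.
  destruct (Nat.leb_spec j k); [reflexivity | lia].
Qed.

Lemma is_poly_const (k : nat) (c : R) : is_poly k (fun _ => c).
Proof.
  induction k as [|k IH]; [|now apply is_poly_S].
  exists (fun _ => c). intros y. rewrite Rsum_0_0. simpl; ring.
Qed.

Lemma is_poly_affine (k : nat) (c : R) : (1 <= k)%nat -> is_poly k (fun y => y + c).
Proof.
  induction 1 as [|k Hk IH]; [|now apply is_poly_S].
  exists (fun i => match i with O => c | _ => 1 end). intros y.
  rewrite Rsum_S, Rsum_0_0 by lia. simpl; ring.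
Qed.

Lemma is_derive_monomial (a x : R) (k : nat) :
  is_derive (fun y => a * y ^ S k) x (a * (INR (S k) * x ^ k)).
Proof. auto_derive; trivial. destruct k; simpl; ring. Qed.

Lemma is_poly_C1 (k : nat) (f : R -> R) :
  is_poly k f -> exists f', (forall x, is_derive f x (f' x)) /\ forall x, continuous f' x.
Proof.
  intros [a Ha].
  assert (H : exists f', (forall x, is_derive (fun y => Rsum (fun i => a i * y ^ i) 0 k) x (f' x))
     /\ forall x, continuous f' x).
  { clear Ha. induction k as [|k [f' [H1 H2]]].
    - exists (fun _ => 0). split; [|intros; apply continuous_const].
      intros x. apply is_derive_ext with (fun _ => a 0%nat * x ^ 0);
        [intros; now rewrite Rsum_0_0 | apply is_derive_const0].
    - exists (fun x => f' x + a (S k) * (INR (S k) * x ^ k)). split.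
      + intros x. apply is_derive_ext with (fun y => Rsum (fun i => a i * y ^ i) 0 k
          + a (S k) * y ^ (S k)); [intros; rewrite Rsum_S; trivial; lia|].
        apply is_derive_Rplus; trivial. apply is_derive_monomial.
      + intros x. apply continuous_Rplus; trivial.
        apply @ex_derive_continuous. auto_derive. trivial. }
  destruct H as [f' [H1 H2]]. exists f'. split; trivial.
  intros x. eapply is_derive_ext; [|apply H1]. intros y; now rewrite Ha.
Qed.

Lemma is_poly_derive_continuous (k : nat) (f f' : R -> R) :
  is_poly k f -> (forall x, is_derive f x (f' x)) -> forall x, continuous f' x.
Proof.
  intros Hf Hd x. destruct (is_poly_C1 k f Hf) as [g [H1 H2]].
  apply continuous_ext with g; trivial. intros t.
  assert (D1 := Hd t). assert (D2 := H1 t). apply is_derive_unique in D1, D2. congruence.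
Qed.

Lemma is_poly_primitive (n : nat) (g : R -> R) (p c : R) :
  is_poly n g -> exists T, is_poly (S n) T /\ T p = c /\ forall x, is_derive T x (g x).
Proof.
  intros [a Ha].
  set (A := fun i => match i with O => 0 | S i => a i / INR (S i) end).
  set (T := fun y => Rsum (fun i => A i * y ^ i) 0 (S n)).
  assert (HT : forall x, is_derive T x (Rsum (fun i => a i * x ^ i) 0 n)).
  { intros x. unfold T. clear Ha. induction n as [|n IH].
    - rewrite Rsum_0_0. apply is_derive_ext with (fun y => a 0%nat * y).
      + intros y. rewrite Rsum_S, Rsum_0_0 by lia. simpl. field.
      + solve_derive. ring.
    - rewrite Rsum_S by lia.
      apply is_derive_ext with (fun y => Rsum (fun i => A i * y ^ i) 0 (S n)
        + A (S (S n)) * y ^ (S (S n))); [intros; rewrite (Rsum_S _ 0 (S n)); trivial; lia|].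
      apply is_derive_Rplus; trivial.
      assert (HS := pos_INR (S n)). assert (E := S_INR (S n)).
      eapply is_derive_eq; [apply is_derive_monomial|]. unfold A. field. lra. }
  exists (fun y => T y + (c - T p)). split; [|split].
  - apply is_poly_plus; [now exists A | apply is_poly_const].
  - ring.
  - intros x. rewrite Ha. eapply is_derive_eq; [apply is_derive_Rplus; [apply HT | apply is_derive_const0]|].
    ring.
Qed.

Lemma Rabs_sub_le_of_derive (f f' g g' : R -> R) (p q x M : R) :
  (forall t, p <= t <= q -> is_derive f t (f' t)) ->
  (forall t, p <= t <= q -> is_derive g t (g' t)) ->
  (forall t, p <= t <= q -> Rabs (f' t - g' t) <= M) ->
  f p = g p -> p <= x <= q -> Rabs (f x - g x) <= M * (q - p).
Proof.
  intros Hf Hg HM E Hx.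
  replace (f x - g x) with ((f x - g x) - (f p - g p)) by (rewrite E; ring).
  apply Rle_trans with (M * (x - p)).
  - apply (Rabs_diff_le_of_derive (fun t => f t - g t) (fun t => f' t - g' t)); try lra.
    + intros t Ht; apply is_derive_Rminus; [apply Hf | apply Hg]; lra.
    + intros t Ht; apply HM; lra.
  - apply Rmult_le_compat_l; [|lra].
    apply Rle_trans with (Rabs (f' p - g' p)); [apply Rabs_pos | apply HM; lra].
Qed.

(** Induction by integrating the Taylor polynomial of the derivative from [p]; each integration
    multiplies the error by at most q - p. Factorials are given up, being constants for a fixed
    degree. *)
Lemma taylor_poly (n : nat) (p q M : R) (F : nat -> R -> R) :
  p <= q ->
  (forall l x, (l <= n)%nat -> p <= x <= q -> is_derive (F l) x (F (l + 1)%nat x)) ->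
  (forall x, p <= x <= q -> Rabs (F (n + 1)%nat x) <= M) ->
  exists T, is_poly n T /\ T p = F 0%nat p /\
    forall x, p <= x <= q -> Rabs (F 0%nat x - T x) <= M * (q - p) ^ (n + 1).
Proof.
  intros Hpq. revert F; induction n as [|n IH]; intros F HF HM.
  - exists (fun _ => F 0%nat p). split; [apply is_poly_const | split; trivial].
    intros x Hx. rewrite pow_1.
    apply (Rabs_sub_le_of_derive (F 0%nat) (F 1%nat) (fun _ => F 0%nat p) (fun _ => 0) p q); trivial.
    + intros t Ht; now apply (HF 0%nat).
    + intros; apply is_derive_const0.
    + intros t Ht. rewrite Rminus_0_r. now apply HM.
  - destruct (IH (fun l => F (S l))) as [T' [P' [E' B']]].
    + intros l x Hl Hx. apply (HF (S l)); trivial; lia.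
    + intros x Hx. now apply HM.
    + destruct (is_poly_primitive n T' p (F 0%nat p) P') as [T [PT [ET DT]]].
      exists T. split; [trivial | split; trivial]. intros x Hx.
      replace (S n + 1)%nat with (S (n + 1)) by lia. rewrite <- tech_pow_Rmult.
      replace (M * ((q - p) * (q - p) ^ (n + 1))) with (M * (q - p) ^ (n + 1) * (q - p)) by ring.
      apply (Rabs_sub_le_of_derive (F 0%nat) (F 1%nat) T T' p q); trivial; [|now intros].
      intros t Ht. apply (HF 0%nat); trivial; lia.
    Qed.

(* The Taylor polynomial at the left endpoint, corrected by a linear term
   so as to match the value at the right endpoint. *)
Lemma interpolation_exists (k : nat) (p q M : R) (F : nat -> R -> R) :
  (1 <= k)%nat -> p < q ->
  (forall l x, (l <= k)%nat -> p <= x <= q -> is_derive (F l) x (F (l + 1)%nat x)) ->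
  (forall x, p <= x <= q -> Rabs (F (k + 1)%nat x) <= M) ->
  exists I I', is_poly k I /\ (forall x, is_derive I x (I' x)) /\
    I p = F 0%nat p /\ I q = F 0%nat q /\
    forall x, p <= x <= q -> Rabs (F 0%nat x - I x) <= 2 * M * (q - p) ^ (k + 1) /\
      Rabs (F 1%nat x - I' x) <= 2 * M * (q - p) ^ k.
Proof.
  intros Hk Hpq HF HM. destruct k as [|n]; [lia|].
  destruct (taylor_poly n p q M (fun l => F (S l))) as [T' [P' [E' B']]]; [lra | | |].
  - intros l x Hl Hx. apply (HF (S l)); trivial; lia.
  - intros x Hx. now apply HM.
  - destruct (is_poly_primitive n T' p (F 0%nat p) P') as [T [PT [ET DT]]].
    assert (B : forall x, p <= x <= q -> Rabs (F 0%nat x - T x) <= M * (q - p) ^ (n + 1) * (q - p)).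
    { intros x Hx. apply (Rabs_sub_le_of_derive (F 0%nat) (F 1%nat) T T' p q); trivial; [|now intros].
      intros t Ht. apply (HF 0%nat); trivial; lia. }
    (* The defect at the right endpoint. Spread linearly, it adds to the value and to the slope at
       most the bound of their Taylor errors, hence the factor 2. *)
    set (e := F 0%nat q - T q). assert (Be : Rabs e <= M * (q - p) ^ (n + 1) * (q - p)) by (apply B; lra).
    assert (Hh : 0 < / (q - p)) by (apply Rinv_0_lt_compat; lra).
    exists (fun x => T x + e * / (q - p) * (x + - p)), (fun x => T' x + e * / (q - p)).
    assert (Bl : Rabs (e * / (q - p)) <= M * (q - p) ^ (n + 1)).
    { rewrite Rabs_mult, (Rabs_right (/ (q - p))) by lra.
      apply Rmult_le_reg_r with (q - p); [lra|].
      rewrite Rmult_assoc, Rinv_l, Rmult_1_r by lra. exact Be. }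
    split; [|split; [|split; [|split]]].
    + apply is_poly_plus; trivial. apply is_poly_scal.
      apply is_poly_affine; lia.
    + intros x. assert (Dx := DT x). solve_derive. ring.
    + rewrite ET. ring.
    + unfold e. field. lra.
    + intros x Hx.
      replace (S n + 1)%nat with (S (n + 1)) by lia. replace (S n) with (n + 1)%nat by lia.
      rewrite <- tech_pow_Rmult. split.
      * replace (F 0%nat x - (T x + e * / (q - p) * (x + - p)))
          with ((F 0%nat x - T x) + - (e * / (q - p) * (x - p))) by ring.
        eapply Rle_trans; [apply Rabs_triang|]. rewrite Rabs_Ropp, Rabs_mult, (Rabs_right (x - p)) by lra.
        assert (B1 := B x Hx).
        assert (B2 : Rabs (e * / (q - p)) * (x - p) <= M * (q - p) ^ (n + 1) * (q - p)).
        { apply Rmult_le_compat; trivial; try apply Rabs_pos; lra. }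
        lra.
      * replace (F 1%nat x - (T' x + e * / (q - p))) with ((F 1%nat x - T' x) + - (e * / (q - p))) by ring.
        eapply Rle_trans; [apply Rabs_triang|]. rewrite Rabs_Ropp.
        assert (B1 := B' x Hx). simpl in B1. lra.
Qed.

(** * From cell approximations to the error of the method *)

Lemma finite_choice (A : Type) (a0 : A) (P : nat -> A -> Prop) (N : nat) :
  (forall j, (1 <= j <= N)%nat -> exists a, P j a) ->
  exists F : nat -> A, forall j, (1 <= j <= N)%nat -> P j (F j).
Proof.
  induction N as [|N IH]; intros H.
  - exists (fun _ => a0). intros; lia.
  - destruct IH as [F HF]; [intros; apply H; lia|].
    destruct (H (S N)) as [a Ha]; [lia|].
    exists (fun j => if j =? S N then a else F j). intros j Hj.
    destruct (Nat.eqb_spec j (S N)) as [->|Hn]; trivial. apply HF; lia.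
Qed.

(** A test function of the discrete space is a single function on R, so the polynomials of the cells
    have to be assembled; the search for the cell goes down from the last one. *)
Fixpoint glue (x : nat -> R) (W : nat -> R -> R) (N : nat) (y : R) : R :=
  match N with
  | O => 0
  | S n => if Rlt_dec (x n) y then W (S n) y else glue x W n y
  end.

Lemma glue_represents (x : nat -> R) (N : nat) (W : nat -> R -> R) :
  is_mesh x N -> represents x N (glue x W N) W.
Proof.
  intros Hx j Hj y Hy.
  assert (H : forall n, (j <= n <= N)%nat -> glue x W n y = W j y).
  { induction n as [|n IH]; intros Hn; [lia|]. simpl.
    destruct (Nat.eq_dec j (S n)) as [->|Hne].
    - replace (S n - 1)%nat with n in Hy by lia. destruct Rlt_dec; [reflexivity | lra].
    - assert (x j <= x n) by (apply mesh_mono with N; trivial; lia).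
      destruct Rlt_dec; [lra | apply IH; lia]. }
  apply H; lia.
Qed.

(* Approximation of [U] on the cell [[p,q]] by [P] in [P_k]; [Z] is the part of the
   error that is controlled only in the weighted norms. *)
Record cell_approximation (k N : nat) (eps K mul mur p q pl pr zl zr : R) (U v : R -> R)
    (P P' Z Z' : R -> R) : Prop := {
  cap_poly : is_poly k P;
  cap_P' : forall y, is_derive P y (P' y);
  cap_Z' : forall y, p <= y <= q -> is_derive Z y (Z' y) /\ continuous Z' y;
  cap_Pl : P p = pl;
  cap_Pr : P q = pr;
  cap_Zl : Z p = zl;
  cap_Zr : Z q = zr;
  cap_diff : forall y, p <= y <= q ->
    Rabs (U y - P y - Z y) <= K /\ Rabs (v y - P' y - Z' y) <= K;
  cap_intZ : RInt (fun y => Z y ^ 2) p q <= eps * (K ^ 2 / INR N);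
  cap_intZ' : eps * RInt (fun y => Z' y ^ 2) p q <= K ^ 2 / INR N;
  cap_nodel : (eps * (v p - P' p)) ^ 2 <= mul * (K ^ 2 / INR N);
  cap_noder : (eps * (v q - P' q)) ^ 2 <= mur * (K ^ 2 / INR N)
}.

Arguments cap_poly {_ _ _ _ _ _ _ _ _ _ _ _ _ _ _ _ _ _}.
Arguments cap_P' {_ _ _ _ _ _ _ _ _ _ _ _ _ _ _ _ _ _}.
Arguments cap_Z' {_ _ _ _ _ _ _ _ _ _ _ _ _ _ _ _ _ _}.
Arguments cap_Pl {_ _ _ _ _ _ _ _ _ _ _ _ _ _ _ _ _ _}.
Arguments cap_Pr {_ _ _ _ _ _ _ _ _ _ _ _ _ _ _ _ _ _}.
Arguments cap_Zl {_ _ _ _ _ _ _ _ _ _ _ _ _ _ _ _ _ _}.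
Arguments cap_Zr {_ _ _ _ _ _ _ _ _ _ _ _ _ _ _ _ _ _}.
Arguments cap_diff {_ _ _ _ _ _ _ _ _ _ _ _ _ _ _ _ _ _}.
Arguments cap_intZ {_ _ _ _ _ _ _ _ _ _ _ _ _ _ _ _ _ _}.
Arguments cap_intZ' {_ _ _ _ _ _ _ _ _ _ _ _ _ _ _ _ _ _}.
Arguments cap_nodel {_ _ _ _ _ _ _ _ _ _ _ _ _ _ _ _ _ _}.
Arguments cap_noder {_ _ _ _ _ _ _ _ _ _ _ _ _ _ _ _ _ _}.

(** Compatibility of the cells is encoded in common nodal values: [pn] makes the approximation
    continuous and zero at the ends, so that its error has no jumps, and [zn] makes the layer part
    single-valued at the nodes. *)
Lemma nipg_error_of_cell_approximation (gamma B : R) (b b1 c f b0 c0 f0 : R -> R) :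
  coefficients b b1 c gamma B -> cont_on 0 1 f ->
  (forall y, unit_interval y -> b0 y = b y) -> (forall y, unit_interval y -> c0 y = c y) ->
  (forall y, unit_interval y -> f0 y = f y) ->
  exists C, 0 < C /\
  forall (k N : nat) (eps K : R) (mu x pn zn : nat -> R) (u uN U v : R -> R),
    is_mesh x N -> 0 < eps <= 1 -> 0 <= K -> (forall j, (j <= N)%nat -> 0 < mu j) ->
    (forall y, unit_interval y -> U y = u y) ->
    (forall y, 0 <= y <= 1 -> is_derive U y (v y)) ->
    (forall y, 0 <= y <= 1 -> is_derive v y ((b y * v y + c y * U y - f y) / eps)) ->
    U 0 = 0 -> U 1 = 0 -> pn 0%nat = 0 -> pn N = 0 ->
    (forall j, (j <= N)%nat -> zn j ^ 2 <= mu j * (K ^ 2 / INR N)) ->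
    (forall j, (1 <= j <= N)%nat -> exists P P' Z Z',
       cell_approximation k N eps K (mu (j - 1)%nat) (mu j) (x (j - 1)%nat) (x j)
         (pn (j - 1)%nat) (pn j) (zn (j - 1)%nat) (zn j) U v P P' Z Z') ->
    nipg_solution eps b0 c0 f0 mu x N k uN ->
    nipg_norm eps gamma b0 mu x N (fun y => u y - uN y) <= C * K.
Proof.
  intros Hco Hf Eb Ec Ef.
  destruct (split_error_estimate gamma B b b1 c Hco) as [C [HC HE]].
  exists (sqrt C). split; [now apply sqrt_lt_R0|].
  intros k N eps K mu x pn zn u uN U v Hx He HK Hmu HuU HU Hv U0 U1 pn0 pnN Hzn Hcells [HuN Hsol].
  assert (Hb := coef_cont_b Hco). assert (Hc := coef_cont_c Hco).
  assert (HN := mesh_pos x N Hx).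
  destruct (finite_choice ((R -> R) * (R -> R) * (R -> R) * (R -> R))
    (fun _ => 0, fun _ => 0, fun _ => 0, fun _ => 0)
    (fun j a => cell_approximation k N eps K (mu (j - 1)%nat) (mu j) (x (j - 1)%nat) (x j)
         (pn (j - 1)%nat) (pn j) (zn (j - 1)%nat) (zn j) U v
         (fst (fst (fst a))) (snd (fst (fst a))) (snd (fst a)) (snd a)) N) as [A HA].
  { intros j Hj. destruct (Hcells j Hj) as [P [P' [Z [Z' H]]]]. now exists (P, P', Z, Z'). }
  set (P := fun j => fst (fst (fst (A j)))) in *. set (P' := fun j => snd (fst (fst (A j)))) in *.
  set (Z := fun j => snd (fst (A j))) in *. set (Z' := fun j => snd (A j)) in *.
  assert (Hcap : forall j, (1 <= j <= N)%nat -> cell_approximation k N eps K (mu (j - 1)%nat) (mu j)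
     (x (j - 1)%nat) (x j) (pn (j - 1)%nat) (pn j) (zn (j - 1)%nat) (zn j) U v
     (P j) (P' j) (Z j) (Z' j)) by exact HA. clear HA.
  destruct (finite_choice ((R -> R) * (R -> R)) (fun _ => 0, fun _ => 0)
    (fun j a => is_poly k (fst a) /\ (forall y, is_derive (fst a) y (snd a y)) /\
       (forall y, continuous (snd a) y) /\
       forall y, x (j - 1)%nat < y < x j -> uN y = fst a y) N) as [A' HA].
  { intros j Hj. destruct (HuN j Hj) as [a Ha].
    assert (Hp : is_poly k (fun y => Rsum (fun i => a i * y ^ i) 0 k)) by (now exists a).
    destruct (is_poly_C1 k _ Hp) as [p' [H1 H2]].
    now exists (fun y => Rsum (fun i => a i * y ^ i) 0 k, p'). }
  set (Q := fun j => fst (A' j)) in *. set (Q' := fun j => snd (A' j)) in *.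
  assert (HQ : forall j, (1 <= j <= N)%nat -> is_poly k (Q j) /\
     (forall y, is_derive (Q j) y (Q' j y)) /\ (forall y, continuous (Q' j) y) /\
     forall y, x (j - 1)%nat < y < x j -> uN y = Q j y) by exact HA. clear HA.
  assert (CQ : cellwise_C1 x N Q Q') by (intros j Hj y Hy; now destruct (HQ j Hj) as [_ [H1 [H2 _]]]).
  assert (CP : cellwise_C1 x N P P').
  { intros j Hj y Hy. assert (H1 := cap_P' (Hcap j Hj)).
    split; trivial.
    apply is_poly_derive_continuous with k (P j); trivial.
    apply (cap_poly (Hcap j Hj)). }
  assert (CZ : cellwise_C1 x N Z Z')
    by (intros j Hj; apply (cap_Z' (Hcap j Hj))).
  assert (cv : cont_on 0 1 v) by (intros y Hy; eapply is_derive_continuous; now apply Hv).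
  assert (CU : cellwise_C1 x N (fun _ => U) (fun _ => v)).
  { intros j Hj y Hy. assert (0 <= y <= 1) by (now apply cell_unit with x N j). split; auto. }
  set (X := fun j y => Q j y - P j y). set (X' := fun j y => Q' j y - P' j y).
  set (H := fun j y => U y - P j y). set (H' := fun (j : nat) y => v y - P' j y).
  assert (CX : cellwise_C1 x N X X') by now apply cellwise_C1_minus.
  assert (CH : cellwise_C1 x N H H') by now apply (cellwise_C1_minus x N (fun _ => U) (fun _ => v)).
  assert (RQ : represents x N uN Q)
    by (intros j Hj y Hy; now destruct (HQ j Hj) as [_ [_ [_ H1]]]; apply H1).
  assert (Rg := glue_represents x N P Hx).
  (* The discrete error is the test function; it lies in the discrete space because the
     approximation does. *)
  set (xi := fun y => uN y - glue x P N y).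
  assert (RX : represents x N xi X).
  { intros j Hj y Hy. unfold xi, X. now rewrite (RQ j), (Rg j). }
  assert (Vxi : in_V x N k xi).
  { intros j Hj. destruct (HQ j Hj) as [HQ1 _].
    assert (HP1 := cap_poly (Hcap j Hj)).
    destruct (is_poly_plus k _ _ HQ1 (is_poly_scal k (-1) _ HP1)) as [a Ha].
    exists a. intros y Hy. rewrite (RX j Hj y Hy). unfold X.
    transitivity (Q j y + -1 * P j y); [ring | apply Ha]. }
  (* Galerkin orthogonality: the form of the approximation is subtracted on both sides, and then the
     discrete equation for [uN] and consistency for [U] give the same right-hand side. *)
  assert (Gal : cell_form eps b c mu x N X X' X X' = cell_form eps b c mu x N H H' X X').
  { unfold X at 1, X' at 1. rewrite cell_form_minus_l by trivial.
    unfold H, H'. rewrite (cell_form_minus_l eps b c mu x N (fun _ => U) (fun _ => v)) by trivial.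
    f_equal. rewrite (cell_form_solution eps b c f U v) by (trivial; lra).
    rewrite <- (nipg_form_cell_form eps b c b0 c0 mu x N uN xi Q Q' X X') by trivial.
    rewrite (Hsol xi Vxi), broken_int_Rsum. apply Rsum_ext. intros j Hj.
    assert (Hlt := mesh_lt x N Hx j Hj). apply RInt_eq_open; [lra|].
    intros y Hy. rewrite (RX j Hj y Hy), Ef; trivial.
    apply cell_unit with x N j; trivial; lra. }
  assert (NE : represents x N (fun y => u y - uN y) (fun j y => H j y - X j y)).
  { intros j Hj y Hy. rewrite (RQ j Hj y Hy), <- HuU.
    - unfold H, X. ring.
    - apply cell_unit with x N j; trivial; lra. }
  rewrite (nipg_norm_cell_norm2 eps gamma b b0 mu x N _ (fun j y => H j y - X j y)
    (fun j y => H' j y - X' j y)); trivial; [|now apply cellwise_C1_minus].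
  rewrite <- (sqrt_pow2 K HK), <- sqrt_mult by (lra || apply pow2_ge_0).
  apply sqrt_le_1_alt. apply (HE eps K mu x N H H' Z Z' X X' zn); trivial.
  split; trivial.
  - intros j Hj. unfold cjump, lval, rval, H.
    destruct (Nat.eqb_spec j 0) as [Ej|Ej], (Nat.eqb_spec j N) as [Ej'|Ej'].
    + ring.
    + assert (E := cap_Pl (Hcap (S j) ltac:(lia))).
      replace (S j - 1)%nat with j in E by lia.
      rewrite E, Ej, (mesh_0 x N Hx), U0, pn0. ring.
    + assert (E := cap_Pr (Hcap j ltac:(lia))).
      rewrite E, Ej', (mesh_N x N Hx), U1, pnN. ring.
    + assert (E := cap_Pl (Hcap (S j) ltac:(lia))).
      replace (S j - 1)%nat with j in E by lia.
      assert (E' := cap_Pr (Hcap j ltac:(lia))).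
      rewrite E, E'. ring.
  - intros j Hj y Hy. now apply (cap_diff (Hcap j Hj)).
  - intros j Hj. apply (cap_intZ (Hcap j Hj)).
  - intros j Hj. apply (cap_intZ' (Hcap j Hj)).
  - intros j Hj. apply (cap_Zr (Hcap j Hj)).
  - intros j Hj. apply (cap_Zl (Hcap j Hj)).
  - intros j Hj. apply (cap_noder (Hcap j Hj)).
  - intros j Hj. apply (cap_nodel (Hcap j Hj)).
Qed.

(** * The Bakhvalov-type mesh *)

(* [D j = 1 + 2 (1 - eps) (j / N - 1)] is the argument of the logarithm in the mesh-generating
   function, so that [exp (- alpha (1 - x j) / eps) = D j ^ sigma]. *)
Record graded_mesh (k : nat) (alpha C eps : R) (x D : nat -> R) (N n : nat) : Prop := {
  gm_mesh : is_mesh x N;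
  gm_N : (n + 2 <= N)%nat;
  gm_eps : eps <= C / INR N;
  gm_width : forall j, (1 <= j <= N)%nat -> x j - x (j - 1)%nat <= C / INR N;
  gm_D_range : forall j, (n + 1 <= j <= N)%nat -> / INR N <= D j <= 1;
  gm_D_n : D n = eps;
  gm_D_n1 : D (n + 1)%nat <= C / INR N;
  gm_D_n2 : D (n + 2)%nat <= C / INR N;
  gm_D_double : forall j, (n + 2 <= j <= N)%nat -> D j <= 2 * D (j - 1)%nat;
  gm_decay : forall j, (n <= j <= N)%nat -> exp (- alpha * (1 - x j) / eps) <= D j ^ (k + 1);
  gm_layer_width : forall j, (n + 2 <= j <= N)%nat ->
    (x j - x (j - 1)%nat) * D (j - 1)%nat <= C * (eps / INR N);
  gm_width_lower : eps <= C * (x (n + 2)%nat - x (n + 1)%nat)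
}.

Arguments gm_mesh {_ _ _ _ _ _ _ _}.
Arguments gm_N {_ _ _ _ _ _ _ _}.
Arguments gm_eps {_ _ _ _ _ _ _ _}.
Arguments gm_width {_ _ _ _ _ _ _ _}.
Arguments gm_D_range {_ _ _ _ _ _ _ _}.
Arguments gm_D_n {_ _ _ _ _ _ _ _}.
Arguments gm_D_n1 {_ _ _ _ _ _ _ _}.
Arguments gm_D_n2 {_ _ _ _ _ _ _ _}.
Arguments gm_D_double {_ _ _ _ _ _ _ _}.
Arguments gm_decay {_ _ _ _ _ _ _ _}.
Arguments gm_layer_width {_ _ _ _ _ _ _ _}.
Arguments gm_width_lower {_ _ _ _ _ _ _ _}.

(** At [j = n] the definition takes the logarithmic branch, whose value there is also [tau]; the
    affine formula thus covers the transition point. *)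
Lemma mesh_coarse (sigma alpha eps : R) (N n j : nat) :
  N = (2 * n)%nat -> (0 < N)%nat -> (j <= n)%nat ->
  mesh sigma alpha eps N j = 2 * tau sigma alpha eps * (INR j / INR N).
Proof.
  intros HN HN0 Hj. unfold mesh, psi.
  assert (HNR : 0 < INR N) by (apply lt_0_INR; lia).
  assert (HNn : INR N = 2 * INR n) by (rewrite HN, mult_INR; reflexivity).
  destruct Rlt_dec as [H|H]; [reflexivity|].
  assert (Hle : INR j <= INR n) by (apply le_INR; lia).
  assert (E : INR j = INR n).
  { apply Rle_antisym; trivial. apply Rnot_lt_le; intros Hlt. apply H.
    apply Rmult_lt_reg_r with (INR N); trivial. unfold Rdiv. rewrite Rmult_assoc, Rinv_l by lra. lra. }
  rewrite E. replace (INR n / INR N) with (/ 2) by (rewrite HNn; field; lra).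
  unfold tau. replace (1 + 2 * (1 - eps) * (/ 2 - 1)) with eps by field. lra.
Qed.

Lemma mesh_layer (sigma alpha eps : R) (N n j : nat) :
  N = (2 * n)%nat -> (0 < N)%nat -> (n <= j)%nat ->
  mesh sigma alpha eps N j
  = 1 + sigma * eps / alpha * ln (1 + 2 * (1 - eps) * (INR j / INR N - 1)).
Proof.
  intros HN HN0 Hj. unfold mesh, psi.
  assert (HNR : 0 < INR N) by (apply lt_0_INR; lia).
  assert (HNn : INR N = 2 * INR n) by (rewrite HN, mult_INR; reflexivity).
  destruct Rlt_dec as [H|H]; [exfalso | reflexivity].
  assert (Hle : INR n <= INR j) by (apply le_INR; lia).
  apply Rmult_lt_compat_r with (r := INR N) in H; trivial.
  unfold Rdiv in H. rewrite Rmult_assoc, Rinv_l in H by lra. lra.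
Qed.

Lemma ln_ratio_le (a b : R) : 0 < a -> a <= b -> ln b - ln a <= (b - a) / a.
Proof.
  intros Ha Hb. assert (Hr : 0 < b / a) by (apply Rdiv_lt_0_compat; lra).
  assert (E : ln b = ln a + ln (b / a)).
  { rewrite <- ln_mult; trivial. f_equal. field. lra. }
  assert (L : ln (b / a) <= b / a - 1).
  { rewrite <- (ln_exp (b / a - 1)). apply ln_le; trivial.
    assert (H := exp_ineq1_le (b / a - 1)). lra. }
  replace ((b - a) / a) with (b / a - 1) by (field; lra). lra.
Qed.

(** Kept apart from the graded bounds and stated for every [eps] below 1, because the values above
    1/2 also need a mesh. *)
Lemma bakhvalov_mesh (sigma alpha eps : R) (N : nat) :
  0 < sigma -> 0 < alpha -> 0 < eps < 1 -> (4 <= N)%nat -> Nat.Even N ->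
  1 / 2 <= tau sigma alpha eps ->
  is_mesh (mesh sigma alpha eps N) N.
Proof.
  intros Hs Ha He HN [n Hn] Ht.
  assert (HNR : 0 < INR N) by (apply lt_0_INR; lia).
  assert (HNn : INR N = 2 * INR n) by (rewrite Hn, mult_INR; reflexivity).
  split.
  - lia.
  - rewrite (mesh_coarse sigma alpha eps N n 0) by lia. simpl. unfold Rdiv. ring.
  - rewrite (mesh_layer sigma alpha eps N n N) by lia.
    replace (1 + 2 * (1 - eps) * (INR N / INR N - 1)) with 1 by (field; lra).
    rewrite ln_1. ring.
  - intros j Hj. assert (Ej : INR j = INR (j - 1) + 1).
    { rewrite <- S_INR. f_equal. lia. }
    destruct (Nat.le_gt_cases j n) as [Hjn|Hjn].
    + rewrite (mesh_coarse sigma alpha eps N n j), (mesh_coarse sigma alpha eps N n (j - 1)) by lia.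
      apply Rmult_lt_compat_l; [lra|]. apply Rmult_lt_compat_r; [now apply Rinv_0_lt_compat | lra].
    + rewrite (mesh_layer sigma alpha eps N n j), (mesh_layer sigma alpha eps N n (j - 1)) by lia.
      assert (Hnj : INR n <= INR (j - 1)) by (apply le_INR; lia).
      assert (H1 : INR (j - 1) / INR N < INR j / INR N)
        by (apply Rmult_lt_compat_r; [now apply Rinv_0_lt_compat | lra]).
      assert (H2 : 1 / 2 <= INR (j - 1) / INR N).
      { apply Rmult_le_reg_r with (INR N); trivial. unfold Rdiv at 2.
        rewrite Rmult_assoc, Rinv_l by lra. lra. }
      apply Rplus_lt_compat_l, Rmult_lt_compat_l.
      { apply Rdiv_lt_0_compat; trivial. apply Rmult_lt_0_compat; lra. }
      apply ln_increasing.
      * assert (0 <= (1 - eps) * (INR (j - 1) / INR N - 1 / 2)) by (apply Rmult_le_pos; lra). lra.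
      * assert (0 < (1 - eps) * (INR j / INR N - INR (j - 1) / INR N))
          by (apply Rmult_lt_0_compat; lra). lra.
Qed.

(** [D] is an arithmetic progression from [eps] at [n] to 1 at [N], with step between 1 / N and 2 /
    N once eps <= 1/2. Widths in the layer follow from ln D_j - ln D_(j-1) <= step / D_(j-1).
    Doubling may fail on the first layer cell, where [D] starts from [eps], but holds afterwards.
    The lower bound on the second cell rests on D_(n+1) = eps + step <= (1 + |C0|) step. *)
Lemma bakhvalov_graded_mesh (k : nat) (sigma alpha C0 : R) :
  INR k + 1 <= sigma -> 0 < alpha ->
  exists C, 1 <= C /\ forall (eps : R) (N n : nat),
    0 < eps <= 1 / 2 -> N = (2 * n)%nat -> (4 <= N)%nat -> 1 / 2 <= tau sigma alpha eps ->
    eps <= C0 / INR N ->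
    graded_mesh k alpha C eps (mesh sigma alpha eps N)
      (fun j => 1 + 2 * (1 - eps) * (INR j / INR N - 1)) N n.
Proof.
  intros Hs Ha. assert (Hk := pos_INR k).
  assert (Hsa : 0 < sigma / alpha) by (apply Rdiv_lt_0_compat; lra).
  (* A lower bound for the logarithm of D (n + 2) / D (n + 1). *)
  set (L := ln (1 + / (1 + Rabs C0))).
  assert (HC0 := Rabs_pos C0).
  assert (Hi0 : 0 < / (1 + Rabs C0)) by (apply Rinv_0_lt_compat; lra).
  assert (HL : 0 < L) by (unfold L; rewrite <- ln_1; apply ln_increasing; lra).
  assert (HC1 : 0 < / (sigma / alpha * L)) by (apply Rinv_0_lt_compat, Rmult_lt_0_compat; trivial).
  (* |C0| + 4 serves [gm_eps], the coarse widths and the values of [D] after the transition point, 2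
     sigma / alpha the layer widths, and the last summand [gm_width_lower]. *)
  set (C := Rabs C0 + 4 + 2 * (sigma / alpha) + / (sigma / alpha * L)).
  exists C. split; [unfold C; lra|].
  intros eps N n He Hn HN Ht Hep.
  assert (HNR : 0 < INR N) by (apply lt_0_INR; lia).
  assert (HNn : INR N = 2 * INR n) by (rewrite Hn, mult_INR; reflexivity).
  assert (Hin : 0 < / INR N) by now apply Rinv_0_lt_compat.
  set (D := fun j => 1 + 2 * (1 - eps) * (INR j / INR N - 1)).
  set (x := mesh sigma alpha eps N).
  set (del := 2 * (1 - eps) * / INR N).
  assert (Hdel : / INR N <= del <= 2 * / INR N).
  { unfold del. assert (0 <= (1 - 2 * eps) * / INR N) by (apply Rmult_le_pos; lra).
    assert (0 <= eps * / INR N) by (apply Rmult_le_pos; lra). lra. }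
  assert (Dn : D n = eps).
  { unfold D. replace (INR n / INR N) with (/ 2) by (rewrite HNn; field; lra). field. }
  assert (DS : forall j, (1 <= j)%nat -> D j = D (j - 1)%nat + del).
  { intros j Hj. unfold D, del. replace (INR j) with (INR (j - 1) + 1)
      by (rewrite <- S_INR; f_equal; lia). field. lra. }
  assert (Dge : forall j, (n <= j)%nat -> eps <= D j).
  { intros j Hj. induction Hj as [|j Hj IH]; [lra|].
    rewrite (DS (S j)) by lia. replace (S j - 1)%nat with j by lia. lra. }
  assert (Dge1 : forall j, (n + 1 <= j)%nat -> / INR N <= D j).
  { intros j Hj. rewrite DS by lia. assert (H := Dge (j - 1)%nat ltac:(lia)). lra. }
  assert (Dle1 : forall j, (j <= N)%nat -> D j <= 1).
  { intros j Hj. unfold D. assert (H : INR j <= INR N) by now apply le_INR.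
    assert (H1 : INR j / INR N <= 1).
    { apply Rmult_le_reg_r with (INR N); trivial. unfold Rdiv. rewrite Rmult_assoc, Rinv_l by lra. lra. }
    assert (0 <= (1 - eps) * (1 - INR j / INR N)) by (apply Rmult_le_pos; lra). lra. }
  assert (Ex : forall j, (n <= j)%nat -> x j = 1 + sigma * eps / alpha * ln (D j))
    by (intros j Hj; apply (mesh_layer sigma alpha eps N n); lia).
  assert (HC0' : C0 / INR N <= Rabs C0 * / INR N)
    by (apply Rmult_le_compat_r; [lra | apply Rle_abs]).
  assert (Hwl : forall j, (n + 1 <= j <= N)%nat ->
     (x j - x (j - 1)%nat) * D (j - 1)%nat <= 2 * (sigma / alpha) * (eps * / INR N)).
  { intros j Hj. rewrite (Ex j), (Ex (j - 1)%nat) by lia.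
    assert (H1 := Dge (j - 1)%nat ltac:(lia)).
    assert (H2 := ln_ratio_le (D (j - 1)%nat) (D j) ltac:(lra) ltac:(rewrite (DS j) by lia; lra)).
    replace (D j - D (j - 1)%nat) with del in H2 by (rewrite (DS j) by lia; ring).
    apply Rmult_le_compat_r with (r := D (j - 1)%nat) in H2; [|lra].
    replace (del / D (j - 1)%nat * D (j - 1)%nat) with del in H2 by (field; lra).
    apply Rle_trans with (sigma / alpha * eps * del).
    - replace ((1 + sigma * eps / alpha * ln (D j)
          - (1 + sigma * eps / alpha * ln (D (j - 1)%nat))) * D (j - 1)%nat)
        with (sigma / alpha * eps * ((ln (D j) - ln (D (j - 1)%nat)) * D (j - 1)%nat))
        by (field; lra).
      apply Rmult_le_compat_l; trivial. apply Rmult_le_pos; lra.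
    - assert (0 <= sigma / alpha * eps * (2 * / INR N - del)).
      { apply Rmult_le_pos; [apply Rmult_le_pos|]; lra. } lra. }
  assert (Hm : is_mesh x N).
  { apply bakhvalov_mesh; trivial; try lra. now exists n. }
  split; trivial.
  - lia.
  - apply Rle_trans with (C0 / INR N); trivial. eapply Rle_trans; [exact HC0'|].
    apply Rmult_le_compat_r; unfold C; lra.
  - intros j Hj. destruct (Nat.le_gt_cases j n) as [Hjn|Hjn].
    + unfold x. rewrite (mesh_coarse sigma alpha eps N n j), (mesh_coarse sigma alpha eps N n (j - 1)) by lia.
      replace (INR j) with (INR (j - 1) + 1) by (rewrite <- S_INR; f_equal; lia).
      replace (2 * tau sigma alpha eps * ((INR (j - 1) + 1) / INR N)
        - 2 * tau sigma alpha eps * (INR (j - 1) / INR N))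
        with (2 * tau sigma alpha eps * / INR N) by (field; lra).
      apply Rmult_le_compat_r; [lra|].
      assert (Hln : ln eps <= 0) by (rewrite <- ln_1; apply ln_le; lra).
      assert (Hse : 0 <= sigma * eps / alpha).
      { apply Rmult_le_pos; [apply Rmult_le_pos; lra | left; now apply Rinv_0_lt_compat]. }
      assert (0 <= sigma * eps / alpha * (- ln eps)) by (apply Rmult_le_pos; lra).
      unfold tau, C. lra.
    + assert (H1 := Hwl j ltac:(lia)). assert (H2 := Dge (j - 1)%nat ltac:(lia)).
      assert (H3 := mesh_lt x N Hm j Hj).
      apply Rmult_le_reg_r with eps; [lra|].
      apply Rle_trans with ((x j - x (j - 1)%nat) * D (j - 1)%nat);
        [apply Rmult_le_compat_l; lra|].
      eapply Rle_trans; [exact H1|]. unfold Rdiv.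
      assert (0 <= (C - 2 * (sigma / alpha)) * (eps * / INR N)).
      { apply Rmult_le_pos; [unfold C; lra | apply Rmult_le_pos; lra]. } lra.
  - intros j Hj. split; [apply Dge1 | apply Dle1]; lia.
  - fold (D (n + 1)%nat). rewrite DS by lia. replace (n + 1 - 1)%nat with n by lia. rewrite Dn.
    unfold Rdiv. assert (0 <= (C - Rabs C0 - 2) * / INR N) by (apply Rmult_le_pos; unfold C; lra). lra.
  - fold (D (n + 2)%nat). rewrite DS by lia. replace (n + 2 - 1)%nat with (n + 1)%nat by lia.
    rewrite DS by lia. replace (n + 1 - 1)%nat with n by lia. rewrite Dn.
    unfold Rdiv. assert (0 <= (C - Rabs C0 - 4) * / INR N) by (apply Rmult_le_pos; unfold C; lra). lra.
  - intros j Hj. fold (D j) (D (j - 1)%nat). rewrite (DS j) by lia.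
    assert (H := DS (j - 1)%nat ltac:(lia)). assert (H1 := Dge (j - 1 - 1)%nat ltac:(lia)). lra.
  - intros j Hj. fold (D j). rewrite Ex by lia.
    assert (HD : 0 < D j) by (assert (H := Dge j ltac:(lia)); lra).
    replace (- alpha * (1 - (1 + sigma * eps / alpha * ln (D j))) / eps)
      with (sigma * ln (D j)) by (field; lra).
    assert (Hln : ln (D j) <= 0).
    { rewrite <- ln_1. apply ln_le; trivial. apply Dle1; lia. }
    rewrite <- (exp_ln (D j) HD) at 2. rewrite <- exp_pow.
    assert (E : sigma * ln (D j) <= INR (k + 1) * ln (D j)).
    { rewrite plus_INR. simpl (INR 1).
      assert (0 <= (sigma - (INR k + 1)) * (- ln (D j))) by (apply Rmult_le_pos; lra). lra. }
    destruct E as [E|E]; [left; now apply exp_increasing | right; now rewrite E].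
  - intros j Hj. fold (D (j - 1)%nat). eapply Rle_trans; [apply Hwl; lia|].
    assert (0 <= (C - 2 * (sigma / alpha)) * (eps * / INR N)).
    { apply Rmult_le_pos; [unfold C; lra | apply Rmult_le_pos; lra]. } unfold Rdiv at 2. lra.
  - rewrite (Ex (n + 2)%nat), (Ex (n + 1)%nat) by lia.
    assert (D1 : D (n + 1)%nat = eps + del)
      by (rewrite DS by lia; replace (n + 1 - 1)%nat with n by lia; now rewrite Dn).
    assert (D2 : D (n + 2)%nat = D (n + 1)%nat + del)
      by (rewrite DS by lia; now replace (n + 2 - 1)%nat with (n + 1)%nat by lia).
    assert (HD1 : 0 < D (n + 1)%nat) by lra.
    assert (HLn : L <= ln (D (n + 2)%nat) - ln (D (n + 1)%nat)).
    { replace (D (n + 2)%nat) with (D (n + 1)%nat * (D (n + 2)%nat / D (n + 1)%nat)) by (field; lra).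
      rewrite ln_mult; trivial; [|apply Rdiv_lt_0_compat; lra].
      unfold L. assert (1 + / (1 + Rabs C0) <= D (n + 2)%nat / D (n + 1)%nat).
      { replace (D (n + 2)%nat / D (n + 1)%nat) with (1 + del / D (n + 1)%nat)
          by (rewrite D2; field; lra).
        apply Rplus_le_compat_l.
        apply Rmult_le_reg_r with (D (n + 1)%nat); trivial.
        unfold Rdiv. rewrite Rmult_assoc, Rinv_l, Rmult_1_r by lra.
        apply Rmult_le_reg_l with (1 + Rabs C0); [lra|].
        rewrite <- Rmult_assoc, Rinv_r, Rmult_1_l by lra. rewrite D1.
        assert (0 <= Rabs C0 * (del - / INR N)) by (apply Rmult_le_pos; lra). lra. }
      assert (ln (1 + / (1 + Rabs C0)) <= ln (D (n + 2)%nat / D (n + 1)%nat)) by (apply ln_le; lra).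
      lra. }
    replace (1 + sigma * eps / alpha * ln (D (n + 2)%nat)
        - (1 + sigma * eps / alpha * ln (D (n + 1)%nat)))
      with (sigma / alpha * eps * (ln (D (n + 2)%nat) - ln (D (n + 1)%nat))) by (field; lra).
    apply Rle_trans with (C * (sigma / alpha * eps * L)).
    + apply Rle_trans with (/ (sigma / alpha * L) * (sigma / alpha * eps * L)).
      * right. field. repeat split; lra.
      * apply Rmult_le_compat_r; [|unfold C; lra].
        apply Rmult_le_pos; [apply Rmult_le_pos|]; lra.
    + apply Rmult_le_compat_l; [unfold C; lra|]. apply Rmult_le_compat_l; trivial.
      apply Rmult_le_pos; lra.
Qed.

(** * Interpolation of the regular and layer parts *)

Definition layer_weight (alpha eps y : R) : R := exp (- alpha * (1 - y) / eps).

Lemma layer_weight_mono (alpha eps y z : R) :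
  0 < alpha -> 0 < eps -> y <= z -> layer_weight alpha eps y <= layer_weight alpha eps z.
Proof.
  intros Ha He H. unfold layer_weight. assert (Hi : 0 < / eps) by now apply Rinv_0_lt_compat.
  assert (E : - alpha * (1 - y) / eps <= - alpha * (1 - z) / eps).
  { apply Rmult_le_compat_r; [lra|]. assert (0 <= alpha * (z - y)) by (apply Rmult_le_pos; lra). lra. }
  destruct E as [E|E]; [left; now apply exp_increasing | right; now rewrite E].
Qed.

Lemma layer_weight_pos (alpha eps y : R) : 0 < layer_weight alpha eps y.
Proof. apply exp_pos. Qed.

Lemma continuous_layer_weight (alpha eps y : R) : continuous (layer_weight alpha eps) y.
Proof. unfold layer_weight. solve_continuous. Qed.

(** Integration gains the factor [eps] whatever the length of the interval; on the first layer cell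
    this supplies what the width, not O(eps), cannot. *)
Lemma RInt_layer_weight_sqr (alpha eps p q : R) :
  0 < alpha -> 0 < eps -> p <= q ->
  RInt (fun y => layer_weight alpha eps y ^ 2) p q
  <= eps / (2 * alpha) * layer_weight alpha eps q ^ 2.
Proof.
  intros Ha He Hpq.
  rewrite (RInt_FTC (fun y => eps / (2 * alpha) * layer_weight alpha eps y ^ 2)); trivial.
  - assert (0 <= eps / (2 * alpha) * layer_weight alpha eps p ^ 2).
    { apply Rmult_le_pos; [left; apply Rdiv_lt_0_compat; lra | apply pow2_ge_0]. } lra.
  - intros y _. unfold layer_weight. solve_derive. field. lra.
  - intros y _. assert (H := continuous_layer_weight alpha eps y). solve_continuous.
Qed.

Lemma penalty_coarse (N n j : nat) : N = (2 * n)%nat -> (j <= n)%nat -> penalty N j = 1.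
Proof.
  intros HN Hj. unfold penalty. replace (N / 2)%nat with n
    by (rewrite HN, Nat.mul_comm, Nat.div_mul; lia).
  destruct (Nat.leb_spec j n); [reflexivity | lia].
Qed.

Lemma penalty_layer (N n j : nat) : N = (2 * n)%nat -> (n < j)%nat -> penalty N j = INR N ^ 2.
Proof.
  intros HN Hj. unfold penalty. replace (N / 2)%nat with n
    by (rewrite HN, Nat.mul_comm, Nat.div_mul; lia).
  destruct (Nat.leb_spec j n); [lia | reflexivity].
Qed.

Lemma sqr_le_self (a : R) : 0 <= a <= 1 -> a ^ 2 <= a.
Proof. intros H. assert (0 <= a * (1 - a)) by (apply Rmult_le_pos; lra). lra. Qed.

Lemma self_le_sqr (a : R) : 1 <= a -> a <= a ^ 2.
Proof. intros H. assert (0 <= a * (a - 1)) by (apply Rmult_le_pos; lra). lra. Qed.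

(** With penalty 1 the factor 1 / N has to come from eps^2 <= eps <= C / N. *)
Lemma node_bound_coarse (N : nat) (eps C K K1 a : R) :
  (1 <= N)%nat -> 0 < eps <= 1 -> 1 <= C -> eps <= C / INR N -> Rabs a <= K1 -> C * K1 <= K ->
  (eps * a) ^ 2 <= 1 * (K ^ 2 / INR N).
Proof.
  intros HN He HC HeC Ha HK. assert (HNR : 0 < INR N) by (apply lt_0_INR; lia).
  assert (Hin : 0 < / INR N) by now apply Rinv_0_lt_compat.
  assert (P1 := Rabs_pos a).
  assert (A : a ^ 2 <= K1 ^ 2) by now apply Rabs_le_sqr.
  assert (B : (C * K1) ^ 2 <= K ^ 2) by (apply pow_incr; split; [apply Rmult_le_pos; lra | trivial]).
  assert (E : eps ^ 2 <= C ^ 2 * / INR N).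
  { eapply Rle_trans; [apply sqr_le_self; lra|]. eapply Rle_trans; [exact HeC|].
    apply Rmult_le_compat_r; [lra | now apply self_le_sqr]. }
  eapply Rle_trans; [apply (sqr_mult_le eps a _ _ E A)|].
  replace (C ^ 2 * / INR N * K1 ^ 2) with ((C * K1) ^ 2 * / INR N) by ring.
  unfold Rdiv. rewrite Rmult_1_l. apply Rmult_le_compat_r; lra.
Qed.

(** With penalty N^2 the share becomes N K^2, so a bound by [K] is more than enough. *)
Lemma node_bound_layer (N : nat) (K a : R) :
  (1 <= N)%nat -> Rabs a <= K -> a ^ 2 <= INR N ^ 2 * (K ^ 2 / INR N).
Proof.
  intros HN Ha. assert (HNR := INR_ge_1 N ltac:(lia)).
  apply Rabs_le_sqr in Ha. replace (INR N ^ 2 * (K ^ 2 / INR N)) with (INR N * K ^ 2) by (field; lra).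
  assert (P := pow2_ge_0 K). assert (0 <= (INR N - 1) * K ^ 2) by (apply Rmult_le_pos; lra). lra.
Qed.

(** One power of the width is dropped in the bound for the values, so that value and derivative
    share the rate [k], which is all that the estimate of the error asks for. *)
Lemma regular_interpolant (k : nat) (alpha C CD eps : R) (x D : nat -> R) (N n : nat)
    (U v : R -> R) (S E : nat -> R -> R) (j : nat) :
  (1 <= k)%nat -> 0 <= CD -> graded_mesh k alpha C eps x D N n ->
  layer_decomposition k alpha CD eps U v S E -> (1 <= j <= N)%nat ->
  exists I I', is_poly k I /\ (forall y, is_derive I y (I' y)) /\
    I (x (j - 1)%nat) = S 0%nat (x (j - 1)%nat) /\ I (x j) = S 0%nat (x j) /\
    forall y, x (j - 1)%nat <= y <= x j ->
      Rabs (S 0%nat y - I y) <= 2 * CD * (C / INR N) ^ k /\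
      Rabs (S 1%nat y - I' y) <= 2 * CD * (C / INR N) ^ k.
Proof.
  intros Hk HCD Hg Hd Hj. assert (Hx := gm_mesh Hg).
  assert (Hlt := mesh_lt x N Hx j Hj).
  assert (Hw := gm_width Hg j Hj).
  assert (Hu := fun y => cell_unit x N j y Hx Hj).
  destruct (interpolation_exists k (x (j - 1)%nat) (x j) CD S) as [I [I' [PI [DI [Il [Ir BI]]]]]];
    trivial.
  - intros l y Hl Hy. apply (dec_S_derive Hd); auto.
  - intros y Hy. apply (dec_S_bound Hd); auto.
  - exists I, I'. split; [trivial|split; [trivial|split; [trivial|split; [trivial|]]]].
    intros y Hy. destruct (BI y Hy) as [B1 B2].
    assert (h1 : (x j - x (j - 1)%nat) ^ k <= (C / INR N) ^ k) by (apply pow_incr; lra).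
    assert (h0 : 0 <= (x j - x (j - 1)%nat) ^ k) by (apply pow_le; lra).
    assert (hle : x j - x (j - 1)%nat <= 1).
    { assert (a1 := Hu (x j) ltac:(lra)). assert (a2 := Hu (x (j - 1)%nat) ltac:(lra)). lra. }
    split.
    + eapply Rle_trans; [exact B1|]. apply Rmult_le_compat_l; [lra|].
      eapply Rle_trans; [|exact h1]. rewrite Nat.add_1_r, <- tech_pow_Rmult.
      rewrite <- (Rmult_1_l ((x j - x (j - 1)%nat) ^ k)) at 2.
      apply Rmult_le_compat_r; lra.
    + eapply Rle_trans; [exact B2|]. apply Rmult_le_compat_l; lra.
Qed.

Lemma Rabs_minus_le (a b : R) : Rabs (a - b) <= Rabs a + Rabs b.
Proof. rewrite <- (Rabs_Ropp b). apply Rabs_triang. Qed.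

Lemma Rabs_sum3_le (a b c : R) (A B C : R) :
  Rabs a <= A -> Rabs b <= B -> Rabs c <= C -> Rabs (a + b + c) <= A + B + C.
Proof.
  intros. eapply Rle_trans; [apply Rabs_triang|]. apply Rplus_le_compat; trivial.
  eapply Rle_trans; [apply Rabs_triang|]. now apply Rplus_le_compat.
Qed.

(** [gm_decay] at [n], where [D] equals [eps], makes the weight at the transition point at most
    eps^(k+1). The derivative loses one power and still keeps eps^k. *)
Lemma decomposition_E_before (k : nat) (alpha C CD eps : R) (x D : nat -> R) (N n : nat)
    (U v : R -> R) (S E : nat -> R -> R) (y : R) :
  0 < alpha -> 0 < eps <= 1 -> 0 <= CD -> graded_mesh k alpha C eps x D N n ->
  layer_decomposition k alpha CD eps U v S E -> 0 <= y <= x n ->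
  Rabs (E 0%nat y) <= CD * eps ^ (k + 1) /\ Rabs (E 1%nat y) <= CD * eps ^ k.
Proof.
  intros Ha He HCD Hg Hd Hy. assert (Hx := gm_mesh Hg).
  assert (HN := gm_N Hg).
  assert (Hxn := mesh_range x N n Hx ltac:(lia)).
  assert (W : layer_weight alpha eps y <= eps ^ (k + 1)).
  { apply Rle_trans with (layer_weight alpha eps (x n)); [apply layer_weight_mono; lra|].
    assert (H := gm_decay Hg n ltac:(lia)).
    rewrite (gm_D_n Hg) in H. exact H. }
  assert (B0 := dec_E_bound Hd 0%nat y ltac:(lia) ltac:(lra)).
  assert (B1 := dec_E_bound Hd 1%nat y ltac:(lia) ltac:(lra)).
  fold (layer_weight alpha eps y) in B0, B1. rewrite pow_1 in B1. simpl in B0.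
  rewrite Rmult_1_r in B0. split.
  - eapply Rle_trans; [exact B0|]. now apply Rmult_le_compat_l.
  - eapply Rle_trans; [exact B1|]. rewrite Rmult_assoc. apply Rmult_le_compat_l; trivial.
    apply Rmult_le_reg_l with eps; [lra|]. rewrite <- Rmult_assoc, Rinv_r, Rmult_1_l by lra.
    rewrite Nat.add_1_r in W. exact W.
Qed.

Lemma eps_pow_le (k : nat) (alpha C eps : R) (x D : nat -> R) (N n : nat) :
  0 < eps <= 1 -> graded_mesh k alpha C eps x D N n ->
  forall m, eps ^ m <= (C / INR N) ^ m /\ eps ^ (m + 1) <= eps ^ m.
Proof.
  intros He Hg m. assert (P : 0 < eps ^ m) by (apply pow_lt; lra). split.
  - apply pow_incr. assert (H := gm_eps Hg). lra.
  - rewrite Nat.add_1_r, <- tech_pow_Rmult. rewrite <- (Rmult_1_l (eps ^ m)) at 2.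
    apply Rmult_le_compat_r; lra.
Qed.

(** [Z] is 0: before the transition point [E] and its derivative are small without any weight, so
    they join the smooth part of the error. *)
Lemma coarse_cell (k : nat) (alpha C CD eps K : R) (x D : nat -> R) (N n : nat)
    (U v : R -> R) (S E : nat -> R -> R) (j : nat) :
  (1 <= k)%nat -> 0 < alpha -> 1 <= C -> 0 < CD -> 0 < eps <= 1 -> N = (2 * n)%nat ->
  graded_mesh k alpha C eps x D N n -> layer_decomposition k alpha CD eps U v S E ->
  C * (4 * CD * (C / INR N) ^ k) <= K -> (1 <= j <= n)%nat ->
  exists P P' Z Z',
    cell_approximation k N eps K (penalty N (j - 1)) (penalty N j) (x (j - 1)%nat) (x j)
      (S 0%nat (x (j - 1)%nat)) (S 0%nat (x j)) 0 0 U v P P' Z Z'.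
Proof.
  intros Hk Ha HC HCD He HNn Hg Hd HK Hj.
  assert (HN := gm_N Hg). assert (Hx := gm_mesh Hg).
  assert (HNR : 0 < INR N) by (apply lt_0_INR; lia).
  assert (Hlt := mesh_lt x N Hx j ltac:(lia)).
  destruct (regular_interpolant k alpha C CD eps x D N n U v S E j) as [I [I' [PI [DI [Il [Ir BI]]]]]];
    trivial; [lra | lia |].
  destruct (eps_pow_le k alpha C eps x D N n He Hg k) as [e1 e2].
  (* One unit for the remainder, two for the interpolation error of [S], one for [E]. *)
  set (K1 := 4 * CD * (C / INR N) ^ k) in *.
  assert (PX : 0 <= (C / INR N) ^ k)
    by (apply pow_le, Rmult_le_pos; [lra | left; now apply Rinv_0_lt_compat]).
  assert (PK1 : 0 <= K1) by (unfold K1; apply Rmult_le_pos; lra).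
  assert (K1K : K1 <= K) by (assert (0 <= (C - 1) * K1) by (apply Rmult_le_pos; lra); lra).
  assert (B : forall y, x (j - 1)%nat <= y <= x j ->
     Rabs (U y - I y) <= K1 /\ Rabs (v y - I' y) <= K1).
  { intros y Hy. assert (Hy1 : 0 <= y <= 1) by (apply cell_unit with x N j; trivial; lia).
    assert (Hjn : x j <= x n) by (apply mesh_mono with N; trivial; lia).
    destruct (BI y Hy) as [b1 b2].
    destruct (dec_remainder Hd y Hy1) as [r1 r2].
    destruct (decomposition_E_before k alpha C CD eps x D N n U v S E y) as [d1 d2]; trivial;
      try lra.
    assert (q1 : CD * eps ^ k <= CD * (C / INR N) ^ k) by (apply Rmult_le_compat_l; lra).
    assert (q2 : CD * eps ^ (k + 1) <= CD * eps ^ k) by (apply Rmult_le_compat_l; lra).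
    split.
    - replace (U y - I y) with ((U y - S 0%nat y - E 0%nat y) + (S 0%nat y - I y) + E 0%nat y) by ring.
      eapply Rle_trans; [apply (Rabs_sum3_le _ _ _ _ _ _ r1 b1 d1)|]. unfold K1. lra.
    - replace (v y - I' y) with ((v y - S 1%nat y - E 1%nat y) + (S 1%nat y - I' y) + E 1%nat y) by ring.
      eapply Rle_trans; [apply (Rabs_sum3_le _ _ _ _ _ _ r2 b2 d2)|]. unfold K1. lra. }
  assert (PKN : 0 <= K ^ 2 / INR N)
    by (apply Rmult_le_pos; [apply pow2_ge_0 | left; now apply Rinv_0_lt_compat]).
  assert (I0 : @eq R (RInt (fun _ => 0 ^ 2) (x (j - 1)%nat) (x j)) 0)
    by (rewrite RInt_constR; simpl; ring).
  exists I, I', (fun _ => 0), (fun _ => 0). split; trivial.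
  - intros y _. split; [apply is_derive_const0 | apply continuous_const].
  - intros y Hy. destruct (B y Hy) as [b1 b2]. rewrite !Rminus_0_r. lra.
  - rewrite I0. apply Rmult_le_pos; lra.
  - rewrite I0. lra.
  - rewrite (penalty_coarse N n) by lia.
    apply node_bound_coarse with C K1; trivial; [lia | apply (gm_eps Hg) | apply B; lra].
  - rewrite (penalty_coarse N n) by lia.
    apply node_bound_coarse with C K1; trivial; [lia | apply (gm_eps Hg) | apply B; lra].
Qed.

(** Here [P] sees only [S], and the layer part is [E] minus its value at the transition point, so
    that it starts from 0 at the node with penalty 1. Its derivative is that of [E], bounded through
    the integral of the squared weight. *)
Lemma transition_cell (k : nat) (alpha C CD eps K : R) (x D : nat -> R) (N n : nat)
    (U v : R -> R) (S E : nat -> R -> R) :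
  (1 <= k)%nat -> 0 < alpha -> 1 <= C -> 0 < CD -> 0 < eps <= 1 -> N = (2 * n)%nat ->
  graded_mesh k alpha C eps x D N n -> layer_decomposition k alpha CD eps U v S E ->
  C * (4 * CD * (C / INR N) ^ k) + CD * C * (C / INR N) ^ k * (/ alpha + 2) <= K ->
  exists P P' Z Z',
    cell_approximation k N eps K (penalty N n) (penalty N (n + 1)) (x n) (x (n + 1)%nat)
      (S 0%nat (x n)) (S 0%nat (x (n + 1)%nat)) 0 (E 0%nat (x (n + 1)%nat) - E 0%nat (x n))
      U v P P' Z Z'.
Proof.
  intros Hk Ha HC HCD He HNn Hg Hd HK.
  assert (HN := gm_N Hg). assert (Hx := gm_mesh Hg).
  assert (HNR := INR_ge_1 N ltac:(lia)).
  assert (Hin : 0 < / INR N) by (apply Rinv_0_lt_compat; lra).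
  assert (Hin1 := Rinv_le_1 _ HNR).
  assert (Hlt := mesh_lt x N Hx (n + 1) ltac:(lia)).
  assert (Hu := fun y => cell_unit x N (n + 1) y Hx ltac:(lia)).
  destruct (regular_interpolant k alpha C CD eps x D N n U v S E (n + 1))
    as [I [I' [PI [DI [Il [Ir BI]]]]]]; trivial; [lra | lia |].
  replace (n + 1 - 1)%nat with n in * by lia.
  destruct (eps_pow_le k alpha C eps x D N n He Hg k) as [e1 e2].
  set (q := C / INR N) in *.
  assert (Pq : 0 < q) by (apply Rdiv_lt_0_compat; lra).
  assert (PX : 0 < q ^ k) by (now apply pow_lt).
  assert (Pia : 0 < / alpha) by now apply Rinv_0_lt_compat.
  set (K1 := 4 * CD * q ^ k) in *. set (W := CD * C * q ^ k) in *.
  assert (PK1 : 0 < K1) by (unfold K1; apply Rmult_lt_0_compat; lra).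
  assert (PCC : 0 < CD * C) by (apply Rmult_lt_0_compat; lra).
  assert (PW : 0 < W) by (unfold W; now apply Rmult_lt_0_compat).
  assert (PWa : 0 < W * / alpha) by now apply Rmult_lt_0_compat.
  assert (PCK : 0 <= (C - 1) * K1) by (apply Rmult_le_pos; lra).
  assert (CDe : CD * eps ^ k <= CD * q ^ k) by (apply Rmult_le_compat_l; lra).
  assert (CDe' : CD * eps ^ (k + 1) <= CD * eps ^ k) by (apply Rmult_le_compat_l; lra).
  destruct (decomposition_E_before k alpha C CD eps x D N n U v S E (x n)) as [Et Et'];
    trivial; [lra | assert (H := Hu (x n)); lra |].
  assert (B : forall y, x n <= y <= x (n + 1)%nat ->
     Rabs (U y - S 0%nat y - E 0%nat y + (S 0%nat y - I y) + E 0%nat (x n)) <= K1 /\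
     Rabs (v y - S 1%nat y - E 1%nat y + (S 1%nat y - I' y) + 0) <= 3 * CD * q ^ k).
  { intros y Hy. destruct (BI y Hy) as [b1 b2].
    destruct (dec_remainder Hd y (Hu y Hy)) as [r1 r2]. split.
    - eapply Rle_trans; [apply (Rabs_sum3_le _ _ _ _ _ _ r1 b1 Et)|]. unfold K1. lra.
    - assert (z0 : Rabs 0 <= 0) by (rewrite Rabs_R0; lra).
      eapply Rle_trans; [apply (Rabs_sum3_le _ _ _ _ _ _ r2 b2 z0)|]. lra. }
  set (w := layer_weight alpha eps (x (n + 1)%nat)).
  assert (Pw : 0 < w) by apply layer_weight_pos.
  assert (Hw : w <= q * q ^ k).
  { eapply Rle_trans; [apply (gm_decay Hg); lia|].
    replace (q * q ^ k) with (q ^ (k + 1)) by (rewrite Nat.add_1_r; reflexivity). apply pow_incr.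
    assert (H := gm_D_range Hg (n + 1)%nat ltac:(lia)).
    assert (H1 := gm_D_n1 Hg). fold q in H1. lra. }
  (* The decay exponent is k + 1: k powers give the rate, the last one the factor 1 / N of the cell
     share. *)
  assert (HwW : CD * w <= W * / INR N).
  { unfold W. replace (CD * C * q ^ k * / INR N) with (CD * (q * q ^ k)) by (unfold q; field; lra).
    apply Rmult_le_compat_l; lra. }
  assert (BE0 : forall y, x n <= y <= x (n + 1)%nat ->
     Rabs (E 0%nat y) <= CD * layer_weight alpha eps y).
  { intros y Hy. eapply Rle_trans; [apply (dec_E_bound Hd); [lia | auto]|].
    simpl. rewrite Rmult_1_r. apply Rle_refl. }
  assert (BE1 : forall y, x n <= y <= x (n + 1)%nat ->
     Rabs (E 1%nat y) <= CD * / eps * layer_weight alpha eps y).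
  { intros y Hy. eapply Rle_trans; [apply (dec_E_bound Hd); [lia | auto]|].
    rewrite pow_1. apply Rle_refl. }
  assert (DE0 : forall y, x n <= y <= x (n + 1)%nat -> is_derive (E 0%nat) y (E 1%nat y))
    by (intros; apply (dec_E_derive Hd 0%nat); [lia | auto]).
  assert (cE0 : cont_on (x n) (x (n + 1)%nat) (E 0%nat))
    by (intros y Hy; eapply is_derive_continuous; now apply DE0).
  assert (cE1 : cont_on (x n) (x (n + 1)%nat) (E 1%nat)).
  { intros y Hy; eapply is_derive_continuous.
    apply (dec_E_derive Hd 1%nat); [lia | auto]. }
  assert (cw := fun y => continuous_layer_weight alpha eps y).
  assert (IW := RInt_layer_weight_sqr alpha eps (x n) (x (n + 1)%nat) Ha ltac:(lra) ltac:(lra)).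
  fold w in IW.
  assert (Hiw : (CD * w) ^ 2 <= W ^ 2 * / INR N).
  { apply Rle_trans with ((W * / INR N) ^ 2).
    - apply pow_incr. split; trivial. left; now apply Rmult_lt_0_compat.
    - rewrite Rpow_mult_distr. apply Rmult_le_compat_l; [apply pow2_ge_0|].
      apply sqr_le_self; lra. }
  assert (KW : (W * (/ alpha + 2)) ^ 2 <= K ^ 2).
  { apply pow_incr. split; [apply Rmult_le_pos; lra | lra]. }
  assert (KW' : W ^ 2 * (/ alpha + 2) <= K ^ 2).
  { eapply Rle_trans; [|exact KW]. rewrite Rpow_mult_distr. apply Rmult_le_compat_l; [apply pow2_ge_0|].
    apply self_le_sqr; lra. }
  exists I, I', (fun y => E 0%nat y - E 0%nat (x n)), (E 1%nat). split; trivial.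
  - intros y Hy. split; [|now apply cE1]. assert (d := DE0 y Hy). solve_derive. ring.
  - ring.
  - intros y Hy. destruct (B y Hy) as [b1 b2]. split.
    + replace (U y - I y - (E 0%nat y - E 0%nat (x n)))
        with (U y - S 0%nat y - E 0%nat y + (S 0%nat y - I y) + E 0%nat (x n)) by ring. lra.
    + replace (v y - I' y - E 1%nat y)
        with (v y - S 1%nat y - E 1%nat y + (S 1%nat y - I' y) + 0) by ring. unfold K1 in *. lra.
  - apply Rle_trans with (RInt (fun y => 2 * CD ^ 2 * layer_weight alpha eps y ^ 2
        + 2 * (CD * eps ^ (k + 1)) ^ 2) (x n) (x (n + 1)%nat)).
    + apply RInt_mono; solve_side.
      * intros y Hy. assert (b := BE0 y ltac:(lra)). apply Rabs_le_sqr in b.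
        assert (b' := Rabs_le_sqr _ _ Et). rewrite Rpow_mult_distr in b.
        assert (P := pow2_ge_0 (E 0%nat y + E 0%nat (x n))). lra.
    + rewrite RInt_Rplus, RInt_Rscal, RInt_constR; solve_side.
      assert (hx : x (n + 1)%nat - x n <= 1).
      { assert (h1 := Hu (x n) ltac:(lra)). assert (h2 := Hu (x (n + 1)%nat) ltac:(lra)). lra. }
      assert (T1 : 2 * CD ^ 2 * RInt (fun y => layer_weight alpha eps y ^ 2) (x n) (x (n + 1)%nat)
         <= eps * (/ alpha * (W ^ 2 * / INR N))).
      { apply Rle_trans with (2 * CD ^ 2 * (eps / (2 * alpha) * w ^ 2)).
        - apply Rmult_le_compat_l; trivial. assert (P := pow2_ge_0 CD). lra.
        - replace (2 * CD ^ 2 * (eps / (2 * alpha) * w ^ 2))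
            with (eps * (/ alpha * (CD * w) ^ 2)) by (field; lra).
          apply Rmult_le_compat_l; [lra|]. apply Rmult_le_compat_l; lra. }
      (* The subtracted constant is not concentrated in the layer, and its integral gains nothing;
         of its square one [eps] gives the weight and a second one, at most C / N, the share. *)
      assert (T2 : 2 * (CD * eps ^ (k + 1)) ^ 2 * (x (n + 1)%nat - x n)
         <= eps * (2 * (W ^ 2 * / INR N))).
      { apply Rle_trans with (2 * (CD * eps ^ (k + 1)) ^ 2 * 1).
        - apply Rmult_le_compat_l; trivial.
          assert (P := pow2_ge_0 (CD * eps ^ (k + 1))). lra.
        - replace (2 * (CD * eps ^ (k + 1)) ^ 2 * 1)
            with (eps * (2 * (eps * (CD * eps ^ k) ^ 2))) by (rewrite Nat.add_1_r; simpl; ring).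
          apply Rmult_le_compat_l; [lra|]. apply Rmult_le_compat_l; [lra|].
          replace (W ^ 2 * / INR N) with (C * / INR N * (C * (CD * q ^ k) ^ 2))
            by (unfold W; ring).
          assert (Q : (CD * eps ^ k) ^ 2 <= (CD * q ^ k) ^ 2).
          { apply pow_incr. split; trivial. apply Rmult_le_pos; [lra | apply pow_le; lra]. }
          assert (He' := gm_eps Hg).
          apply Rmult_le_compat; [lra | apply pow2_ge_0 | exact He' |].
          assert (P := pow2_ge_0 (CD * q ^ k)).
          assert (0 <= (C - 1) * (CD * q ^ k) ^ 2) by (apply Rmult_le_pos; lra). lra. }
      assert (T3 : eps * (W ^ 2 * (/ alpha + 2) * / INR N) <= eps * (K ^ 2 * / INR N)).
      { apply Rmult_le_compat_l; [lra|]. apply Rmult_le_compat_r; lra. }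
      unfold Rdiv. lra.
  - apply Rle_trans with (eps * RInt (fun y => (CD * / eps) ^ 2 * layer_weight alpha eps y ^ 2)
       (x n) (x (n + 1)%nat)).
    + apply Rmult_le_compat_l; [lra|].
      apply RInt_mono; solve_side.
      * intros y Hy. assert (b := BE1 y ltac:(lra)). apply Rabs_le_sqr in b.
        rewrite Rpow_mult_distr in b. exact b.
    + rewrite RInt_Rscal; solve_side.
      apply Rle_trans with (eps * ((CD * / eps) ^ 2 * (eps / (2 * alpha) * w ^ 2))).
      * apply Rmult_le_compat_l; [lra|]. apply Rmult_le_compat_l; [apply pow2_ge_0 | exact IW].
      * replace (eps * ((CD * / eps) ^ 2 * (eps / (2 * alpha) * w ^ 2)))
          with (/ 2 * / alpha * (CD * w) ^ 2) by (field; lra).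
        apply Rle_trans with (/ 2 * / alpha * (W ^ 2 * / INR N)).
        -- apply Rmult_le_compat_l; [|exact Hiw]. apply Rmult_le_pos; lra.
        -- replace (/ 2 * / alpha * (W ^ 2 * / INR N)) with (W ^ 2 * (/ 2 * / alpha) * / INR N) by ring.
           apply Rmult_le_compat_r; [lra|]. eapply Rle_trans; [|exact KW'].
           apply Rmult_le_compat_l; [apply pow2_ge_0 | lra].
  - rewrite (penalty_coarse N n) by lia.
    apply node_bound_coarse with C K1; trivial; [lia | apply (gm_eps Hg) | | lra].
    destruct (B (x n) ltac:(lra)) as [_ b2].
    replace (v (x n) - I' (x n)) with ((v (x n) - S 1%nat (x n) - E 1%nat (x n)
       + (S 1%nat (x n) - I' (x n)) + 0) + E 1%nat (x n)) by ring.
    eapply Rle_trans; [apply Rabs_triang|]. unfold K1. lra.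
  - rewrite (penalty_layer N n) by lia.
    apply node_bound_layer; [lia|].
    set (y := x (n + 1)%nat) in *. destruct (B y ltac:(lra)) as [_ b2].
    assert (b3 := BE1 y ltac:(lra)). fold w in b3.
    replace (eps * (v y - I' y)) with (eps * (v y - S 1%nat y - E 1%nat y
       + (S 1%nat y - I' y) + 0) + eps * E 1%nat y) by ring.
    eapply Rle_trans; [apply Rabs_triang|]. rewrite !Rabs_mult, (Rabs_right eps) by lra.
    assert (t1 : eps * Rabs (v y - S 1%nat y - E 1%nat y + (S 1%nat y - I' y) + 0) <= 3 * CD * q ^ k).
    { rewrite <- (Rmult_1_l (3 * CD * q ^ k)). apply Rmult_le_compat; try lra. apply Rabs_pos. }
    assert (t2 : eps * Rabs (E 1%nat y) <= CD * w).
    { apply Rle_trans with (eps * (CD * / eps * w)); [apply Rmult_le_compat_l; lra|].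
      right. field. lra. }
    assert (t3 : W * / INR N <= W * 1) by (apply Rmult_le_compat_l; lra).
    unfold K1 in *. lra.
Qed.

(** [Pi] stands for the approximation of [E] on a cell beyond the first of the layer. Since D >= 1 /
    N there, the width is O(eps). The energy of [Z'] contains D^2 times the width over eps: one D
    combines with the width to at most C eps / N, the other is at most 1. *)
Lemma layer_cell (k : nat) (alpha C CD eps K K2 pil pir : R) (x D : nat -> R) (N n : nat)
    (U v Pi Pi' : R -> R) (S E : nat -> R -> R) (j : nat) :
  (1 <= k)%nat -> 0 < alpha -> 1 <= C -> 0 < CD -> 0 <= K2 -> 0 < eps <= 1 -> N = (2 * n)%nat ->
  graded_mesh k alpha C eps x D N n -> layer_decomposition k alpha CD eps U v S E ->
  4 * CD * (C / INR N) ^ k + C * ((K2 + CD * C) * (C / INR N) ^ k) <= K ->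
  (n + 2 <= j <= N)%nat ->
  is_poly k Pi -> (forall y, is_derive Pi y (Pi' y)) ->
  Pi (x (j - 1)%nat) = pil -> Pi (x j) = pir ->
  (forall y, x (j - 1)%nat <= y <= x j ->
     Rabs (E 0%nat y - Pi y) <= K2 * (C / INR N) ^ k * / INR N /\
     eps * Rabs (E 1%nat y - Pi' y) <= K2 * (C / INR N) ^ k * D (j - 1)%nat) ->
  exists P P' Z Z',
    cell_approximation k N eps K (penalty N (j - 1)) (penalty N j) (x (j - 1)%nat) (x j)
      (S 0%nat (x (j - 1)%nat) + pil) (S 0%nat (x j) + pir)
      (E 0%nat (x (j - 1)%nat) - pil - E 0%nat (x n)) (E 0%nat (x j) - pir - E 0%nat (x n))
      U v P P' Z Z'.
Proof.
  intros Hk Ha HC HCD HK2 He HNn Hg Hd HK Hj PPi DPi Pil Pir BPi.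
  assert (HN := gm_N Hg). assert (Hx := gm_mesh Hg).
  assert (HNR := INR_ge_1 N ltac:(lia)).
  assert (Hin : 0 < / INR N) by (apply Rinv_0_lt_compat; lra).
  assert (Hin1 := Rinv_le_1 _ HNR).
  assert (Hlt := mesh_lt x N Hx j ltac:(lia)).
  assert (Hu := fun y => cell_unit x N j y Hx ltac:(lia)).
  destruct (regular_interpolant k alpha C CD eps x D N n U v S E j)
    as [I [I' [PI [DI [Il [Ir BI]]]]]]; trivial; [lra | lia |].
  destruct (eps_pow_le k alpha C eps x D N n He Hg k) as [e1 e2].
  assert (He' := gm_eps Hg).
  assert (HD := gm_D_range Hg (j - 1)%nat ltac:(lia)).
  assert (Hw := gm_layer_width Hg j Hj).
  destruct (decomposition_E_before k alpha C CD eps x D N n U v S E (x n)) as [Et _];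
    trivial; [lra | |].
  { assert (H := mesh_range x N n Hx ltac:(lia)). lra. }
  set (X := (C / INR N) ^ k) in *. set (d := D (j - 1)%nat) in *.
  set (p := x (j - 1)%nat) in *. set (q := x j) in *.
  assert (PX : 0 < X) by (apply pow_lt, Rdiv_lt_0_compat; lra).
  assert (PCX : 0 < CD * X) by now apply Rmult_lt_0_compat.
  set (K3 := (K2 + CD * C) * X) in *.
  assert (PCC : 0 < CD * C) by (apply Rmult_lt_0_compat; lra).
  assert (PK2 : 0 <= K2 * X) by (apply Rmult_le_pos; lra).
  assert (PCCX : 0 < CD * C * X) by now apply Rmult_lt_0_compat.
  assert (PK3 : 0 < K3) by (unfold K3; lra).
  assert (CK3 : 0 <= (C - 1) * K3) by (apply Rmult_le_pos; lra).
  assert (K3K : C * K3 ^ 2 <= K ^ 2).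
  { apply Rle_trans with ((C * K3) ^ 2).
    - rewrite Rpow_mult_distr. apply Rmult_le_compat_r; [apply pow2_ge_0 | now apply self_le_sqr].
    - apply pow_incr. split; [apply Rmult_le_pos|]; lra. }
  assert (Hh : q - p <= C * eps).
  { apply Rmult_le_reg_r with (/ INR N); trivial.
    apply Rle_trans with ((q - p) * d); [apply Rmult_le_compat_l; lra|].
    eapply Rle_trans; [exact Hw|]. unfold Rdiv. lra. }
  assert (CDe : CD * eps ^ k <= CD * X) by (apply Rmult_le_compat_l; lra).
  assert (CDe' : CD * eps ^ (k + 1) <= CD * eps ^ k) by (apply Rmult_le_compat_l; lra).
  (* One of the k + 1 powers of [eps] is spent on C / N, so that the subtracted constant meets the
     same bound as the error of [Pi]. *)
  assert (Et2 : CD * eps ^ (k + 1) <= CD * C * X * / INR N).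
  { rewrite Nat.add_1_r, <- tech_pow_Rmult.
    replace (CD * C * X * / INR N) with (CD * (C / INR N * X)) by (unfold Rdiv; ring).
    apply Rmult_le_compat_l; [lra|]. apply Rmult_le_compat; try lra. apply pow_le; lra. }
  assert (DE0 : forall y, p <= y <= q -> is_derive (E 0%nat) y (E 1%nat y))
    by (intros; apply (dec_E_derive Hd 0%nat); [lia | auto]).
  assert (cE1 : cont_on p q (E 1%nat)).
  { intros y Hy; eapply is_derive_continuous.
    apply (dec_E_derive Hd 1%nat); [lia | auto]. }
  assert (cE0 : cont_on p q (E 0%nat)) by (intros y Hy; eapply is_derive_continuous; now apply DE0).
  assert (cPi' := is_poly_derive_continuous k Pi Pi' PPi DPi).
  assert (cPi : forall y, continuous Pi y) by (intros y; eapply is_derive_continuous, DPi).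
  assert (PKN : 0 <= K ^ 2 * / INR N) by (apply Rmult_le_pos; [apply pow2_ge_0 | lra]).
  assert (BN : forall y, p <= y <= q -> (eps * (v y - (I' y + Pi' y))) ^ 2
      <= INR N ^ 2 * (K ^ 2 / INR N)).
  { intros y Hy. apply node_bound_layer; [lia|].
    destruct (BI y Hy) as [_ b2]. destruct (BPi y Hy) as [_ b4].
    destruct (dec_remainder Hd y (Hu y Hy)) as [_ r2].
    assert (z0 : Rabs 0 <= 0) by (rewrite Rabs_R0; lra).
    assert (T := Rabs_sum3_le _ _ _ _ _ _ r2 b2 z0).
    replace (eps * (v y - (I' y + Pi' y))) with (eps * (v y - S 1%nat y - E 1%nat y
       + (S 1%nat y - I' y) + 0) + eps * (E 1%nat y - Pi' y)) by ring.
    eapply Rle_trans; [apply Rabs_triang|]. rewrite !Rabs_mult, (Rabs_right eps) by lra.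
    assert (t1 : eps * Rabs (v y - S 1%nat y - E 1%nat y + (S 1%nat y - I' y) + 0) <= 1 * (3 * CD * X)).
    { apply Rmult_le_compat; try lra. apply Rabs_pos. }
    assert (t2 : K2 * X * d <= K2 * X * 1) by (apply Rmult_le_compat_l; lra).
    unfold K3 in *. lra. }
  exists (fun y => I y + Pi y), (fun y => I' y + Pi' y),
    (fun y => E 0%nat y - Pi y - E 0%nat (x n)), (fun y => E 1%nat y - Pi' y).
  split.
  - now apply is_poly_plus.
  - intros y. apply is_derive_Rplus; auto.
  - intros y Hy. assert (d1 := DE0 y Hy). assert (d2 := DPi y). assert (c1 := cE1 y Hy).
    assert (c2 := cPi' y). split; [solve_derive; ring | solve_continuous].
  - now rewrite Il, Pil.
  - now rewrite Ir, Pir.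
  - now rewrite Pil.
  - now rewrite Pir.
  - intros y Hy. destruct (BI y Hy) as [b1 b2].
    destruct (dec_remainder Hd y (Hu y Hy)) as [r1 r2]. split.
    + replace (U y - (I y + Pi y) - (E 0%nat y - Pi y - E 0%nat (x n)))
        with (U y - S 0%nat y - E 0%nat y + (S 0%nat y - I y) + E 0%nat (x n)) by ring.
      eapply Rle_trans; [apply (Rabs_sum3_le _ _ _ _ _ _ r1 b1 Et)|]. lra.
    + assert (z0 : Rabs 0 <= 0) by (rewrite Rabs_R0; lra).
      replace (v y - (I' y + Pi' y) - (E 1%nat y - Pi' y))
        with (v y - S 1%nat y - E 1%nat y + (S 1%nat y - I' y) + 0) by ring.
      eapply Rle_trans; [apply (Rabs_sum3_le _ _ _ _ _ _ r2 b2 z0)|]. lra.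
  - apply Rle_trans with ((K3 * / INR N) ^ 2 * (q - p)).
    + apply RInt_le_const; try lra.
      * intros y Hy. assert (c0 := cE0 y Hy). solve_continuous.
      * intros y Hy. apply Rabs_le_sqr. destruct (BPi y ltac:(lra)) as [b3 _].
        eapply Rle_trans; [apply Rabs_minus_le|].
        unfold K3. lra.
    + apply Rle_trans with ((K3 * / INR N) ^ 2 * (C * eps));
        [apply Rmult_le_compat_l; [apply pow2_ge_0 | trivial]|].
      replace ((K3 * / INR N) ^ 2 * (C * eps)) with (eps * ((C * K3 ^ 2) * (/ INR N) ^ 2)) by ring.
      apply Rmult_le_compat_l; [lra|]. unfold Rdiv. apply Rmult_le_compat; trivial.
      * apply Rmult_le_pos; [lra | apply pow2_ge_0].
      * apply pow2_ge_0.
      * apply sqr_le_self; lra.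
  - apply Rle_trans with (eps * ((K2 * X * d * / eps) ^ 2 * (q - p))).
    + apply Rmult_le_compat_l; [lra|]. apply RInt_le_const; try lra.
      * intros y Hy. assert (c1 := cE1 y Hy). solve_continuous.
      * intros y Hy. apply Rabs_le_sqr. destruct (BPi y ltac:(lra)) as [_ b4].
        apply Rmult_le_reg_l with eps; [lra|]. eapply Rle_trans; [exact b4|].
        right. field. lra.
    + replace (eps * ((K2 * X * d * / eps) ^ 2 * (q - p)))
        with ((K2 * X) ^ 2 * (d * (((q - p) * d) * / eps))) by (field; lra).
      assert (T1 : (q - p) * d * / eps <= C * / INR N).
      { apply Rmult_le_reg_r with eps; [lra|]. rewrite Rmult_assoc, Rinv_l, Rmult_1_r by lra.
        eapply Rle_trans; [exact Hw|]. right. unfold Rdiv. ring. }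
      assert (T2 : d * ((q - p) * d * / eps) <= 1 * (C * / INR N)).
      { apply Rmult_le_compat; try lra. apply Rmult_le_pos; [apply Rmult_le_pos; lra|].
        left; apply Rinv_0_lt_compat; lra. }
      apply Rle_trans with ((K2 * X) ^ 2 * (C * / INR N)).
      * apply Rmult_le_compat_l; [apply pow2_ge_0 | lra].
      * replace ((K2 * X) ^ 2 * (C * / INR N)) with (C * (K2 * X) ^ 2 * / INR N) by ring.
        unfold Rdiv. apply Rmult_le_compat_r; [lra|]. eapply Rle_trans; [|exact K3K].
        apply Rmult_le_compat_l; [lra|]. apply pow_incr. unfold K3. lra.
  - rewrite (penalty_layer N n) by lia. apply BN. lra.
  - rewrite (penalty_layer N n) by lia. apply BN. lra.
Qed.

(** On the second layer cell [E] is O(N^-(k+1)) and [gm_width_lower] controls the slope of the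
    affine piece; on the later ones the weight at the right end compensates the powers of 1 / eps in
    the derivatives. The four summands of the constant are for value and derivative in these two
    cases. *)
Lemma layer_interpolant (k : nat) (alpha C CD eps : R) (x D : nat -> R) (N n : nat)
    (U v : R -> R) (S E : nat -> R -> R) (j : nat) :
  (1 <= k)%nat -> 0 < alpha -> 1 <= C -> 0 < CD -> 0 < eps <= 1 ->
  graded_mesh k alpha C eps x D N n -> layer_decomposition k alpha CD eps U v S E ->
  (n + 2 <= j <= N)%nat ->
  exists Pi Pi', is_poly k Pi /\ (forall y, is_derive Pi y (Pi' y)) /\
    Pi (x (j - 1)%nat) = (if (j - 1 <=? n + 1)%nat then 0 else E 0%nat (x (j - 1)%nat)) /\
    Pi (x j) = E 0%nat (x j) /\
    forall y, x (j - 1)%nat <= y <= x j ->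
     Rabs (E 0%nat y - Pi y)
       <= CD * (2 * C + (1 + C) * C + 4 * 2 ^ k * C + 4 * 2 ^ k) * (C / INR N) ^ k * / INR N /\
     eps * Rabs (E 1%nat y - Pi' y)
       <= CD * (2 * C + (1 + C) * C + 4 * 2 ^ k * C + 4 * 2 ^ k) * (C / INR N) ^ k * D (j - 1)%nat.
Proof.
  intros Hk Ha HC HCD He Hg Hd Hj.
  assert (HN := gm_N Hg). assert (Hx := gm_mesh Hg).
  assert (HNR := INR_ge_1 N ltac:(lia)).
  assert (Hin : 0 < / INR N) by (apply Rinv_0_lt_compat; lra).
  assert (Hlt := mesh_lt x N Hx j ltac:(lia)).
  assert (Hu := fun y => cell_unit x N j y Hx ltac:(lia)).
  assert (HD := gm_D_range Hg (j - 1)%nat ltac:(lia)).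
  assert (Hw := gm_layer_width Hg j Hj).
  set (X := (C / INR N) ^ k) in *. set (d := D (j - 1)%nat) in *.
  set (p := x (j - 1)%nat) in *. set (q := x j) in *.
  assert (PX : 0 < X) by (apply pow_lt, Rdiv_lt_0_compat; lra).
  assert (P2 : 0 < 2 ^ k) by (apply pow_lt; lra).
  assert (PCC : 0 < (1 + C) * C) by (apply Rmult_lt_0_compat; lra).
  assert (P2C : 0 < 2 ^ k * C) by (apply Rmult_lt_0_compat; lra).
  set (w := layer_weight alpha eps q).
  assert (Pw : 0 < w) by apply layer_weight_pos.
  assert (Hw1 : w <= D j ^ (k + 1)) by (apply (gm_decay Hg); lia).
  assert (BE : forall l y, (l <= k + 1)%nat -> p <= y <= q ->
     Rabs (E l y) <= CD * (/ eps) ^ l * w).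
  { intros l y Hl Hy. eapply Rle_trans; [apply (dec_E_bound Hd); [lia | auto]|].
    apply Rmult_le_compat_l.
    - apply Rmult_le_pos; [lra | apply pow_le; left; apply Rinv_0_lt_compat; lra].
    - apply (layer_weight_mono alpha eps y q); lra. }
  assert (Mono : forall a r, 0 <= r ->
     0 <= a <= 2 * C + (1 + C) * C + 4 * 2 ^ k * C + 4 * 2 ^ k ->
     CD * a * X * r <= CD * (2 * C + (1 + C) * C + 4 * 2 ^ k * C + 4 * 2 ^ k) * X * r).
  { intros a r Hr Hra. apply Rmult_le_compat_r; trivial. apply Rmult_le_compat_r; [lra|].
    apply Rmult_le_compat_l; lra. }
  destruct (Nat.leb_spec (j - 1) (n + 1)) as [Hj2|Hj2].
  - assert (Ej : j = (n + 2)%nat) by lia.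
    assert (Hh := gm_width_lower Hg).
    replace (x (n + 2)%nat) with q in Hh by (unfold q; now rewrite Ej).
    replace (x (n + 1)%nat) with p in Hh by (unfold p; rewrite Ej; f_equal; lia).
    assert (Hw2 : w <= C * X * / INR N).
    { eapply Rle_trans; [exact Hw1|]. rewrite Ej.
      replace (C * X * / INR N) with ((C / INR N) ^ (k + 1))
        by (rewrite Nat.add_1_r, <- tech_pow_Rmult; unfold X, Rdiv; ring).
      apply pow_incr. assert (H1 := gm_D_n2 Hg).
      assert (H2 := gm_D_range Hg (n + 2)%nat ltac:(lia)). lra. }
    assert (Hi : 0 < / (q - p)) by (apply Rinv_0_lt_compat; lra).
    assert (BEq := BE 0%nat q ltac:(lia) ltac:(lra)). rewrite pow_O, Rmult_1_r in BEq.
    exists (fun y => E 0%nat q * / (q - p) * (y + - p)), (fun _ => E 0%nat q * / (q - p)).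
    split; [|split; [|split; [|split]]].
    + apply is_poly_scal, is_poly_affine; trivial.
    + intros y. solve_derive. ring.
    + ring.
    + field. lra.
    + intros y Hy. split.
      * apply Rle_trans with (CD * (2 * C) * X * / INR N); [|apply Mono; lra].
        eapply Rle_trans; [apply Rabs_minus_le|].
        assert (B1 := BE 0%nat y ltac:(lia) Hy). rewrite pow_O, Rmult_1_r in B1.
        assert (B2 : Rabs (E 0%nat q * / (q - p) * (y + - p)) <= CD * w).
        { rewrite Rmult_assoc, Rabs_mult. rewrite <- (Rmult_1_r (CD * w)).
          apply Rmult_le_compat; try apply Rabs_pos; trivial.
          rewrite Rabs_right.
          - apply Rmult_le_reg_l with (q - p); [lra|].
            rewrite <- Rmult_assoc, Rinv_r, Rmult_1_l by lra. lra.
          - apply Rle_ge, Rmult_le_pos; lra. }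
        assert (CD * w <= CD * (C * X * / INR N)) by (apply Rmult_le_compat_l; lra). lra.
      * apply Rle_trans with (CD * ((1 + C) * C) * X * d); [|apply Mono; lra].
        apply Rle_trans with (CD * ((1 + C) * C) * X * / INR N).
        2:{ apply Rmult_le_compat_l; [|lra]. apply Rmult_le_pos; [apply Rmult_le_pos|]; lra. }
        assert (B1 := BE 1%nat y ltac:(lia) Hy). rewrite pow_1 in B1.
        assert (T : Rabs (E 1%nat y - E 0%nat q * / (q - p))
           <= CD * / eps * w + CD * w * / (q - p)).
        { eapply Rle_trans; [apply Rabs_minus_le|]. rewrite Rabs_mult.
          rewrite (Rabs_right (/ (q - p))) by lra. apply Rplus_le_compat; trivial.
          apply Rmult_le_compat_r; lra. }
        apply Rle_trans with (eps * (CD * / eps * w + CD * w * / (q - p)));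
          [apply Rmult_le_compat_l; lra|].
        replace (eps * (CD * / eps * w + CD * w * / (q - p)))
          with (CD * w * (1 + eps * / (q - p))) by (field; lra).
        replace (CD * ((1 + C) * C) * X * / INR N) with (CD * (C * X * / INR N) * (1 + C)) by ring.
        assert (R1 : eps * / (q - p) <= C).
        { apply Rmult_le_reg_r with (q - p); [lra|].
          rewrite Rmult_assoc, Rinv_l, Rmult_1_r by lra. exact Hh. }
        assert (0 < eps * / (q - p)) by (apply Rmult_lt_0_compat; lra).
        apply Rmult_le_compat; try lra.
        -- apply Rmult_le_pos; lra.
        -- apply Rmult_le_compat_l; lra.
  - assert (Hdd := gm_D_double Hg j Hj). fold d in Hdd.
    assert (HDj := gm_D_range Hg j ltac:(lia)).
    (* The width in the local scale of the layer: the interpolation error is a multiple of r^(k+1),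
       and passing from [D j] to [D (j - 1)] by doubling shows that [r] is O(1 / N). *)
    set (r := (q - p) * D j * / eps).
    assert (Pie : 0 < / eps) by (apply Rinv_0_lt_compat; lra).
    assert (Pr : 0 <= r) by (unfold r; apply Rmult_le_pos; [apply Rmult_le_pos|]; lra).
    assert (Hr : r <= 2 * (C / INR N)).
    { unfold r. apply Rmult_le_reg_r with eps; [lra|]. rewrite Rmult_assoc, Rinv_l, Rmult_1_r by lra.
      apply Rle_trans with ((q - p) * (2 * d)); [apply Rmult_le_compat_l; lra|].
      unfold Rdiv in *. lra. }
    assert (Hrk : r ^ k <= 2 ^ k * X)
      by (unfold X; rewrite <- Rpow_mult_distr; apply pow_incr; lra).
    set (M := CD * (/ eps) ^ (k + 1) * D j ^ (k + 1)).
    destruct (interpolation_exists k p q M E) as [I [I' [PI [DI [Il [Ir BI]]]]]]; trivial.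
    { intros l y Hl Hy. apply (dec_E_derive Hd); auto. }
    { intros y Hy. eapply Rle_trans; [apply BE; trivial; lia|]. unfold M.
      apply Rmult_le_compat_l; trivial. apply Rmult_le_pos; [lra | apply pow_le; lra]. }
    exists I, I'. split; [trivial|split; [trivial|split; [trivial|split; [trivial|]]]].
    intros y Hy. destruct (BI y Hy) as [b1 b2]. split.
    + apply Rle_trans with (CD * (4 * 2 ^ k * C) * X * / INR N); [|apply Mono; lra].
      eapply Rle_trans; [exact b1|].
      replace (2 * M * (q - p) ^ (k + 1)) with (2 * CD * (r * r ^ k)).
      2:{ unfold M, r. rewrite !Nat.add_1_r, <- !tech_pow_Rmult, !Rpow_mult_distr. ring. }
      replace (CD * (4 * 2 ^ k * C) * X * / INR N)
        with (2 * CD * (2 * (C / INR N) * (2 ^ k * X))) by (unfold Rdiv; ring).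
      apply Rmult_le_compat_l; [lra|]. apply Rmult_le_compat; trivial. now apply pow_le.
    + apply Rle_trans with (CD * (4 * 2 ^ k) * X * d); [|apply Mono; lra].
      apply Rle_trans with (eps * (2 * M * (q - p) ^ k)); [apply Rmult_le_compat_l; lra|].
      replace (eps * (2 * M * (q - p) ^ k)) with (2 * CD * (r ^ k * D j)).
      2:{ unfold M, r. rewrite !Nat.add_1_r, <- !tech_pow_Rmult, !Rpow_mult_distr. field. lra. }
      replace (CD * (4 * 2 ^ k) * X * d) with (2 * CD * (2 ^ k * X * (2 * d))) by ring.
      apply Rmult_le_compat_l; [lra|]. apply Rmult_le_compat; trivial; try lra. now apply pow_le.
Qed.

Lemma cell_approximation_exists (k : nat) (alpha C CD : R) :
  (1 <= k)%nat -> 0 < alpha -> 1 <= C -> 0 < CD ->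
  exists K0, 0 < K0 /\
  forall (eps : R) (x D : nat -> R) (N n : nat) (U v : R -> R) (S E : nat -> R -> R),
    0 < eps <= 1 -> N = (2 * n)%nat ->
    graded_mesh k alpha C eps x D N n -> layer_decomposition k alpha CD eps U v S E ->
    exists pn zn : nat -> R, pn 0%nat = 0 /\ pn N = 0 /\
      (forall j, (j <= N)%nat ->
         zn j ^ 2 <= penalty N j * ((K0 * / INR N ^ k) ^ 2 / INR N)) /\
      (forall j, (1 <= j <= N)%nat -> exists P P' Z Z',
        cell_approximation k N eps (K0 * / INR N ^ k) (penalty N (j - 1)) (penalty N j)
          (x (j - 1)%nat) (x j) (pn (j - 1)%nat) (pn j) (zn (j - 1)%nat) (zn j) U v P P' Z Z').
Proof.
  intros Hk Ha HC HCD.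
  set (K2 := CD * (2 * C + (1 + C) * C + 4 * 2 ^ k * C + 4 * 2 ^ k)).
  assert (P2 : 0 < 2 ^ k) by (apply pow_lt; lra).
  assert (P2C : 0 < 2 ^ k * C) by (apply Rmult_lt_0_compat; lra).
  assert (PCC : 0 < (1 + C) * C) by (apply Rmult_lt_0_compat; lra).
  assert (PK2 : 0 < K2) by (unfold K2; apply Rmult_lt_0_compat; lra).
  assert (Pia : 0 < / alpha) by now apply Rinv_0_lt_compat.
  assert (PCDC : 0 < CD * C) by (apply Rmult_lt_0_compat; lra).
  assert (PCk : 0 < C ^ k) by (apply pow_lt; lra).
  (* [Ka] is what the smooth part requires on every cell; [Kb] is added for the transition cell and
     [Kc] for the later layer cells. *)
  set (Ka := C * (4 * CD * C ^ k)). set (Kb := CD * C * C ^ k * (/ alpha + 2)).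
  set (Kc := C * ((K2 + CD * C) * C ^ k)).
  assert (PDk : 0 < 4 * CD * C ^ k) by (apply Rmult_lt_0_compat; lra).
  assert (PKa : 0 < Ka) by (apply Rmult_lt_0_compat; lra).
  assert (PDCk : 0 < CD * C * C ^ k) by (apply Rmult_lt_0_compat; lra).
  assert (PKb : 0 < Kb) by (apply Rmult_lt_0_compat; lra).
  assert (PKc : 0 < Kc).
  { unfold Kc. apply Rmult_lt_0_compat; [lra|]. apply Rmult_lt_0_compat; lra. }
  exists (Ka + Kb + Kc). split; [lra|].
  intros eps x D N n U v S E He HNn Hg Hd.
  assert (HN := gm_N Hg). assert (Hx := gm_mesh Hg).
  assert (HNR := INR_ge_1 N ltac:(lia)).
  assert (Hin : 0 < / INR N) by (apply Rinv_0_lt_compat; lra).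
  assert (Hin1 := Rinv_le_1 _ HNR).
  assert (EX : (C / INR N) ^ k = C ^ k * / INR N ^ k)
    by (unfold Rdiv; rewrite Rpow_mult_distr, pow_inv; reflexivity).
  set (Y := / INR N ^ k) in *.
  assert (PY : 0 < Y) by (apply Rinv_0_lt_compat, pow_lt; lra).
  set (K := (Ka + Kb + Kc) * Y).
  assert (PaY : 0 < Ka * Y) by now apply Rmult_lt_0_compat.
  assert (PbY : 0 < Kb * Y) by now apply Rmult_lt_0_compat.
  assert (PcY : 0 < Kc * Y) by now apply Rmult_lt_0_compat.
  assert (PiY : 0 < CD * C * C ^ k * Y * / alpha)
    by (repeat apply Rmult_lt_0_compat; trivial; lra).
  assert (PKN : 0 <= K ^ 2 / INR N).
  { apply Rmult_le_pos; [apply pow2_ge_0 | lra]. }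
  (* [E] enters the nodal values from node n + 2 on; since n + 2 <= N, the last of them is S(1) +
     E(1) = 0. *)
  exists (fun j => S 0%nat (x j) + (if (j <=? n + 1)%nat then 0 else E 0%nat (x j))).
  (* The second formula also gives 0 at [n], so it fits the coarse side, where there is no layer
     part; beyond n + 1 it reduces to - E(tau). *)
  exists (fun j => if (j <=? n)%nat then 0
    else E 0%nat (x j) - (if (j <=? n + 1)%nat then 0 else E 0%nat (x j)) - E 0%nat (x n)).
  split; [|split; [|split]].
  - simpl. rewrite (mesh_0 x N Hx), (dec_S_0 Hd).
    destruct (Nat.leb_spec 0 (n + 1)); [ring | lia].
  - destruct (Nat.leb_spec N (n + 1)); [lia|].
    rewrite (mesh_N x N Hx). apply (dec_1 Hd).
  - intros j Hj. destruct (Nat.leb_spec j n) as [Hjn|Hjn].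
    + rewrite (penalty_coarse N n) by lia. simpl (0 ^ 2). lra.
    + rewrite (penalty_layer N n) by lia. apply node_bound_layer; [lia|].
      destruct (eps_pow_le k alpha C eps x D N n He Hg k) as [e1 e2].
      destruct (decomposition_E_before k alpha C CD eps x D N n U v S E (x n)) as [Et _];
        trivial; [lra | assert (H := mesh_range x N n Hx ltac:(lia)); lra |].
      assert (t0 : CD * eps ^ (k + 1) <= CD * (C / INR N) ^ k) by (apply Rmult_le_compat_l; lra).
      assert (t1 : CD * (C / INR N) ^ k <= CD * C * C ^ k * Y).
      { rewrite EX. assert (0 <= (C - 1) * (CD * (C ^ k * Y))).
        { apply Rmult_le_pos; [lra|]. repeat apply Rmult_le_pos; lra. } lra. }
      eapply Rle_trans; [apply Rabs_minus_le|].
      assert (t2 : Rabs (E 0%nat (x j) - (if (j <=? n + 1)%nat then 0 else E 0%nat (x j)))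
        <= CD * C * C ^ k * Y).
      { destruct (Nat.leb_spec j (n + 1)) as [Hj2|Hj2].
        - rewrite Rminus_0_r. replace j with (n + 1)%nat by lia.
          eapply Rle_trans; [apply (dec_E_bound Hd); [lia|]|].
          + apply (mesh_range x N); trivial; lia.
          + rewrite pow_O, Rmult_1_r, !Rmult_assoc. apply Rmult_le_compat_l; [lra|].
            eapply Rle_trans; [apply (gm_decay Hg); lia|].
            apply Rle_trans with ((C / INR N) ^ (k + 1)).
            * apply pow_incr. assert (H1 := gm_D_n1 Hg).
              assert (H2 := gm_D_range Hg (n + 1)%nat ltac:(lia)). lra.
            * rewrite Nat.add_1_r, <- tech_pow_Rmult, EX. unfold Rdiv.
              apply Rmult_le_compat_r; [apply Rmult_le_pos; lra|].
              assert (C * / INR N <= C * 1) by (apply Rmult_le_compat_l; lra). lra.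
        - rewrite Rminus_diag, Rabs_R0. repeat apply Rmult_le_pos; lra. }
      unfold K, Kb in *. lra.
  - intros j Hj.
    destruct (Nat.leb_spec j n) as [Hjn|Hjn].
    + destruct (Nat.leb_spec (j - 1) n); [|lia]. destruct (Nat.leb_spec (j - 1) (n + 1)); [|lia].
      destruct (Nat.leb_spec j (n + 1)); [|lia]. rewrite !Rplus_0_r.
      apply (coarse_cell k alpha C CD eps K x D N n U v S E j); trivial; try lia.
      rewrite EX. unfold K, Ka in *. lra.
    + destruct (Nat.eq_dec j (n + 1)) as [->|Hj2].
      * replace (n + 1 - 1)%nat with n by lia.
        destruct (Nat.leb_spec n n); [|lia]. destruct (Nat.leb_spec n (n + 1)); [|lia].
        destruct (Nat.leb_spec (n + 1) (n + 1)); [|lia].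
        rewrite !Rplus_0_r, Rminus_0_r.
        apply (transition_cell k alpha C CD eps K x D N n U v S E); trivial; try lia.
        rewrite EX. unfold K, Ka, Kb in *. lra.
      * destruct (Nat.leb_spec (j - 1) n); [lia|].
        replace (j <=? n + 1)%nat with false by (symmetry; apply Nat.leb_gt; lia).
        destruct (layer_interpolant k alpha C CD eps x D N n U v S E j)
          as [Pi [Pi' [PPi [DPi [Pl [Pr BPi]]]]]]; trivial; [lia|].
        apply (layer_cell k alpha C CD eps K K2 _ _ x D N n U v Pi Pi' S E j); trivial; try lra; try lia.
        rewrite EX. assert (0 <= (C - 1) * (4 * CD * C ^ k * Y)).
        { apply Rmult_le_pos; [lra|]. apply Rmult_le_pos; lra. }
        unfold K, Ka, Kc in *. lra.
Qed.

(** * Large [eps] and the conclusion *)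

Lemma penalty_ge_1 (N j : nat) : (1 <= N)%nat -> 1 <= penalty N j.
Proof.
  intros HN. unfold penalty. destruct (j <=? N / 2)%nat; [lra|].
  apply pow_R1_Rle. change 1 with (INR 1). now apply le_INR.
Qed.

Lemma zero_cell_approximation (k N : nat) (eps K0 mul mur p q : R) (U v : R -> R) :
  (1 <= N)%nat -> 0 < eps <= 1 -> 0 <= K0 -> 1 <= mul -> 1 <= mur -> p <= q ->
  (forall y, p <= y <= q -> Rabs (U y) <= K0 /\ Rabs (v y) <= K0) ->
  exists P P' Z Z', cell_approximation k N eps (K0 * INR N) mul mur p q 0 0 0 0 U v P P' Z Z'.
Proof.
  intros HN He HK Hl Hr Hpq HB.
  assert (HNR := INR_ge_1 N HN).
  assert (K0N : K0 <= K0 * INR N).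
  { assert (0 <= K0 * (INR N - 1)) by (apply Rmult_le_pos; lra). lra. }
  assert (E : (K0 * INR N) ^ 2 / INR N = K0 ^ 2 * INR N) by (field; lra).
  assert (PK : K0 ^ 2 <= K0 ^ 2 * INR N).
  { assert (0 <= K0 ^ 2 * (INR N - 1)) by (apply Rmult_le_pos; [apply pow2_ge_0 | lra]). lra. }
  assert (PK2 := pow2_ge_0 K0).
  assert (I0 : @eq R (RInt (fun _ => 0 ^ 2) p q) 0) by (rewrite RInt_constR; simpl; ring).
  assert (Hnode : forall mu y, 1 <= mu -> p <= y <= q ->
     (eps * (v y - 0)) ^ 2 <= mu * ((K0 * INR N) ^ 2 / INR N)).
  { intros mu y Hmu Hy. rewrite E, Rminus_0_r. destruct (HB y Hy) as [_ b].
    apply Rabs_le_sqr in b.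
    assert (H := sqr_mult_le eps (v y) 1 (K0 ^ 2)).
    assert (e1 : eps ^ 2 <= 1) by (assert (H1 := sqr_le_self eps); lra).
    specialize (H e1 b).
    assert (0 <= (mu - 1) * (K0 ^ 2 * INR N)) by (apply Rmult_le_pos; lra). lra. }
  exists (fun _ => 0), (fun _ => 0), (fun _ => 0), (fun _ => 0). split; trivial.
  - apply is_poly_const.
  - intros; apply is_derive_const0.
  - intros; split; [apply is_derive_const0 | apply continuous_const].
  - intros y Hy. destruct (HB y Hy). rewrite !Rminus_0_r. lra.
  - rewrite I0, E. apply Rmult_le_pos; lra.
  - rewrite I0, E. lra.
  - apply Hnode; trivial; lra.
  - apply Hnode; trivial; lra.
Qed.

(** The expansions divide by [b] on a whole neighbourhood. Continuity at the two endpoints provides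
    it, [b] being at least [alpha] in between. *)
Lemma nonzero_near_unit (b : R -> R) (alpha : R) :
  0 < alpha -> (forall x, continuous b x) -> (forall x, 0 <= x <= 1 -> alpha <= b x) ->
  exists d, 0 < d /\ forall x, dom d x -> b x <> 0.
Proof.
  intros Ha Hc Hb.
  assert (H : forall x0, 0 <= x0 <= 1 -> exists d, 0 < d /\ forall x, Rabs (x - x0) < d -> 0 < b x).
  { intros x0 H0. destruct (Hc x0 (ball (b x0) (mkposreal alpha Ha))) as [d Hd].
    - apply locally_ball.
    - exists d. split; [apply cond_pos|]. intros x Hx. specialize (Hd x Hx).
      apply ball_Rabs in Hd; simpl in Hd.
      apply Rabs_def2 in Hd. assert (Hb0 := Hb x0 H0). lra. }
  destruct (H 0 ltac:(lra)) as [d0 [P0 H0]]. destruct (H 1 ltac:(lra)) as [d1 [P1 H1]].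
  exists (Rmin d0 d1). split; [now apply Rmin_pos|]. intros x Hx. unfold dom in Hx.
  assert (M0 := Rmin_l d0 d1). assert (M1 := Rmin_r d0 d1).
  apply Rgt_not_eq. destruct (Rlt_dec x 0) as [Hx0|Hx0].
  - apply H0. rewrite Rminus_0_r, Rabs_left; lra.
  - destruct (Rlt_dec 1 x) as [Hx1|Hx1].
    + apply H1. rewrite Rabs_right; lra.
    + assert (alpha <= b x) by (apply Hb; lra). lra.
Qed.

Theorem theorem4 :
  forall k : nat, (1 <= k)%nat ->
  exists m : nat,
  forall (sigma alpha gamma C0 : R) (b b' c f : R -> R),
    INR k + 1 <= sigma ->
    0 < alpha -> 0 < gamma ->
    Cm_unit m b -> Cm_unit m c -> Cm_unit m f ->
    is_derivative_on_unit b b' ->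
    (forall x, unit_interval x -> alpha <= b x) ->
    (forall x, unit_interval x -> gamma <= c x - b' x / 2) ->
  exists C : R, 0 < C /\
  forall (eps : R) (N : nat) (u uN : R -> R),
    0 < eps < 1 ->
    (4 <= N)%nat -> Nat.Even N ->
    1 / 2 <= tau sigma alpha eps ->
    eps <= C0 * / INR N ->
    solves_bvp eps b c f u ->
    nipg_solution eps b c f (penalty N) (mesh sigma alpha eps N) N k uN ->
    nipg_norm eps gamma b (penalty N) (mesh sigma alpha eps N) N
      (fun x => u x - uN x)
    <= C * / INR N ^ k.
Proof.
  (* k + 2 orders of expansion at one derivative each, and k + 2 derivatives left of the result; one
     more because the derivative of [b] is a coefficient of the amplitude equation. *)
  intros k Hk. exists (S (k + 2 + (k + 2))).
  intros sigma alpha gamma C0 b b' c f Hs Ha Hg Hb Hc Hf Hb' Hba Hcg.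
  destruct (Cm_unit_extends _ b Hb) as [be [Eb Cb]].
  destruct (Cm_unit_extends _ c Hc) as [ce [Ec Cc]].
  destruct (Cm_unit_extends _ f Hf) as [fe [Ef Cf]].
  assert (cont : forall g n, (forall d, Cn d n g) -> forall x, continuous g x).
  { intros g n H x. apply (Cn_cont (Rabs x + 1) n g (H _)). unfold dom.
    assert (H1 := Rle_abs x). assert (H2 := Rle_abs (- x)). rewrite Rabs_Ropp in H2. lra. }
  assert (cb := cont be _ Cb). assert (cc := cont ce _ Cc). assert (cf := cont fe _ Cf).
  assert (Hbe : forall x, 0 <= x <= 1 -> alpha <= be x) by (intros; rewrite Eb; auto).
  destruct (nonzero_near_unit be alpha Ha cb Hbe) as [d [Hd Hnz]].
  destruct (Cb d) as [b1 [Db1 Cb1]].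
  assert (Du : forall x, 0 <= x <= 1 -> dom d x) by (unfold dom; intros; lra).
  destruct (bounded_unit be) as [Bb [PBb HBb]]; [intros x _; apply cb|].
  destruct (bounded_unit b1) as [B1 [PB1 HB1]]; [intros x Hx; apply (Cn_cont _ _ _ Cb1); auto|].
  destruct (bounded_unit ce) as [Bc [PBc HBc]]; [intros x _; apply cc|].
  destruct (bounded_unit fe) as [Bf [PBf HBf]]; [intros x _; apply cf|].
  assert (Hco : coefficients be b1 ce gamma (Bb + B1 + Bc)).
  { split; trivial.
    - intros y Hy; auto.
    - intros y Hy; apply (Cn_cont _ _ _ Cb1); auto.
    - intros y _; apply cc.
    - intros y Hy. assert (H := Hbe y Hy). lra.
    - intros y Hy. assert (H := HBb y Hy). lra.
    - intros y Hy. assert (H := HB1 y Hy). lra.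
    - intros y Hy. assert (H := HBc y Hy). lra.
    - intros y Hy. assert (Hyu : unit_interval y) by (unfold unit_interval; lra).
      replace (b1 y) with (b' y); [rewrite Ec by trivial; now apply Hcg|].
      assert (D1 : is_derive be y (b' y)).
      { apply is_derive_ext_loc with b; [|apply D_in_is_derive; auto].
        assert (Hm : 0 < Rmin y (1 - y)) by (apply Rmin_pos; lra).
        exists (mkposreal _ Hm). intros t Ht. symmetry; apply Eb.
        apply ball_Rabs in Ht; simpl in Ht.
        assert (H1 := Rmin_l y (1 - y)). assert (H2 := Rmin_r y (1 - y)).
        apply Rabs_def2 in Ht. unfold unit_interval; lra. }
      assert (D2 := Db1 y (Du y ltac:(lra))). apply is_derive_unique in D1, D2. congruence. }
  destruct (nipg_error_of_cell_approximation gamma _ be b1 ce fe b c f Hco) as [C1 [PC1 HC1]];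
    [intros y _; apply cf | intros; symmetry; auto | intros; symmetry; auto
    | intros; symmetry; auto |].
  destruct (bakhvalov_graded_mesh k sigma alpha C0 Hs Ha) as [C2 [PC2 HC2]].
  destruct (layer_decomposition_exists k d alpha gamma _ be b1 ce fe Hk Hd Ha Hco Hbe Hnz Db1)
    as [CD [PCD HCD]]; trivial; [apply Cn_pred, Cb | apply Cn_pred, Cc | apply Cn_pred, Cf |].
  destruct (cell_approximation_exists k alpha C2 CD Hk Ha PC2 PCD) as [K0 [PK0 HK0]].
  destruct (a_priori_bound gamma _ be b1 ce Hco) as [Cp [PCp HCp]].
  (* The factor 4 bounds eps^-2 when eps > 1/2. *)
  set (C4 := 4 * (Cp * Bf)).
  assert (PCB : 0 < Cp * Bf) by now apply Rmult_lt_0_compat.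
  assert (P4 : 0 <= C4 * (2 * Rabs C0) ^ (k + 1)).
  { apply Rmult_le_pos; [unfold C4; lra|]. apply pow_le. assert (H := Rabs_pos C0). lra. }
  (* Sum of the constants for small and for large [eps]. In the second case eps <= C0 / N forces N
     <= 2 |C0|, and [C4 * N] is compared with N^-k through N^(k+1). *)
  exists (C1 * (K0 + C4 * (2 * Rabs C0) ^ (k + 1))).
  split; [apply Rmult_lt_0_compat; lra|].
  intros eps N u uN He HN HE Ht HeN Hu HuN.
  assert (HNR := INR_ge_1 N ltac:(lia)).
  assert (Hkp := pos_INR k).
  assert (Hm : is_mesh (mesh sigma alpha eps N) N) by (apply bakhvalov_mesh; trivial; lra).
  destruct (bvp_solution_extends eps b c f be ce fe u ltac:(lra) cb cc cf Eb Ec Ef Hu)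
    as [U [v [EU [DU Dv]]]].
  assert (U0 : U 0 = 0) by (rewrite EU by (unfold unit_interval; lra); apply Hu).
  assert (U1 : U 1 = 0) by (rewrite EU by (unfold unit_interval; lra); apply Hu).
  assert (Hmu : forall j, (j <= N)%nat -> 0 < penalty N j).
  { intros j _. assert (H := penalty_ge_1 N j ltac:(lia)). lra. }
  assert (PNk : 0 < / INR N ^ k) by (apply Rinv_0_lt_compat, pow_lt; lra).
  assert (Hfin : forall K, 0 <= K -> K <= (K0 + C4 * (2 * Rabs C0) ^ (k + 1)) * / INR N ^ k ->
     C1 * K <= C1 * (K0 + C4 * (2 * Rabs C0) ^ (k + 1)) * / INR N ^ k).
  { intros K _ HK. rewrite Rmult_assoc. apply Rmult_le_compat_l; lra. }
  (* Up to 1/2 the step of [D] is at least 1 / N, on which the graded bounds rest. *)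
  destruct (Rle_lt_dec eps (1 / 2)) as [Hsm|Hlg].
  - destruct HE as [n Hn].
    assert (Hgm := HC2 eps N n ltac:(lra) Hn HN Ht HeN).
    destruct (HCD eps U v ltac:(lra) DU Dv U0 U1) as [S [E Hdec]].
    destruct (HK0 eps _ _ N n U v S E ltac:(lra) Hn Hgm Hdec) as [pn [zn [p0 [pN [Hzn Hcells]]]]].
    apply Rle_trans with (C1 * (K0 * / INR N ^ k)).
    + apply (HC1 k N eps _ (penalty N) (mesh sigma alpha eps N) pn zn u uN U v); trivial; try lra.
      apply Rmult_le_pos; lra.
    + apply Hfin; [apply Rmult_le_pos; lra | apply Rmult_le_compat_r; lra].
  - assert (HN2 : INR N <= 2 * Rabs C0).
    { assert (H := Rle_abs C0). apply Rmult_le_compat_r with (r := INR N) in HeN; [|lra].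
      rewrite Rmult_assoc, Rinv_l, Rmult_1_r in HeN by lra.
      assert (1 / 2 * INR N <= eps * INR N) by (apply Rmult_le_compat_r; lra). lra. }
    assert (BU : forall y, 0 <= y <= 1 -> Rabs (U y) <= C4 /\ Rabs (v y) <= C4).
    { intros y Hy.
      assert (Hq : Cp * Bf / eps ^ 2 <= C4).
      { unfold C4. apply Rmult_le_reg_r with (eps ^ 2); [apply pow_lt; lra|].
        unfold Rdiv. rewrite Rmult_assoc, Rinv_l, Rmult_1_r by (apply pow_nonzero; lra).
        assert (1 <= 4 * eps ^ 2).
        { assert ((1 / 2) ^ 2 <= eps ^ 2) by (apply pow_incr; lra). lra. }
        assert (0 <= Cp * Bf * (4 * eps ^ 2 - 1)) by (apply Rmult_le_pos; lra). lra. }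
      destruct (HCp eps Bf U v fe ltac:(lra) PBf) with (y := y) as [a1 a2]; trivial.
      - intros z _; apply cf.
      - lra. }
    apply Rle_trans with (C1 * (C4 * INR N)).
    + assert (PK : 0 <= C4 * INR N) by (apply Rmult_le_pos; unfold C4; lra).
      apply (HC1 k N eps _ (penalty N) (mesh sigma alpha eps N) (fun _ => 0) (fun _ => 0) u uN U v);
        trivial; try lra.
      * intros j Hj. simpl (0 ^ 2). rewrite Rmult_0_l.
        apply Rmult_le_pos; [left; now apply Hmu|].
        apply Rmult_le_pos; [apply pow2_ge_0 | left; apply Rinv_0_lt_compat; lra].
      * intros j Hj. assert (Hlt := mesh_lt _ _ Hm j Hj).
        apply zero_cell_approximation; try lra; try (apply penalty_ge_1; lia); try lia.
        -- unfold C4; lra.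
        -- intros y Hy. apply BU. now apply cell_unit with (mesh sigma alpha eps N) N j.
    + apply Hfin; [apply Rmult_le_pos; unfold C4; lra|].
      apply Rle_trans with (C4 * (2 * Rabs C0) ^ (k + 1) * / INR N ^ k);
        [|apply Rmult_le_compat_r; lra].
      rewrite Rmult_assoc. apply Rmult_le_compat_l; [unfold C4; lra|].
      apply Rmult_le_reg_r with (INR N ^ k); [apply pow_lt; lra|].
      rewrite Rmult_assoc, Rinv_l, Rmult_1_r by (apply pow_nonzero; lra).
      rewrite tech_pow_Rmult, <- Nat.add_1_r. apply pow_incr. lra.
Qed.
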